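(* Let $k$ be a commutative ring and $A$ an augmented dg $k$-algebra. Then the relative derived category $\mathcal D_{rel}A$ is triangle equivalent to the category of unital dg $A$-modules (with strictly unital morphisms of $A_\infty$-modules) up to strictly unital homotopy equivalences of $A_\infty$-modules.
   Context: $k$ is a commutative associative unital ring; graded means $\mathbf Z$-graded; $\otimes=\otimes_k$; Koszul sign rule. $A$ is a unital dg algebra with unit $\eta:k\to A$ and an augmentation (a unital dg algebra morphism $A\to k$); $\overline A$ denotes its kernel. Put $m_1=d_A$, $m_2$ the multiplication and $m_i=0$ for $i\ne1,2$. Relative derived category: $\mathcal CA$ is the category of unital right dg $A$-modules; a relative quasi-isomorphism is a morphism whose mapping cone is contractible as a complex over $k$; $\mathcal D_{rel}A$ is the localization of $\mathcal CA$ at the relative quasi-isomorphisms (a triangle quotient of the homotopy category of unital dg $A$-modules). A (right) $A_\infty$-module over $A$ is a graded $k$-module $M$ with maps $m_i^M:M\otimes A^{\otimes(i-1)}\to M$, $i\ge1$, of degree $2-i$ with $\sum_{j+n+l=p}(-1)^{jn+l}m^M_{j+1+l}(\mathbf 1^{\otimes j}\otimes m_n\otimes\mathbf 1^{\otimes l})=0$, $p\ge1$ (where $m_n=m_n^A$ if $j>0$, $m_n=m_n^M$ if $j=0$). It is strictly unital if $m_2^M(\mathbf 1\otimes\eta)=\mathbf 1$ and $m_i^M$, $i\ge3$, vanishes when $\eta$ is inserted in any $A$-argument. Unital dg $A$-modules are the strictly unital ones with $m_i^M=0$ for $i\ge3$. A morphism $f:M\to N$ is a family $f_i:M\otimes A^{\otimes(i-1)}\to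 N$, $i\ge1$, of degree $1-i$ with $\sum_{j+n+l=p}(-1)^{jn+l}f_{j+1+l}(\mathbf 1^{\otimes j}\otimes m_n\otimes\mathbf 1^{\otimes l})=\sum_{r+q=p}m^N_{q+1}(f_r\otimes\mathbf 1^{\otimes q})$; composition $(fg)_p=\sum_{n+l=p}f_{1+l}(g_n\otimes\mathbf 1^{\otimes l})$. A homotopy from $f$ to $g$ is a family $h_i:M\otimes A^{\otimes(i-1)}\to N$ of degree $-i$ with $f_p-g_p=\sum_{r+q=p}(-1)^qm^N_{1+q}(h_r\otimes\mathbf 1^{\otimes q})+\sum_{j+n+l=p}(-1)^{jn+l}h_{j+1+l}(\mathbf 1^{\otimes j}\otimes m_n\otimes\mathbf 1^{\otimes l})$. A morphism or homotopy is strictly unital if its components with $i\ge2$ vanish when $\eta$ is inserted in any $A$-argument. The category ''up to strictly unital homotopy equivalences'' is the stable category of the full subcategory of $\mathrm{Mod}_\infty A$ (strictly unital $A_\infty$-modules, strictly unital morphisms) formed by the unital dg $A$-modules, i.e. morphisms are taken modulo strictly unital homotopy; here $\mathrm{Mod}_\infty A$ is a Frobenius category with structure inherited, via restriction to $\overline A$ and the fully faithful bar construction, from counital dg comodules over $B\overline A$ (conflations: sequences split as graded comodules after bar construction), and triangles are induced by this structure. *)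

(* Defs.v *)
From HB Require Import structures.
From mathcomp Require Import all_boot all_order all_algebra.
From mathcomp Require Import zify.

Set Implicit Arguments.
Unset Strict Implicit.
Unset Printing Implicit Defensive.

Import GRing.Theory.
Local Open Scope ring_scope.

Lemma lin0 (k : pzRingType) (U V : lmodType k) (f : U -> V) :
  linear f -> f 0 = 0.
Proof.
move=> fl; have := fl 1 0 0; rewrite !scale1r addr0 => h.
by apply: (addIr (f 0)); rewrite -h add0r.
Qed.

Lemma linD (k : pzRingType) (U V : lmodType k) (f : U -> V) :
  linear f -> {morph f : x y / x + y}.
Proof. by move=> fl x y; have := fl 1 x y; rewrite !scale1r. Qed.

Lemma linZ (k : pzRingType) (U V : lmodType k) (f : U -> V) :
  linear f -> forall c, {morph f : x / c *: x}.
Proof. by move=> fl c x; have := fl c x 0; rewrite (lin0 fl) !addr0. Qed.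

Lemma linB (k : pzRingType) (U V : lmodType k) (f : U -> V) :
  linear f -> {morph f : x y / x - y}.
Proof.
by move=> fl x y; rewrite -scaleN1r addrC fl scaleN1r addrC.
Qed.

Lemma linN (k : pzRingType) (U V : lmodType k) (f : U -> V) :
  linear f -> {morph f : x / - x}.
Proof. by move=> fl x; rewrite -scaleN1r (linZ fl) scaleN1r. Qed.

Lemma lin_sum (k : pzRingType) (U V : lmodType k) (f : U -> V)
    (I : Type) (r : seq I) (F : I -> U) :
  linear f -> f (\sum_(i <- r) F i) = \sum_(i <- r) f (F i).
Proof.
move=> fl; elim: r => [|a r IH]; rewrite ?big_nil ?(lin0 fl) //.
by rewrite !big_cons (linD fl) IH.
Qed.

Definition ksgn (k : comPzRingType) (z : int) : k := (-1) ^+ `|z|%N.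
Arguments ksgn {k} z.

Lemma ksgnD (k : comPzRingType) a b : ksgn (a + b) = ksgn a * ksgn b :> k.
Proof.
rewrite /ksgn -signr_odd (_ : odd _ = odd `|a| (+) odd `|b|); last by lia.
by rewrite signr_addb !signr_odd.
Qed.

Lemma ksgn_odd (k : comPzRingType) a b :
  odd `|a| = odd `|b| -> ksgn a = ksgn b :> k.
Proof. by move=> h; rewrite /ksgn -signr_odd h signr_odd. Qed.

Lemma ksgn0 (k : comPzRingType) : ksgn 0 = 1 :> k.
Proof. by rewrite /ksgn expr0. Qed.

Lemma ksgn1 (k : comPzRingType) : ksgn 1 = -1 :> k.
Proof. by rewrite /ksgn expr1. Qed.

Lemma ksgn_even (k : comPzRingType) a : ~~ odd `|a| -> ksgn a = 1 :> k.
Proof. by move=> h; rewrite -(ksgn0 k); apply: ksgn_odd; lia. Qed.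

Lemma ksgn_oddN (k : comPzRingType) a : odd `|a| -> ksgn a = -1 :> k.
Proof. by move=> h; rewrite -(ksgn1 k); apply: ksgn_odd; lia. Qed.

(* All the ways of writing s as u ++ v. *)
Fixpoint splits (T : Type) (s : seq T) : seq (seq T * seq T) :=
  if s is a :: s' then
    ([::], s) :: [seq (a :: uv.1, uv.2) | uv <- splits s']
  else [:: ([::], [::])].
Arguments splits : simpl never.

Lemma splits_cat (T : eqType) (s : seq T) uv : uv \in splits s -> uv.1 ++ uv.2 = s.
Proof.
elim: s uv => [|a s IH] uv; rewrite /splits -/splits inE; first by move/eqP->.
case/orP => [/eqP-> //|/mapP [w /IH h ->]] /=; by rewrite h.
Qed.

Lemma splits_map (T U : Type) (f : T -> U) (s : seq T) :
  splits (map f s) = [seq (map f uv.1, map f uv.2) | uv <- splits s].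
Proof.
by elim: s => [|a s IH] //; rewrite /splits /= -/splits IH -!map_comp.
Qed.

Section Sums.
Variables (V : nmodType) (T : Type).
Implicit Types s u v : seq T.

Lemma sum_splits_nil (F : seq T * seq T -> V) :
  \sum_(uv <- splits [::]) F uv = F ([::], [::]).
Proof. by rewrite big_seq1. Qed.

Lemma sum_splits_cons a s (F : seq T * seq T -> V) :
  \sum_(uv <- splits (a :: s)) F uv =
  F ([::], a :: s) + \sum_(uv <- splits s) F (a :: uv.1, uv.2).
Proof. by rewrite /splits -/splits big_cons big_map. Qed.

Lemma sum_splits_coassoc s (F : seq T -> seq T -> seq T -> V) :
  \sum_(ab <- splits s) \sum_(cd <- splits ab.1) F cd.1 cd.2 ab.2 =
  \sum_(ab <- splits s) \sum_(cd <- splits ab.2) F ab.1 cd.1 cd.2.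
Proof.
elim: s F => [|a s IH] F; first by rewrite !big_seq1.
rewrite !sum_splits_cons big_seq1 /=.
have -> : \sum_(uv <- splits s)
    \sum_(cd <- splits (a :: uv.1)) F cd.1 cd.2 uv.2 =
  \sum_(uv <- splits s) F [::] (a :: uv.1) uv.2 +
  \sum_(uv <- splits s) \sum_(cd <- splits uv.1) F (a :: cd.1) cd.2 uv.2.
  by rewrite -big_split; apply: eq_bigr => uv _; rewrite sum_splits_cons.
rewrite (IH (fun x => F (a :: x))) addrA; congr (_ + _).
Qed.

Lemma sum_splits_cat u z v (F : seq T * seq T -> V) :
  \sum_(uv <- splits (u ++ z :: v)) F uv =
  \sum_(ab <- splits u) F (ab.1, ab.2 ++ z :: v) +
  \sum_(ab <- splits v) F (u ++ z :: ab.1, ab.2).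
Proof.
elim: u F => [|a u IH] F; first by rewrite sum_splits_cons sum_splits_nil.
by rewrite cat_cons !sum_splits_cons IH addrA.
Qed.

Lemma sum_splits_last s (F : seq T -> seq T -> V) :
  (forall u v, (0 < size v)%N -> F u v = 0) ->
  \sum_(uv <- splits s) F uv.1 uv.2 = F s [::].
Proof.
elim: s F => [|a s IH] F h; first by rewrite sum_splits_nil.
by rewrite sum_splits_cons h // add0r (IH (fun u v => F (a :: u) v)) // => *; apply: h.
Qed.

Lemma sum_splits_first s (F : seq T -> seq T -> V) :
  (forall u v, (0 < size u)%N -> F u v = 0) ->
  \sum_(uv <- splits s) F uv.1 uv.2 = F [::] s.
Proof.
case: s => [|a s] h; first by rewrite sum_splits_nil.
by rewrite sum_splits_cons big1 ?addr0 // => *; apply: h.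
Qed.
End Sums.

(* A graded module is presented as the direct sum of its components,
   "gdeg n x" meaning that x belongs to the component of degree n. *)
Record gmod (k : comPzRingType) := GMod {
  gcar :> lmodType k;
  gdeg : int -> gcar -> Prop;
  gdeg0 : forall n, gdeg n 0;
  gdegL : forall n c x y, gdeg n x -> gdeg n y -> gdeg n (c *: x + y);
  gdeg_span : forall x, exists t : seq (int * gcar),
    {in t, forall q, gdeg q.1 q.2} /\ x = \sum_(q <- t) q.2;
  gdeg_indep : forall (s : seq int) (c : int -> gcar), uniq s ->
    (forall n, gdeg n (c n)) -> \sum_(n <- s) c n = 0 ->
    forall n, n \in s -> c n = 0 }.
Arguments gdeg {k g} n x.

(* Lists of homogeneous elements are carried around with their degrees. *)
Definition homog (k : comPzRingType) (M : gmod k) (t : seq (int * M)) : Prop :=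
  {in t, forall q, gdeg q.1 q.2}.

Definition vals (T : Type) (t : seq (int * T)) : seq T := map snd t.

Definition tdeg (T : Type) (t : seq (int * T)) : int := \sum_(q <- t) q.1.

Record dgAlg (k : comPzRingType) := DGAlg {
  alg :> gmod k;
  amul : alg -> alg -> alg;
  aone : alg;
  adiff : alg -> alg;
  amul_linl : forall b, linear (amul^~ b);
  amul_linr : forall a, linear (amul a);
  amul_deg : forall p q a b, gdeg p a -> gdeg q b -> gdeg (p + q) (amul a b);
  amulA : associative amul;
  aone_deg : gdeg 0 aone;
  amul1l : left_id aone amul;
  amul1r : right_id aone amul;
  adiff_lin : linear adiff;
  adiff_deg : forall p a, gdeg p a -> gdeg (p + 1) (adiff a);
  adiffK : forall a, adiff (adiff a) = 0;
  adiffM : forall p a b, gdeg p a ->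
    adiff (amul a b) = amul (adiff a) b + ksgn p *: amul a (adiff b) }.
Arguments aone {k d}.

(* A morphism of unital dg algebras from A to k, the latter being
   concentrated in degree 0 with zero differential. *)
Record augmentation (k : comPzRingType) (A : dgAlg k) := Augmentation {
  aug :> A -> k;
  aug_lin : forall c a b, aug (c *: a + b) = c * aug a + aug b;
  aug_deg : forall n a, gdeg n a -> n != 0 -> aug a = 0;
  aug1 : aug aone = 1;
  augM : forall a b, aug (amul a b) = aug a * aug b;
  aug_diff : forall a, aug (adiff a) = 0 }.

(* The operations m_n of A evaluated on a list of n elements; m_n = 0 for n
   other than 1 and 2, including n = 0. *)
Definition mA (k : comPzRingType) (A : dgAlg k) (s : seq A) : A :=
  match s with
  | [:: a] => adiff a
  | [:: a; b] => amul a b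
  | _ => 0
  end.

Section Families.
Variables (k : comPzRingType) (A : dgAlg k).

(* A family of maps f_i : M (x) A^(i-1) -> N, i >= 1, is a single function f
   taking the A-arguments as a list: f_i (x (x) a_1 (x) ... (x) a_(i-1)) is
   f x [:: a_1; ...; a_(i-1)].  It has degree e when f_i has degree e + 1 - i:
   e = 1 for A_oo-structures, 0 for morphisms, -1 for homotopies. *)
Record is_family (M N : gmod k) (e : int) (f : M -> seq A -> N) : Prop :=
  IsFamily {
  fam_lin : forall s, linear (f^~ s);
  fam_linA : forall x u v, linear (fun a => f x (u ++ a :: v));
  fam_deg : forall p x t, gdeg p x -> homog t ->
    gdeg (p + tdeg t + e - (size t)%:Z) (f x (vals t)) }.

Definition strictly_unital (M N : gmod k) (f : M -> seq A -> N) : Prop :=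
  forall x s, aone \in s -> f x s = 0.

(* sum over r + q = p of (-1)^(e q) f_(1+q) (g_r (x) 1^q) *)
Definition famcomp (e : int) (L M N : gmod k)
    (f : M -> seq A -> N) (g : L -> seq A -> M) (x : L) (s : seq A) : N :=
  \sum_(uv <- splits s) ksgn (e * (size uv.2)%:Z) *: f (g x uv.1) uv.2.

(* sum over j + n + l = p, j >= 1, of (-1)^(j n + l) f (1^j (x) m_n^A (x) 1^l)
   evaluated at x (x) t where x has degree p: here j - 1, n, l are the lengths
   of u, w, v, where t = u ++ w ++ v, and the Koszul rule moves m_n, of degree
   2 - n, past x and u. *)
Definition aop (M N : gmod k) (f : M -> seq A -> N)
    (p : int) (x : M) (t : seq (int * A)) : N :=
  \sum_(ut <- splits t) \sum_(wv <- splits ut.2)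
    let: (u, w, v) := (ut.1, wv.1, wv.2) in
    ksgn ((1 + size u) * size w + size v)%:Z *:
    (ksgn ((2 - (size w)%:Z) * (p + tdeg u)) *:
     f x (vals u ++ mA (vals w) :: vals v)).

Implicit Types (L M N : gmod k).

Lemma homog_cat M (u v : seq (int * M)) :
  homog (u ++ v) <-> homog u /\ homog v.
Proof.
split=> [h|[hu hv] q]; last by rewrite mem_cat => /orP [/hu|/hv].
by split=> q hq; apply: h; rewrite mem_cat hq ?orbT.
Qed.

Lemma tdeg_cat (T : Type) (u v : seq (int * T)) : tdeg (u ++ v) = tdeg u + tdeg v.
Proof. by rewrite /tdeg big_cat. Qed.

Lemma vals_cat (T : Type) (u v : seq (int * T)) : vals (u ++ v) = vals u ++ vals v.
Proof. by rewrite /vals map_cat. Qed.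

Lemma size_vals (T : Type) (u : seq (int * T)) : size (vals u) = size u.
Proof. by rewrite /vals size_map. Qed.

Lemma gdegD M n (x y : M) : gdeg n x -> gdeg n y -> gdeg n (x + y).
Proof. by move=> hx hy; rewrite -(scale1r x); apply: gdegL. Qed.

Lemma gdegZ M n c (x : M) : gdeg n x -> gdeg n (c *: x).
Proof. by move=> hx; rewrite -(addr0 (c *: x)); apply: gdegL => //; apply: gdeg0. Qed.

Lemma gdeg_sum M n (I : eqType) (r : seq I) (F : I -> M) :
  (forall i, i \in r -> gdeg n (F i)) -> gdeg n (\sum_(i <- r) F i).
Proof.
move=> h; rewrite big_seq; elim/big_ind: _ => //; [exact: gdeg0 | exact: gdegD].
Qed.

Lemma sum_splits_vals (V : nmodType) (t : seq (int * A))
    (F : seq A * seq A -> V) :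
  \sum_(uv <- splits (vals t)) F uv =
  \sum_(uv <- splits t) F (vals uv.1, vals uv.2).
Proof. by rewrite /vals splits_map big_map. Qed.

Lemma compE e L M N (f : M -> seq A -> N) (g : L -> seq A -> M) x t :
  famcomp e f g x (vals t) =
  \sum_(uv <- splits t)
    ksgn (e * (size uv.2)%:Z) *: f (g x (vals uv.1)) (vals uv.2).
Proof. by rewrite /famcomp sum_splits_vals; apply: eq_bigr => uv _; rewrite size_vals. Qed.

Lemma linear_sum (U V : lmodType k) (I : Type) (r : seq I) (c : I -> k) (F : I -> U -> V) :
  (forall i, linear (F i)) -> linear (fun x => \sum_(i <- r) c i *: F i x).
Proof.
move=> h a x y; rewrite scaler_sumr -big_split; apply: eq_bigr => i _ /=.
by rewrite h scalerDr !scalerA mulrC.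
Qed.

Lemma comp_family e e' L M N (f : M -> seq A -> N) (g : L -> seq A -> M) c :
  is_family e' f -> is_family e g -> is_family (e' + e) (famcomp c f g).
Proof.
move=> hf hg; split.
- move=> s; apply: linear_sum => uv a x y.
  by rewrite (fam_lin hg) (fam_lin hf).
- move=> x u v b a1 a2; rewrite /famcomp !sum_splits_cat scalerDr addrACA !scaler_sumr -!big_split.
  congr (_ + _); apply: eq_bigr => ab _ /=.
    rewrite !size_cat /= (fam_linA hf) scalerDr !scalerA.
    by rewrite [b * _]mulrC.
  rewrite (fam_linA hg) (fam_lin hf) scalerDr !scalerA.
  by rewrite [b * _]mulrC.
- move=> p x t hx ht; rewrite compE; apply: gdeg_sum => -[u v] /splits_cat /= E.
  apply: gdegZ; move: ht; rewrite -E => /homog_cat [hu hv].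
  have := fam_deg hf (fam_deg hg hx hu) hv.
  congr gdeg; rewrite tdeg_cat size_cat; lia.
Qed.

Lemma comp_su L M N (f : M -> seq A -> N) (g : L -> seq A -> M) c e' e :
  is_family e' f -> is_family e g ->
  strictly_unital f -> strictly_unital g -> strictly_unital (famcomp c f g).
Proof.
move=> hf hg sf sg x s hs; rewrite /famcomp big_seq big1 // => -[u v] /splits_cat /= E.
move: hs; rewrite -E mem_cat => /orP [h|h].
  by rewrite (sg _ _ h) (lin0 (fam_lin hf _)) scaler0.
by rewrite (sf _ _ h) scaler0.
Qed.

Lemma comp_assoc e c L M N (P : gmod k) (f : N -> seq A -> P) (g : M -> seq A -> N)
    (h : L -> seq A -> M) e' : is_family e' f ->
  forall x s, famcomp c (famcomp e f g) h x s = famcomp (e + c) f (famcomp c g h) x s.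
Proof.
move=> hf x s; rewrite /famcomp.
under eq_bigr => uv _.
  rewrite scaler_sumr.
  under eq_bigr => ab _ do rewrite scalerA.
  over.
under [RHS]eq_bigr => uv _.
  rewrite (lin_sum _ _ (fam_lin hf _)) scaler_sumr.
  under eq_bigr => ab _ do rewrite (linZ (fam_lin hf _)) scalerA.
  over.
rewrite (sum_splits_coassoc s (fun a b d => (ksgn ((e + c) * (size d)%:Z) *
  ksgn (c * (size b)%:Z)) *: f (g (h x a) b) d)).
rewrite big_seq [RHS]big_seq; apply: eq_bigr => -[a q] _ /=.
rewrite big_seq [RHS]big_seq; apply: eq_bigr => -[b d] /splits_cat /= <-.
congr (_ *: _); rewrite -!ksgnD; apply: ksgn_odd; rewrite size_cat; lia.
Qed.

Lemma aop_comp (e c : int) L M N (f : M -> seq A -> N) (g : L -> seq A -> M) e' :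
  is_family e' f -> odd `|c| = odd `|e| ->
  forall p x t,
  aop (famcomp c f g) p x t =
  \sum_(uv <- splits t) ksgn ((c + 1) * (size uv.2)%:Z) *:
     f (aop g p x uv.1) (vals uv.2) +
  ksgn c *: \sum_(uv <- splits t) ksgn (c * (size uv.2)%:Z) *:
     aop f (p + tdeg uv.1 + e - (size uv.1)%:Z) (g x (vals uv.1)) uv.2.
Proof.
move=> hf ce p x t.
pose S (u w v : seq (int * A)) y : N := ksgn ((1 + size u) * size w + size v)%:Z *:
    (ksgn ((2 - (size w)%:Z) * (p + tdeg u)) *: y).
have -> : aop (famcomp c f g) p x t =
  \sum_(ut <- splits t) \sum_(wv <- splits ut.2)
   (\sum_(ab <- splits ut.1) S ut.1 wv.1 wv.2
     (ksgn (c * (size ab.2 + 1 + size wv.2)%:Z) *: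
       f (g x (vals ab.1)) (vals ab.2 ++ mA (vals wv.1) :: vals wv.2)) +
    \sum_(ab <- splits wv.2) S ut.1 wv.1 wv.2 (ksgn (c * (size ab.2)%:Z) *:
       f (g x (vals ut.1 ++ mA (vals wv.1) :: vals ab.1)) (vals ab.2))).
  rewrite /aop; apply: eq_bigr => -[u s] _ /=; apply: eq_bigr => -[w v] _ /=.
  rewrite /famcomp sum_splits_cat !sum_splits_vals !scalerDr /S !scaler_sumr.
  congr (_ + _); apply: eq_bigr => -[a b] _ /=.
    by rewrite size_cat /= !size_vals addn1 addSn addnS.
  by rewrite !size_vals.
under eq_bigr => ut _ do rewrite big_split.
rewrite big_split [LHS]addrC; congr (_ + _).
- under [RHS]eq_bigr => uv _.
    rewrite /aop (lin_sum _ _ (fam_lin hf _)) scaler_sumr.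
    under eq_bigr => ab _.
      rewrite (lin_sum _ _ (fam_lin hf _)) scaler_sumr.
      under eq_bigr => wv _ do rewrite !(linZ (fam_lin hf _)).
      over.
    over.
  pose G (u w v b : seq (int * A)) : N := ksgn ((c + 1) * (size b)%:Z) *:
   (ksgn ((1 + size u) * size w + size v)%:Z *:
   (ksgn ((2 - (size w)%:Z) * (p + tdeg u)) *:
    f (g x (vals u ++ mA (vals w) :: vals v)) (vals b))).
  rewrite (sum_splits_coassoc t (fun u r b =>
    \sum_(wv <- splits r) G u wv.1 wv.2 b)).
  apply: eq_bigr => -[u s] _ /=.
  rewrite (sum_splits_coassoc s (G u)).
  apply: eq_bigr => -[w r] _ /=.
  rewrite big_seq [RHS]big_seq; apply: eq_bigr => -[v b] /splits_cat /= <-.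
  rewrite /G /S !scalerA -!ksgnD; congr (_ *: _); apply: ksgn_odd.
  rewrite size_cat; lia.
- rewrite scaler_sumr /aop.
  pose G (a b w v : seq (int * A)) : N := ksgn c *: (ksgn (c * (size b + size w + size v)%:Z) *:
   (ksgn ((1 + size b) * size w + size v)%:Z *:
   (ksgn ((2 - (size w)%:Z) * (p + tdeg a + e - (size a)%:Z + tdeg b)) *:
    f (g x (vals a)) (vals b ++ mA (vals w) :: vals v)))).
  have -> : \sum_(uv <- splits t) ksgn c *: (ksgn (c * (size uv.2)%:Z) *:
     \sum_(ut <- splits uv.2) \sum_(wv <- splits ut.2)
       ksgn ((1 + size ut.1) * size wv.1 + size wv.2)%:Z *:
       (ksgn ((2 - (size wv.1)%:Z) *
          (p + tdeg uv.1 + e - (size uv.1)%:Z + tdeg ut.1)) *: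
        f (g x (vals uv.1)) (vals ut.1 ++ mA (vals wv.1) :: vals wv.2))) =
    \sum_(uv <- splits t) \sum_(ut <- splits uv.2) \sum_(wv <- splits ut.2)
      G uv.1 ut.1 wv.1 wv.2.
    apply: eq_bigr => -[a s] _ /=; rewrite !scaler_sumr.
    rewrite big_seq [RHS]big_seq; apply: eq_bigr => -[b r] /splits_cat /= <-.
    rewrite !scaler_sumr.
    rewrite big_seq [RHS]big_seq; apply: eq_bigr => -[w v] /splits_cat /= <-.
    by rewrite /G !size_cat addnA.
  rewrite -(sum_splits_coassoc t (fun a b r =>
    \sum_(wv <- splits r) G a b wv.1 wv.2)).
  apply: eq_bigr => -[u s] _ /=.
  rewrite exchange_big big_seq [RHS]big_seq.
  apply: eq_bigr => -[a b] /splits_cat /= <-; apply: eq_bigr => -[w v] _ /=.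
  rewrite /G /S !scalerA -!ksgnD; congr (_ *: _); apply: ksgn_odd.
  have [d ->] : exists d, c = e + 2 * d by exists ((c - e) %/ 2)%Z; lia.
  rewrite tdeg_cat size_cat; lia.
Qed.

(* sum over j + n + l = p of (-1)^(j n + l) f (1^j (x) m_n (x) 1^l), with
   m_n = m for j = 0 and m_n = m_n^A for j > 0 *)
Definition circ (M N : gmod k) (m : M -> seq A -> M) (f : M -> seq A -> N)
    (p : int) (x : M) (t : seq (int * A)) : N :=
  famcomp 1 f m x (vals t) + aop f p x t.

Lemma circ_comp (e c : int) L M N (m : L -> seq A -> L)
    (f : M -> seq A -> N) (g : L -> seq A -> M) e' :
  is_family e' f -> odd `|c| = odd `|e| ->
  forall p x t,
  circ m (famcomp c f g) p x t =
  \sum_(uv <- splits t) ksgn ((c + 1) * (size uv.2)%:Z) *: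
     f (circ m g p x uv.1) (vals uv.2) +
  ksgn c *: \sum_(uv <- splits t) ksgn (c * (size uv.2)%:Z) *:
     aop f (p + tdeg uv.1 + e - (size uv.1)%:Z) (g x (vals uv.1)) uv.2.
Proof.
move=> hf ce p x t; rewrite /circ (aop_comp _ hf ce) (comp_assoc _ _ _ _ hf) addrA.
congr (_ + _); rewrite compE -big_split; apply: eq_bigr => -[u v] _ /=.
by rewrite (linD (fam_lin hf _)) scalerDr.
Qed.

End Families.

(* Strict unitality is part of the record; am_su concerns m_i for i > 2. *)
Record ainfMod (k : comPzRingType) (A : dgAlg k) := AinfMod {
  acar :> gmod k;
  am : acar -> seq A -> acar;
  am_fam : is_family 1 am;
  am_rel : forall p x t, gdeg p x -> homog t -> circ am am p x t = 0;
  am_one : forall x, am x [:: aone] = x;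
  am_su : forall x s, (1 < size s)%N -> aone \in s -> am x s = 0 }.
Arguments am {k A} a x s.

Record ainfHom (k : comPzRingType) (A : dgAlg k) (M N : ainfMod A) := AinfHom {
  ah :> M -> seq A -> N;
  ah_fam : is_family 0 ah;
  ah_rel : forall p x t, gdeg p x -> homog t ->
    circ (am M) ah p x t = famcomp 0 (am N) ah x (vals t);
  ah_su : strictly_unital ah }.

Definition homotopic (k : comPzRingType) (A : dgAlg k) (M N : ainfMod A)
    (f g : ainfHom M N) : Prop :=
  exists h : M -> seq A -> N,
    [/\ is_family (- 1) h, strictly_unital h &
        forall p x t, gdeg p x -> homog t ->
        f x (vals t) - g x (vals t) = famcomp 1 (am N) h x (vals t) + circ (am M) h p x t].

Section AinfCategory.
Variables (k : comPzRingType) (A : dgAlg k).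
Implicit Types L M N P : ainfMod A.

Definition idfam (M : gmod k) (x : M) (s : seq A) : M :=
  if s is [::] then x else 0.

Lemma circ_comp_hom L M (N : gmod k) (f : M -> seq A -> N) (g : ainfHom L M) e :
  is_family e f -> forall p x t, gdeg p x -> homog t ->
  circ (am L) (famcomp 0 f g) p x t =
  \sum_(uv <- splits t)
    circ (am M) f (p + tdeg uv.1 + 0 - (size uv.1)%:Z) (g x (vals uv.1)) uv.2.
Proof.
move=> hf p x t hx ht; rewrite (circ_comp _ _ hf (erefl (odd `|0|))).
rewrite add0r ksgn0 scale1r.
have -> : \sum_(uv <- splits t) ksgn (1 * (size uv.2)%:Z) *:
    f (circ (am L) g p x uv.1) (vals uv.2) = famcomp 0 (famcomp 1 f (am M)) g x (vals t).
  rewrite (comp_assoc _ _ _ _ hf) compE big_seq [RHS]big_seq.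
  apply: eq_bigr => -[u v] /splits_cat /= E.
  by rewrite (ah_rel g) // => q hq; apply: ht; rewrite -E mem_cat hq.
rewrite compE -big_split; apply: eq_bigr => -[u v] _ /=.
by rewrite mul0r ksgn0 !scale1r.
Qed.

Lemma comp_rel L M N (f : ainfHom M N) (g : ainfHom L M) p x t :
  gdeg p x -> homog t ->
  circ (am L) (famcomp 0 f g) p x t = famcomp 0 (am N) (famcomp 0 f g) x (vals t).
Proof.
move=> hx ht; rewrite (circ_comp_hom _ (ah_fam f)) //.
rewrite -[0 as X in famcomp X (am _) _](addr0 0) -(comp_assoc _ _ _ _ (am_fam N)).
rewrite compE big_seq [RHS]big_seq; apply: eq_bigr => -[u v] /splits_cat /= E.
move: ht; rewrite -E => /homog_cat [hu hv].
by rewrite mul0r ksgn0 scale1r (ah_rel f) //; apply: (fam_deg (ah_fam g)).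
Qed.

(* (f g)_p = sum over n + l = p of f_(1+l) (g_n (x) 1^l) *)
Definition ainf_comp L M N (f : ainfHom M N) (g : ainfHom L M) : ainfHom L N :=
  @AinfHom k A L N (famcomp 0 f g) (comp_family 0 (ah_fam f) (ah_fam g))
    (comp_rel f g) (comp_su 0 (ah_fam f) (ah_fam g) (@ah_su _ _ _ _ f) (@ah_su _ _ _ _ g)).


Lemma idfam_family (M : gmod k) : is_family 0 (@idfam M).
Proof.
split=> [[|a s] c x y|x [|b u] v c a1 a2|p x [|q t] hx ht] //=;
  rewrite ?scaler0 ?addr0 //; last exact: gdeg0.
by rewrite /tdeg big_nil !addr0 ?subr0.
Qed.

Lemma aop_nil (M N : gmod k) (f : M -> seq A -> N) p x t :
  (forall x s, (0 < size s)%N -> f x s = 0) -> aop f p x t = 0.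
Proof.
move=> h; rewrite /aop big1 // => ut _; rewrite big1 // => wv _.
by rewrite h ?scaler0 // size_cat addnS.
Qed.

Lemma comp_strictr c L (M N : gmod k) (f : M -> seq A -> N) (g : L -> seq A -> M) e x s :
  is_family e f -> (forall y u, (0 < size u)%N -> g y u = 0) ->
  famcomp c f g x s = ksgn (c * (size s)%:Z) *: f (g x [::]) s.
Proof.
move=> hf hg; rewrite /famcomp (sum_splits_first s
  (F := fun u v => ksgn (c * (size v)%:Z) *: f (g x u) v)) // => u v hu.
by rewrite hg // (lin0 (fam_lin hf _)) scaler0.
Qed.

Lemma comp_strictl c L (M N : gmod k) (f : M -> seq A -> N) (g : L -> seq A -> M) x s :
  (forall y u, (0 < size u)%N -> f y u = 0) -> famcomp c f g x s = f (g x s) [::].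
Proof.
move=> hf; rewrite /famcomp (sum_splits_last s
  (F := fun u v => ksgn (c * (size v)%:Z) *: f (g x u) v)) /=.
  by rewrite mulr0 ksgn0 scale1r.
by move=> u v hv; rewrite hf // scaler0.
Qed.

(* A strict morphism of A_oo-modules: f_i = 0 for i > 1. *)
Record strictHom L M := StrictHom {
  sh :> L -> M;
  sh_lin : linear sh;
  sh_deg : forall p x, gdeg p x -> gdeg p (sh x);
  sh_am : forall x s, sh (am L x s) = am M (sh x) s }.

Section Strict.
Variables (L M : ainfMod A) (f : strictHom L M).

Definition strictfam (x : L) (s : seq A) : M := if s is [::] then f x else 0.

Lemma strictfam_family : is_family 0 strictfam.
Proof.
split=> [[|a s] c x y|x [|b u] v c a1 a2|p x [|q t] hx ht] //=;
  rewrite ?scaler0 ?addr0 //; try exact: gdeg0; first exact: sh_lin.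
by rewrite /tdeg big_nil !addr0 ?subr0; apply: sh_deg.
Qed.

Lemma strictfam_nil x s : (0 < size s)%N -> strictfam x s = 0.
Proof. by case: s. Qed.

Lemma strictfam_rel p x t : gdeg p x -> homog t ->
  circ (am L) strictfam p x t = famcomp 0 (am M) strictfam x (vals t).
Proof.
move=> _ _; rewrite /circ (aop_nil _ _ _ strictfam_nil) addr0.
rewrite (comp_strictl _ _ _ _ strictfam_nil).
rewrite (comp_strictr _ _ _ (am_fam M) strictfam_nil) mul0r ksgn0 scale1r.
exact: sh_am.
Qed.

Lemma strictfam_su : strictly_unital strictfam.
Proof. by move=> x [|a s]. Qed.

Definition ainf_of_strict : ainfHom L M :=
  AinfHom strictfam_family strictfam_rel strictfam_su.
End Strict.

Definition strict_id M : strictHom M M :=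
  @StrictHom M M id (fun c x y => erefl) (fun p x h => h) (fun x s => erefl).

Definition ainf_id M : ainfHom M M := ainf_of_strict (strict_id M).

Lemma strict_comp_lin L M N (f : strictHom M N) (g : strictHom L M) :
  linear (fun x => f (g x)).
Proof. by move=> c x y; rewrite (sh_lin g) (sh_lin f). Qed.

Lemma strict_comp_am L M N (f : strictHom M N) (g : strictHom L M) x s :
  f (g (am L x s)) = am N (f (g x)) s.
Proof. by rewrite !sh_am. Qed.

Definition strict_comp L M N (f : strictHom M N) (g : strictHom L M) :
    strictHom L N :=
  @StrictHom L N (fun x => f (g x)) (strict_comp_lin f g)
    (fun p x h => sh_deg f (sh_deg g h)) (strict_comp_am f g).

Definition hsum M N (c : k) (h h' : M -> seq A -> N) x s := c *: h x s + h' x s.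

Lemma hsum_family M N c (h h' : M -> seq A -> N) e :
  is_family e h -> is_family e h' -> is_family e (hsum c h h').
Proof.
move=> F F'; split=> [s b x y|x u v b a1 a2|p x t hx ht]; rewrite /hsum.
- by rewrite (fam_lin F) (fam_lin F') !scalerDr addrACA !scalerA mulrC.
- by rewrite (fam_linA F) (fam_linA F') !scalerDr addrACA !scalerA mulrC.
- by apply: gdegL; apply: fam_deg.
Qed.

Lemma hsum_su M N c (h h' : M -> seq A -> N) :
  strictly_unital h -> strictly_unital h' -> strictly_unital (hsum c h h').
Proof. by move=> F F' x s hs; rewrite /hsum (F x s hs) (F' x s hs) scaler0 addr0. Qed.

Lemma comp_hsum M N c (h h' : M -> seq A -> N) x s :
  famcomp 1 (am N) (hsum c h h') x s = c *: famcomp 1 (am N) h x s + famcomp 1 (am N) h' x s.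
Proof.
rewrite /famcomp scaler_sumr -big_split; apply: eq_bigr => uv _ /=.
by rewrite /hsum (fam_lin (am_fam N)) scalerDr !scalerA mulrC.
Qed.

Lemma circ_hsum M N c (h h' : M -> seq A -> N) p x t :
  circ (am M) (hsum c h h') p x t = c *: circ (am M) h p x t + circ (am M) h' p x t.
Proof.
rewrite /circ scalerDr addrACA; congr (_ + _).
  rewrite /famcomp scaler_sumr -big_split; apply: eq_bigr => uv _ /=.
  by rewrite /hsum scalerDr !scalerA mulrC.
rewrite /aop scaler_sumr -big_split; apply: eq_bigr => ut _ /=.
rewrite scaler_sumr -big_split; apply: eq_bigr => wv _ /=.
rewrite /hsum !scalerDr; congr (_ + _).
by rewrite !scalerA; congr (_ *: _); rewrite [LHS]mulrC mulrA.
Qed.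

Lemma family0 M N e : is_family e (fun (_ : M) (_ : seq A) => 0 : N).
Proof.
split=> [s c x y|x u v c a1 a2|p x t _ _]; rewrite ?scaler0 ?addr0 //.
exact: gdeg0.
Qed.

Lemma homotopic_eq M N (f g : ainfHom M N) :
  (forall p x t, gdeg p x -> homog t -> f x (vals t) = g x (vals t)) ->
  homotopic f g.
Proof.
move=> fg; exists (fun _ _ => 0); split=> [||p x t hx ht]; first exact: family0.
  by move=> x s _.
rewrite (fg p) // subrr /circ /aop /famcomp !big1 ?addr0 // => *; rewrite ?scaler0 //.
- by rewrite big1 // => *; rewrite !scaler0.
- by rewrite (lin0 (fam_lin (am_fam N) _)) scaler0.
Qed.

Lemma homotopic_refl M N (f : ainfHom M N) : homotopic f f.
Proof. by apply: homotopic_eq. Qed.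

Lemma homotopic_comb M N (f1 g1 f2 g2 f g : ainfHom M N) c :
  homotopic f1 g1 -> homotopic f2 g2 ->
  (forall x s, f x s - g x s = c *: (f1 x s - g1 x s) + (f2 x s - g2 x s)) ->
  homotopic f g.
Proof.
move=> [h [F S R]] [h' [F' S' R']] e.
exists (hsum c h h'); split; [exact: hsum_family | exact: hsum_su |].
move=> p x t hx ht; rewrite e (R p) // (R' p) // comp_hsum circ_hsum.
by rewrite scalerDr addrACA.
Qed.

Lemma homotopic_sym M N (f g : ainfHom M N) : homotopic f g -> homotopic g f.
Proof.
move=> fg; apply: (homotopic_comb (c := -1) fg (homotopic_refl f)) => x s.
by rewrite subrr addr0 scaleN1r opprB.
Qed.

Lemma homotopic_trans M N (f g l : ainfHom M N) :
  homotopic f g -> homotopic g l -> homotopic f l.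
Proof.
move=> fg gl; apply: (homotopic_comb (c := 1) fg gl) => x s.
by rewrite scale1r addrA subrK.
Qed.

Lemma homotopic_compr L M N (f f' : ainfHom M N) (g : ainfHom L M) :
  homotopic f f' -> homotopic (ainf_comp f g) (ainf_comp f' g).
Proof.
move=> [h [F S R]]; exists (famcomp 0 h g); split.
- exact: comp_family F (ah_fam g).
- exact: comp_su F (ah_fam g) S (@ah_su _ _ _ _ g).
- move=> p x t hx ht; rewrite (circ_comp_hom _ F) //=.
  rewrite -[1 as X in famcomp X (am _) _](addr0 1) -(comp_assoc _ _ _ _ (am_fam N)).
  rewrite !compE -sumrB -big_split big_seq [RHS]big_seq.
  apply: eq_bigr => -[u v] /splits_cat /= E.
  move: ht; rewrite -E => /homog_cat [hu hv].
  rewrite mul0r ksgn0 !scale1r; apply: R => //.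
  exact: (fam_deg (ah_fam g)).
Qed.

Lemma homotopic_compl L M N (f : ainfHom M N) (g g' : ainfHom L M) :
  homotopic g g' -> homotopic (ainf_comp f g) (ainf_comp f g').
Proof.
move=> [h [F S R]]; exists (famcomp 1 f h); split.
- exact: comp_family (ah_fam f) F.
- exact: comp_su (ah_fam f) F (@ah_su _ _ _ _ f) S.
- move=> p x t hx ht /=.
  have o : odd `|1| = odd `|- 1 : int| by [].
  rewrite (circ_comp _ _ (ah_fam f) o).
  have -> : famcomp 1 (am N) (famcomp 1 f h) x (vals t) = famcomp 1 (famcomp 0 (am N) f) h x (vals t).
    by rewrite (comp_assoc _ _ _ _ (am_fam N)).
  have -> : famcomp 1 (famcomp 0 (am N) f) h x (vals t) =
     \sum_(uv <- splits t) ksgn (1 * (size uv.2)%:Z) *: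
       circ (am M) f (p + tdeg uv.1 - 1 - (size uv.1)%:Z) (h x (vals uv.1)) uv.2.
    rewrite compE big_seq [RHS]big_seq; apply: eq_bigr => -[u v] /splits_cat /= E.
    move: ht; rewrite -E => /homog_cat [hu hv].
    by rewrite (ah_rel f) //; apply: (fam_deg F).
  rewrite ksgn1 scaleN1r addrCA -[X in _ = _ + X]sumrB.
  rewrite [X in _ = _ + X](_ : _ = famcomp 1 (famcomp 1 f (am M)) h x (vals t)); last first.
    rewrite compE; apply: eq_bigr => uv _.
    by rewrite -scalerBr /circ addrK.
  rewrite (comp_assoc _ _ _ _ (ah_fam f)) !compE -sumrB -big_split.
  rewrite big_seq [RHS]big_seq; apply: eq_bigr => -[u v] /splits_cat /= E.
  move: ht; rewrite -E => /homog_cat [hu hv].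
  have e : ksgn ((1 + 1) * (size v)%:Z) = 1 :> k by apply: ksgn_even; lia.
  rewrite mul0r ksgn0 e !scale1r -(linB (fam_lin (ah_fam f) _)) (R p) //.
  by rewrite (linD (fam_lin (ah_fam f) _)) addrC.
Qed.


Section GShift.
Variable M : gmod k.
Definition gshift_deg n (x : M) := gdeg (n + 1) x.

Lemma gshift_span x : exists t : seq (int * M),
  {in t, forall q, gshift_deg q.1 q.2} /\ x = \sum_(q <- t) q.2.
Proof.
have [t [ht ->]] := gdeg_span x; exists [seq (q.1 - 1, q.2) | q <- t].
rewrite big_map; split=> // _ /mapP [q hq ->] /=.
by rewrite /gshift_deg subrK; apply: ht.
Qed.

Lemma gshift_indep (s : seq int) (c : int -> M) : uniq s ->
  (forall n, gshift_deg n (c n)) -> \sum_(n <- s) c n = 0 ->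
  forall n, n \in s -> c n = 0.
Proof.
move=> us hc e n hn.
have i : injective (fun n : int => n + 1) by move=> a b; lia.
have := @gdeg_indep k M [seq n + 1 | n <- s] (fun m => c (m - 1)).
rewrite map_inj_uniq // big_map => /(_ us).
have h m : gdeg m (c (m - 1)) by have := hc (m - 1); rewrite /gshift_deg subrK.
move=> /(_ h).
under eq_bigr => m _ do rewrite addrK.
by move=> /(_ e (n + 1)); rewrite addrK; apply; apply/mapP; exists n.
Qed.

(* (S M)^n = M^(n+1) *)
Definition gshift : gmod k :=
  @GMod k M gshift_deg (fun n => gdeg0 M (n + 1))
    (fun n => @gdegL k M (n + 1)) gshift_span gshift_indep.
End GShift.

(* S f_i = (-1)^(e+i-1) f_i for a family f of degree e; on a dg module this
   negates the differential and leaves the right action unchanged. *)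
Definition sfam (e : int) (M N : gmod k) (f : M -> seq A -> N)
    (x : gshift M) (s : seq A) : gshift N :=
  ksgn ((size s)%:Z + e) *: (f x s : N).

Lemma sfam_family (M' N' : gmod k) e c (f : M' -> seq A -> N') :
  is_family e f -> @is_family k A (gshift M') (gshift N') e (sfam c f).
Proof.
move=> F; split=> [s b x y|x u v b a1 a2|p x t hx ht]; rewrite /sfam.
- by rewrite (fam_lin F) scalerDr !scalerA mulrC.
- by rewrite !size_cat /= (fam_linA F) scalerDr !scalerA mulrC.
- apply: gdegZ; have := fam_deg F (hx : @gdeg k M' (p + 1) x) ht.
  congr gdeg; lia.
Qed.

Lemma sfam_su (M' N' : gmod k) c (f : M' -> seq A -> N') :
  strictly_unital f -> @strictly_unital k A (gshift M') (gshift N') (sfam c f).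
Proof. by move=> F x s hs; rewrite /sfam (F x s hs) scaler0. Qed.

Lemma comp_sfam (L' M' N' : gmod k) c e e' d (f : M' -> seq A -> N') (g : L' -> seq A -> M') x s :
  is_family d f ->
  @famcomp k A c (gshift L') (gshift M') (gshift N') (sfam e f) (sfam e' g) x s =
  ksgn ((size s)%:Z + e + e') *: (famcomp c f g x s : N').
Proof.
move=> F; rewrite /famcomp scaler_sumr big_seq [RHS]big_seq.
apply: eq_bigr => -[u v] /splits_cat /= <-.
rewrite /sfam (linZ (fam_lin F _)) !scalerA -!ksgnD; congr (_ *: _).
by apply: ksgn_odd; rewrite size_cat; lia.
Qed.

Lemma aop_sfam (M' N' : gmod k) e (f : M' -> seq A -> N') p x t :
  @aop k A (gshift M') (gshift N') (sfam e f) p x t = ksgn ((size t)%:Z + 1 + e) *: (aop f (p + 1) x t : N').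
Proof.
rewrite /aop scaler_sumr big_seq [RHS]big_seq.
apply: eq_bigr => -[u w] /splits_cat /= <-.
rewrite scaler_sumr big_seq [RHS]big_seq.
apply: eq_bigr => -[w' v] /splits_cat /= <-.
rewrite /sfam !scalerA -!ksgnD; congr (_ *: _); apply: ksgn_odd.
rewrite !size_cat /= !size_vals; lia.
Qed.

Lemma circ_sfam (M' N' : gmod k) e d (m : M' -> seq A -> M') (f : M' -> seq A -> N') p x t :
  is_family d f ->
  @circ k A (gshift M') (gshift N') (sfam 1 m) (sfam e f) p x t =
  ksgn ((size t)%:Z + 1 + e) *: (circ m f (p + 1) x t : N').
Proof.
move=> F; rewrite /circ aop_sfam (comp_sfam _ _ _ _ _ _ F) scalerDr.
congr (_ *: _ + _); apply: ksgn_odd; rewrite size_vals; lia.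
Qed.

Section Shift.
Variable M : ainfMod A.

Lemma shift_rel p (x : gshift M) t : gdeg p x -> homog t ->
  circ (sfam 1 (am M)) (sfam 1 (am M)) p x t = 0.
Proof.
by move=> hx ht; rewrite (circ_sfam _ _ _ _ _ (am_fam M)) am_rel ?scaler0.
Qed.

Lemma shift_one (x : gshift M) : sfam 1 (am M) x [:: aone] = x.
Proof. by rewrite /sfam am_one ksgn_even // scale1r. Qed.

Lemma shift_su (x : gshift M) s : (1 < size s)%N -> aone \in s ->
  sfam 1 (am M) x s = 0.
Proof. by move=> h1 h2; rewrite /sfam am_su ?scaler0. Qed.

Definition shift : ainfMod A :=
  @AinfMod k A (gshift M) (sfam 1 (am M)) (sfam_family 1 (am_fam M))
    shift_rel shift_one shift_su.
End Shift.

Section ShiftHom.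
Variables (M N : ainfMod A) (f : ainfHom M N).

Lemma shift_hom_rel p (x : shift M) t : gdeg p x -> homog t ->
  circ (am (shift M)) (sfam 0 f) p x t = famcomp 0 (am (shift N)) (sfam 0 f) x (vals t).
Proof.
move=> hx ht; apply: (etrans (circ_sfam 0 (am M) _ _ _ (ah_fam f))); rewrite (ah_rel f) //.
apply/esym/(etrans (comp_sfam 0 1 0 _ _ _ (am_fam N))); congr (_ *: _).
by apply: ksgn_odd; rewrite size_vals; lia.
Qed.

Definition shift_hom : ainfHom (shift M) (shift N) :=
  @AinfHom k A (shift M) (shift N) (sfam 0 f) (sfam_family 0 (ah_fam f))
    shift_hom_rel (sfam_su 0 (@ah_su _ _ _ _ f)).
End ShiftHom.

Lemma shift_homotopic M N (f g : ainfHom M N) :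
  homotopic f g -> homotopic (shift_hom f) (shift_hom g).
Proof.
move=> [h [F S R]]; exists (sfam 1 h); split.
- exact: sfam_family F.
- exact: sfam_su S.
- move=> p x t hx ht; apply: (etrans (y := ksgn (size t)%:Z *: (f x (vals t) - g x (vals t) : N))).
    by rewrite /= /sfam !size_vals addr0 -scalerBr.
  rewrite (R (p + 1)) // scalerDr; congr (_ + _); apply/esym.
    apply: (etrans (comp_sfam 1 1 1 _ _ _ (am_fam N))); congr (_ *: _).
    by apply: ksgn_odd; rewrite size_vals; lia.
  apply: (etrans (circ_sfam 1 (am M) _ _ _ F)); congr (_ *: _).
  by apply: ksgn_odd; lia.
Qed.

Section ShiftStrict.
Variables (M N : ainfMod A) (f : strictHom M N).
Lemma shift_strict_lin : linear (f : gshift M -> gshift N).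
Proof. exact: sh_lin. Qed.

Lemma shift_strict_am (x : shift M) s :
  f (am (shift M) x s) = am (shift N) (f x) s.
Proof. by rewrite /= /sfam (linZ (sh_lin f)) sh_am. Qed.

Definition shift_strict : strictHom (shift M) (shift N) :=
  @StrictHom (shift M) (shift N) f shift_strict_lin
   (fun p x h => @sh_deg M N f (p + 1) x h) shift_strict_am.
End ShiftStrict.

Section GSum.
Variables M N : gmod k.
Definition gsum_deg n (z : (M * N)%type) := gdeg n z.1 /\ gdeg n z.2.

Lemma gsum_deg0 n : gsum_deg n 0.
Proof. by split; apply: gdeg0. Qed.

Lemma gsum_degL n c x y : gsum_deg n x -> gsum_deg n y -> gsum_deg n (c *: x + y).
Proof. by move=> [? ?] [? ?]; split; apply: gdegL. Qed.

Lemma sum_pair (I : Type) (r : seq I) (F : I -> (M * N)%type) :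
  \sum_(i <- r) F i = (\sum_(i <- r) (F i).1, \sum_(i <- r) (F i).2).
Proof.
elim: r => [|i r IH]; first by rewrite !big_nil.
by rewrite !big_cons IH.
Qed.

Lemma gsum_span z : exists t : seq (int * (M * N)%type),
  {in t, forall q, gsum_deg q.1 q.2} /\ z = \sum_(q <- t) q.2.
Proof.
case: z => x y; have [t [ht ->]] := gdeg_span x; have [t' [ht' ->]] := gdeg_span y.
exists ([seq (q.1, (q.2, 0)) | q <- t] ++ [seq (q.1, (0, q.2)) | q <- t']).
split.
  move=> q; rewrite mem_cat => /orP [] /mapP [r hr ->]; split=> /=;
  by [apply: ht | apply: ht' | apply: gdeg0].
rewrite big_cat !big_map !sum_pair /=.
by rewrite -[RHS]/(_ + _, _ + _) /= !big1_eq addr0 add0r.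
Qed.

Lemma gsum_indep (s : seq int) (c : int -> (M * N)%type) : uniq s ->
  (forall n, gsum_deg n (c n)) -> \sum_(n <- s) c n = 0 ->
  forall n, n \in s -> c n = 0.
Proof.
move=> us hc; rewrite sum_pair => -[e1 e2] n hn.
rewrite [c n]surjective_pairing.
have -> := @gdeg_indep k M s (fun m => (c m).1) us (fun m => (hc m).1) e1 n hn.
by have -> := @gdeg_indep k N s (fun m => (c m).2) us (fun m => (hc m).2) e2 n hn.
Qed.

Definition gsum : gmod k :=
  @GMod k (M * N)%type gsum_deg gsum_deg0 gsum_degL gsum_span gsum_indep.
End GSum.

Section Cone.
Variables (L M : ainfMod A) (f : strictHom L M).

(* M (+) S L, with differential (y, x) |-> (d y + f x, - d x) *)
Definition cone_am (z : gsum M (gshift L)) (s : seq A) : gsum M (gshift L) :=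
  (am M z.1 s + strictfam f z.2 s, am (shift L) z.2 s).

Lemma cone_family : is_family 1 cone_am.
Proof.
split=> [s b x y|x u v b a1 a2|p [y x] t [hy hx] ht]; rewrite /cone_am.
- rewrite !(fam_lin (am_fam _)) (fam_lin (strictfam_family f)) addrACA -scalerDr.
  by [].
- rewrite !(fam_linA (am_fam _)) (fam_linA (strictfam_family f)) addrACA -scalerDr.
  by [].
- split=> /=; last exact: (@fam_deg _ _ _ _ _ _ (am_fam (shift L)) p x t hx ht).
  apply: gdegD; first exact: (fam_deg (am_fam M) hy ht).
  have := fam_deg (strictfam_family f) (hx : @gdeg k L (p + 1) x) ht.
  by congr gdeg; lia.
Qed.

Lemma fst_sum (U V : lmodType k) (I : Type) (r : seq I) (F : I -> (U * V)%type) :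
  (\sum_(i <- r) F i).1 = \sum_(i <- r) (F i).1.
Proof. by elim: r => [|i r IH]; rewrite ?big_nil // !big_cons -IH. Qed.

Lemma snd_sum (U V : lmodType k) (I : Type) (r : seq I) (F : I -> (U * V)%type) :
  (\sum_(i <- r) F i).2 = \sum_(i <- r) (F i).2.
Proof. by elim: r => [|i r IH]; rewrite ?big_nil // !big_cons -IH. Qed.

Lemma cone_circ2 p z t : (circ cone_am cone_am p z t).2 =
  circ (am (shift L)) (am (shift L)) p z.2 t.
Proof.
rewrite /circ -[LHS]/(_.2 + _.2); congr (_ + _); first by rewrite /famcomp snd_sum.
rewrite /aop snd_sum; apply: eq_bigr => ut _; rewrite snd_sum.
by apply: eq_bigr.
Qed.

Lemma cone_circ1 p z t : (circ cone_am cone_am p z t).1 = circ (am M) (am M) p z.1 t.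
Proof.
have o u v : (0 < size v)%N -> strictfam f u v = 0 by exact: strictfam_nil.
rewrite /circ -[LHS]/(_.1 + _.1) addrC [RHS]addrC; congr (_ + _).
  rewrite /aop fst_sum; apply: eq_bigr => ut _; rewrite fst_sum.
  apply: eq_bigr => wv _ /=.
  by rewrite o ?addr0 // size_cat addnS.
rewrite /famcomp fst_sum.
have -> : \sum_(uv <- splits (vals t)) (ksgn (1 * (size uv.2)%:Z) *:
     cone_am (cone_am z uv.1) uv.2).1 =
  famcomp 1 (am M) (am M) z.1 (vals t) + (famcomp 1 (am M) (strictfam f) z.2 (vals t) +
    @famcomp k A 1 L L M (strictfam f) (sfam 1 (am L)) z.2 (vals t)).
  rewrite /famcomp -!big_split; apply: eq_bigr => uv _ /=.
  by rewrite (linD (fam_lin (am_fam M) _)) !scalerDr addrA.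
rewrite (comp_strictr _ _ _ (am_fam M) o) (comp_strictl _ _ _ _ o) /=.
rewrite /sfam (linZ (sh_lin f)) sh_am -scalerDl.
rewrite (_ : ksgn _ + ksgn _ = 0) ?scale0r ?addr0 // mul1r ksgnD ksgn1.
by rewrite mulrN1 subrr.
Qed.

Lemma cone_rel p z t : gdeg p z -> homog t -> circ cone_am cone_am p z t = 0.
Proof.
move=> [/= hy hx] ht; rewrite [LHS]surjective_pairing cone_circ1 cone_circ2.
by rewrite (am_rel hy ht) (@am_rel _ _ (shift L) p z.2 t hx ht).
Qed.

Lemma cone_one z : cone_am z [:: aone] = z.
Proof. by case: z => y x; rewrite /cone_am /= addr0 am_one shift_one. Qed.

Lemma cone_su z s : (1 < size s)%N -> aone \in s -> cone_am z s = 0.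
Proof.
move=> h1 h2; rewrite /cone_am /= (am_su _ h1 h2) (shift_su _ h1 h2).
by rewrite strictfam_su // addr0.
Qed.

Definition cone : ainfMod A :=
  @AinfMod k A (gsum M (gshift L)) cone_am cone_family cone_rel cone_one cone_su.

Lemma cone_inc_lin : linear (fun y : M => (y, 0) : cone).
Proof.
move=> c x y; rewrite -[RHS]/(_ + _, c *: 0 + 0) /=.
by rewrite scaler0 addr0.
Qed.

Lemma cone_inc_am (y : M) s : (am M y s, 0) = am cone (y, 0) s.
Proof.
rewrite /= /cone_am /= (lin0 (fam_lin (strictfam_family f) s)) addr0.
by rewrite (lin0 (fam_lin (sfam_family 1 (am_fam L)) s)).
Qed.

Definition cone_inc : strictHom M cone :=
  @StrictHom M cone (fun y => (y, 0)) cone_inc_lin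
    (fun p y h => conj h (gdeg0 (gshift L) p)) cone_inc_am.

Definition cone_proj : strictHom cone (shift L) :=
  @StrictHom cone (shift L) (fun z => z.2) (fun c x y => erefl)
    (fun p z h => proj2 h) (fun z s => erefl).
End Cone.


(* As a complex of k-modules: h need not be compatible with the action. *)
Definition contractible M : Prop :=
  exists h : M -> M, [/\ linear h,
    forall n x, gdeg n x -> gdeg (n - 1) (h x) &
    forall x, am M (h x) [::] + h (am M x [::]) = x].

Definition rel_quasi_iso L M (f : strictHom L M) : Prop := contractible (cone f).

Lemma shift_rel_quasi_iso L M (f : strictHom L M) :
  rel_quasi_iso f -> rel_quasi_iso (shift_strict f).
Proof.
move=> [h [hl hd hc]].
pose th (z : (M * L)%type) : (M * L)%type := (z.1, - z.2).
have thl : linear th.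
  move=> c x y; rewrite /th /= opprD -scalerN.
  by rewrite -[RHS]/(_ + _, _ + _).
have thK z : th (th z) = z by case: z => y x; rewrite /th /= opprK.
have thd n z : @gdeg k (cone f) (n + 1) z -> @gdeg k (cone (shift_strict f)) n (th z).
  case: z => y x [/= hy hx]; split=> //=.
  by rewrite -scaleN1r; apply: (@gdegZ k (gshift (gshift L))); exact: hx.
have thd' n z : @gdeg k (cone (shift_strict f)) n z -> @gdeg k (cone f) (n + 1) (th z).
  case: z => y x [/= hy hx]; split=> //=.
  by rewrite -scaleN1r; apply: (@gdegZ k (gshift L)); exact: hx.
have dth z : am (cone (shift_strict f)) z [::] = - th (am (cone f) (th z) [::]).
  case: z => y x; rewrite -[RHS]/(- _, - _) /= /cone_am /= /sfam /= /th /=.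
  rewrite ksgn1 !scaleN1r.
  rewrite (linN (sh_lin f)) (linN (fam_lin (am_fam L) _)) opprD !opprK.
  by [].
exists (fun z => - th (h (th z))); split.
- by move=> c x y; rewrite thl hl thl opprD scalerN.
- move=> n z hz; rewrite -scaleN1r; apply: (@gdegZ k (cone (shift_strict f))).
  apply: thd; have := hd _ _ (thd' _ _ hz).
  by congr (@gdeg k (cone f)); lia.
- move=> z; rewrite !dth.
  set w := th z; set y := am (cone f) w [::].
  have e1 : th (- th (h w)) = - h w by rewrite (linN thl) thK.
  have e2 : th (- th y) = - y by rewrite (linN thl) thK.
  rewrite e1 e2 (linN (fam_lin (am_fam (cone f)) [::])) (linN hl) !(linN thl).
  by rewrite !opprK -(linD thl) hc thK.
Qed.

End AinfCategory.

(* Categories; the equality of morphisms is an equivalence relation heq on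
   each hom type rather than Leibniz equality, so that passing to homotopy
   classes or localizing requires no quotient types. *)
Record category := Category {
  ob :> Type;
  hom : ob -> ob -> Type;
  heq : forall X Y, hom X Y -> hom X Y -> Prop;
  idm : forall X, hom X X;
  cmp : forall X Y Z, hom Y Z -> hom X Y -> hom X Z;
  heq_refl : forall X Y (f : hom X Y), heq f f;
  heq_sym : forall X Y (f g : hom X Y), heq f g -> heq g f;
  heq_trans : forall X Y (f g h : hom X Y), heq f g -> heq g h -> heq f h;
  heq_cmp : forall X Y Z (f f' : hom Y Z) (g g' : hom X Y),
    heq f f' -> heq g g' -> heq (cmp f g) (cmp f' g');
  cmp1m : forall X Y (f : hom X Y), heq (cmp (idm Y) f) f;
  cmpm1 : forall X Y (f : hom X Y), heq (cmp f (idm X)) f;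
  cmpA : forall X Y Z T (f : hom Z T) (g : hom Y Z) (h : hom X Y),
    heq (cmp f (cmp g h)) (cmp (cmp f g) h) }.
Arguments hom {c} X Y.
Arguments heq {c X Y} f g.
Arguments idm {c} X.
Arguments cmp {c X Y Z} f g.

Record functor (C D : category) := Functor {
  fob :> C -> D;
  fmap : forall X Y, hom X Y -> hom (fob X) (fob Y);
  fmap_heq : forall X Y (f g : hom X Y), heq f g -> heq (fmap f) (fmap g);
  fmap_id : forall X, heq (fmap (idm X)) (idm (fob X));
  fmap_cmp : forall X Y Z (f : hom Y Z) (g : hom X Y),
    heq (fmap (cmp f g)) (cmp (fmap f) (fmap g)) }.
Arguments fmap {C D} _ {X Y} _.

Definition id_functor (C : category) : functor C C :=
  @Functor C C (fun X => X) (fun X Y f => f) (fun X Y f g h => h)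
    (fun X => heq_refl (idm X)) (fun X Y Z f g => heq_refl (cmp f g)).

Section CompFunctor.
Variables (C D E : category) (G : functor D E) (F : functor C D).

Lemma comp_functor_heq X Y (f g : @hom C X Y) :
  heq f g -> heq (fmap G (fmap F f)) (fmap G (fmap F g)).
Proof. by move=> h; apply/fmap_heq/fmap_heq. Qed.

Lemma comp_functor_id X : heq (fmap G (fmap F (idm X))) (idm (G (F X))).
Proof. exact: heq_trans (fmap_heq G (fmap_id F X)) (fmap_id G (F X)). Qed.

Lemma comp_functor_cmp X Y Z (f : hom Y Z) (g : @hom C X Y) :
  heq (fmap G (fmap F (cmp f g))) (cmp (fmap G (fmap F f)) (fmap G (fmap F g))).
Proof. exact: heq_trans (fmap_heq G (fmap_cmp F f g)) (fmap_cmp G _ _). Qed.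

Definition comp_functor : functor C E :=
  @Functor C E (fun X => G (F X)) (fun X Y f => fmap G (fmap F f))
    comp_functor_heq comp_functor_id comp_functor_cmp.
End CompFunctor.

Definition is_iso (C : category) (X Y : C) (f : hom X Y) : Prop :=
  exists g : hom Y X, heq (cmp g f) (idm X) /\ heq (cmp f g) (idm Y).

Definition nat_iso (C D : category) (F G : functor C D)
    (phi : forall X : C, hom (F X) (G X)) : Prop :=
  (forall X, is_iso (phi X)) /\
  (forall X Y (f : hom X Y),
     heq (cmp (phi Y) (fmap F f)) (cmp (fmap G f) (phi X))).

Definition is_zero (C : category) (Z : C) : Prop :=
  forall X : C,
    (exists f : hom X Z, forall g, heq g f) /\
    (exists f : hom Z X, forall g, heq g f).

Definition is_product (C : category) (P X Y : C)
    (p : hom P X) (q : hom P Y) : Prop :=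
  forall (T : C) (a : hom T X) (b : hom T Y),
    exists h : hom T P, [/\ heq (cmp p h) a, heq (cmp q h) b &
      forall h' : hom T P,
        heq (cmp p h') a -> heq (cmp q h') b -> heq h' h].

(* Between additive categories, whose addition of morphisms is determined by
   the finite products, this says that F is additive. *)
Definition additive_functor (C D : category) (F : functor C D) : Prop :=
  (forall Z : C, is_zero Z -> is_zero (F Z)) /\
  (forall (P X Y : C) (p : hom P X) (q : hom P Y),
     is_product p q -> is_product (fmap F p) (fmap F q)).

Definition iso_triangle (C : category) (S : functor C C)
    (X Y Z : C) (u : hom X Y) (v : hom Y Z) (w : hom Z (S X))
    (X' Y' Z' : C) (u' : hom X' Y') (v' : hom Y' Z') (w' : hom Z' (S X')) :
    Prop :=
  exists (a : hom X X') (b : hom Y Y') (c : hom Z Z'),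
    [/\ is_iso a, is_iso b & is_iso c] /\
    [/\ heq (cmp b u) (cmp u' a), heq (cmp c v) (cmp v' b) &
        heq (cmp (fmap S a) w) (cmp w' c)].

(* The data of a triangulated category: a category, its suspension functor
   and its class of (distinguished) triangles. *)
Record triCat := TriCat {
  tcat :> category;
  susp : functor tcat tcat;
  triangle : forall X Y Z : tcat,
    hom X Y -> hom Y Z -> hom Z (susp X) -> Prop }.
Arguments susp {t}.
Arguments triangle {t X Y Z} u v w.

(* A triangle functor is an additive functor F with a natural isomorphism
   phi : F S -> S F such that (F u, F v, phi F w) is a triangle whenever
   (u, v, w) is; it is a triangle equivalence if F is an equivalence of
   categories. *)
Definition triangle_functor (C D : triCat) (F : functor C D)
    (phi : forall X : C, hom (F (susp X)) (susp (F X))) : Prop :=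
  [/\ additive_functor F,
      @nat_iso C D (comp_functor F susp) (comp_functor susp F) phi &
      forall (X Y Z : C) (u : hom X Y) (v : hom Y Z) (w : hom Z (susp X)),
        triangle u v w ->
        triangle (fmap F u) (fmap F v) (cmp (phi X) (fmap F w))].

Definition is_equivalence (C D : category) (F : functor C D) : Prop :=
  exists (G : functor D C)
    (eta : forall X : C, hom X (G (F X))) (eps : forall Y : D, hom (F (G Y)) Y),
    @nat_iso C C (id_functor C) (comp_functor G F) eta /\
    @nat_iso D D (comp_functor F G) (id_functor D) eps.

Definition triangle_equivalent (C D : triCat) : Prop :=
  exists (F : functor C D)
    (phi : forall X : C, hom (F (susp X)) (susp (F X))),
    triangle_functor phi /\ is_equivalence F.

(* The localization of C at W: morphisms are zigzags of morphisms of C and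
   formal inverses of morphisms in W, modulo the smallest congruence that
   makes C -> C[W^-1] a functor and the formal inverses inverses. *)
Section Localization.
Variables (C : category) (W : forall X Y : C, hom X Y -> Prop).

Inductive zigzag : C -> C -> Type :=
| znil X : zigzag X X
| zfwd X Y Z (f : hom X Y) (z : zigzag Y Z) : zigzag X Z
| zbwd X Y Z (w : hom Y X) (Ww : W w) (z : zigzag Y Z) : zigzag X Z.

Inductive zeq : forall X Y, zigzag X Y -> zigzag X Y -> Prop :=
| zeq_refl X Y (z : zigzag X Y) : zeq z z
| zeq_sym X Y (z z' : zigzag X Y) : zeq z z' -> zeq z' z
| zeq_trans X Y (z z' z'' : zigzag X Y) : zeq z z' -> zeq z' z'' -> zeq z z''
| zeq_fwd X Y Z (f f' : hom X Y) (z z' : zigzag Y Z) :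
    heq f f' -> zeq z z' -> zeq (zfwd f z) (zfwd f' z')
| zeq_bwd X Y Z (w : hom Y X) (Ww : W w) (z z' : zigzag Y Z) :
    zeq z z' -> zeq (zbwd Ww z) (zbwd Ww z')
| zeq_id X Y (z : zigzag X Y) : zeq (zfwd (idm X) z) z
| zeq_cmp X Y Z T (g : hom Y Z) (f : hom X Y) (z : zigzag Z T) :
    zeq (zfwd (cmp g f) z) (zfwd f (zfwd g z))
| zeq_fb X Y Z (w : hom X Y) (Ww : W w) (z : zigzag X Z) :
    zeq (zfwd w (zbwd Ww z)) z
| zeq_bf X Y Z (w : hom X Y) (Ww : W w) (z : zigzag Y Z) :
    zeq (zbwd Ww (zfwd w z)) z.

Fixpoint zcat X Y Z (z : zigzag X Y) : zigzag Y Z -> zigzag X Z :=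
  match z in zigzag X Y return zigzag Y Z -> zigzag X Z with
  | znil _ => fun t => t
  | zfwd _ _ _ f z => fun t => zfwd f (zcat z t)
  | zbwd _ _ _ _ Ww z => fun t => zbwd Ww (zcat z t)
  end.

Lemma zcat_nil X Y (z : zigzag X Y) : zcat z (znil Y) = z.
Proof. by elim: z => //= [? ? ? f z ->|? ? ? w Ww z ->]. Qed.

Lemma zcatA X Y Z T (z : zigzag X Y) (t : zigzag Y Z) (s : zigzag Z T) :
  zcat (zcat z t) s = zcat z (zcat t s).
Proof.
by elim: z t => //= [? ? ? f z IH|? ? ? w Ww z IH] t; rewrite IH.
Qed.

Lemma zcat_zeq X Y Z (z z' : zigzag X Y) (t t' : zigzag Y Z) :
  zeq z z' -> zeq t t' -> zeq (zcat z t) (zcat z' t').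
Proof.
move=> hz ht; apply: (@zeq_trans _ _ _ (zcat z' t)).
  elim: hz t {t' ht} => {X Y z z'} /=.
  - by move=> *; apply: zeq_refl.
  - by move=> X Y z z' _ IH t; apply: zeq_sym.
  - by move=> X Y z z' z'' _ IH _ IH' t; apply: zeq_trans (IH t) (IH' t).
  - by move=> X Y U f f' z z' e _ IH t; apply: zeq_fwd.
  - by move=> X Y U w Ww z z' _ IH t; apply: zeq_bwd.
  - by move=> *; apply: zeq_id.
  - by move=> *; apply: zeq_cmp.
  - by move=> *; apply: zeq_fb.
  - by move=> *; apply: zeq_bf.
elim: z' {z hz} t t' ht => //= [? ? ? f z IH|? ? ? w Ww z IH] t t' ht.
  by apply: zeq_fwd; [apply: heq_refl | apply: IH].
by apply: zeq_bwd; apply: IH.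
Qed.

Definition localization : category :=
  @Category C zigzag zeq znil (fun X Y Z f g => zcat g f)
    zeq_refl zeq_sym zeq_trans
    (fun X Y Z f f' g g' hf hg => zcat_zeq hg hf)
    (fun X Y f => eq_ind_r (fun z => zeq z f) (zeq_refl f) (zcat_nil f))
    (fun X Y f => zeq_refl f)
    (fun X Y Z T f g h =>
       eq_ind_r (fun z => zeq z (zcat h (zcat g f))) (zeq_refl _) (zcatA h g f)).

Definition loc_mor X Y (f : hom X Y) : zigzag X Y := zfwd f (znil Y).

Section LocMap.
Variable G : functor C C.
Hypothesis GW : forall X Y (w : @hom C X Y), W w -> W (fmap G w).

Fixpoint zmap X Y (z : zigzag X Y) : zigzag (G X) (G Y) :=
  match z in zigzag X Y return zigzag (G X) (G Y) with
  | znil X => znil (G X)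
  | zfwd _ _ _ f z => zfwd (fmap G f) (zmap z)
  | zbwd _ _ _ _ Ww z => zbwd (GW Ww) (zmap z)
  end.

Lemma zmap_zeq X Y (z z' : zigzag X Y) : zeq z z' -> zeq (zmap z) (zmap z').
Proof.
elim=> {X Y z z'} /=.
- by move=> *; apply: zeq_refl.
- by move=> X Y z z' _ IH; apply: zeq_sym.
- by move=> X Y z z' z'' _ IH _ IH'; apply: zeq_trans IH IH'.
- by move=> X Y Z f f' z z' e _ IH; apply: zeq_fwd => //; apply: fmap_heq.
- by move=> X Y Z w Ww z z' _ IH; apply: zeq_bwd.
- move=> X Y z; apply: zeq_trans (zeq_id _).
  by apply: zeq_fwd (zeq_refl _); apply: fmap_id.
- move=> X Y Z T g f z; apply: zeq_trans (zeq_cmp _ _ _).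
  by apply: zeq_fwd (zeq_refl _); apply: fmap_cmp.
- by move=> *; apply: zeq_fb.
- by move=> *; apply: zeq_bf.
Qed.

Lemma zmap_cat X Y Z (z : zigzag Y Z) (t : zigzag X Y) :
  zeq (zmap (zcat t z)) (zcat (zmap t) (zmap z)).
Proof.
suff -> : zmap (zcat t z) = zcat (zmap t) (zmap z) by apply: zeq_refl.
by elim: t z => //= [? ? ? f t IH|? ? ? w Ww t IH] z; rewrite IH.
Qed.

Definition loc_functor : functor localization localization :=
  @Functor localization localization G zmap zmap_zeq
    (fun X => zeq_refl (znil (G X))) zmap_cat.
End LocMap.
End Localization.

Section TwoCategories.
Variables (k : comPzRingType) (A : dgAlg k).

(* A unital dg module is a strictly unital A_oo-module with m_i = 0 for i > 2;
   the lemmas dg_diffK, dg_leibniz and dg_assoc make the axioms explicit. *)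
Record dgMod := DGMod {
  dg_ainf :> ainfMod A;
  dg_high : forall x s, (1 < size s)%N -> am dg_ainf x s = 0 }.

Lemma dg_diffK (X : dgMod) p (x : X) : gdeg p x -> am X (am X x [::]) [::] = 0.
Proof.
move=> hx.
have h : homog ([::] : seq (int * A)) by move=> q.
have := @am_rel _ _ X p x [::] hx h.
rewrite /circ /famcomp /aop /splits /= !big_cons !big_nil /= !addr0 ksgn0 !scale1r. rewrite (lin0 (fam_linA (am_fam X) x [::] [::])) scaler0 addr0. by [].
Qed.

Lemma dg_leibniz (X : dgMod) p q (x : X) a : gdeg p x -> gdeg q a ->
  am X (am X x [:: a]) [::] = am X (am X x [::]) [:: a] + ksgn p *: am X x [:: adiff a].
Proof.
move=> hx ha.
have h : homog ([:: (q,a)] : seq (int * A)) by move=> r; rewrite inE => /eqP ->.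
have := @am_rel _ _ X p x _ hx h.
rewrite /circ /famcomp /aop /splits /= !big_cons !big_nil /= !addr0.
rewrite (lin0 (fam_linA (am_fam X) x [::] [::a])) (lin0 (fam_linA (am_fam X) x [::a] [::])) !scaler0 !addr0 !add0r.
rewrite /tdeg big_nil !addr0 !mulr0 ksgn0 scale1r.
rewrite scalerA -ksgnD (ksgn_odd k (a := _ + _) (b := p + 1)); last by lia.
rewrite (ksgn_oddN k) // ksgnD ksgn1 mulrN1 scaleN1r scaleNr => /eqP e.
by apply/eqP; move: e; rewrite [- _ + _]addrC -addrA -opprD subr_eq0.
Qed.

Lemma dg_assoc (X : dgMod) p q r (x : X) a b : gdeg p x -> gdeg q a -> gdeg r b ->
  am X (am X x [:: a]) [:: b] = am X x [:: amul a b].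
Proof.
move=> hx ha hb.
have h : homog ([:: (q,a); (r,b)] : seq (int * A)) by move=> z; rewrite !inE => /orP [] /eqP ->.
have := @am_rel _ _ X p x _ hx h.
rewrite /circ /famcomp /aop /splits /= !big_cons !big_nil /= !addr0.
rewrite (lin0 (fam_linA (am_fam X) x [::] [::a;b])) (lin0 (fam_linA (am_fam X) x [::a] [::b])) (lin0 (fam_linA (am_fam X) x [::a;b] [::])).
rewrite !(dg_high _ (s := [:: _; _])) // (lin0 (fam_lin (am_fam X) _)) !scaler0 !addr0 !add0r.
rewrite mul1r ksgn1 scaleN1r ksgn_even // scale1r ksgn_even ?scale1r; last by rewrite /=; lia.
by move/eqP; rewrite addrC subr_eq0 => /eqP.
Qed.

Lemma shift_high (X : dgMod) (x : shift X) s : (1 < size s)%N ->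
  am (shift X) x s = 0.
Proof. by move=> hs; rewrite /= /sfam dg_high // scaler0. Qed.

Definition dg_shift (X : dgMod) : dgMod := DGMod (@shift_high X).

Lemma cone_high (X Y : dgMod) (f : strictHom X Y) (z : cone f) s :
  (1 < size s)%N -> am (cone f) z s = 0.
Proof.
move=> hs; have hx := @shift_high X z.2 s hs; have hy := dg_high z.1 hs.
apply: (congr2 pair _ hx); rewrite hy add0r.
by case: s hs {hx hy}.
Qed.

Definition dg_cone (X Y : dgMod) (f : strictHom X Y) : dgMod :=
  DGMod (@cone_high X Y f).

(* The category of unital dg modules: strict morphisms are the k-linear maps of
   degree 0 which commute with the differential and the action. *)
Definition CA : category :=
  @Category dgMod (fun X Y => strictHom X Y) (fun X Y f g => f =1 g)
    (fun X => strict_id X) (fun X Y Z f g => strict_comp f g)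
    (fun X Y f x => erefl) (fun X Y f g h x => esym (h x))
    (fun X Y f g l h h' x => etrans (h x) (h' x))
    (fun X Y Z f f' g g' h h' x => etrans (h (g x)) (congr1 f' (h' x)))
    (fun X Y f x => erefl) (fun X Y f x => erefl)
    (fun X Y Z T f g h x => erefl).

Definition CA_shift : functor CA CA :=
  @Functor CA CA dg_shift (fun X Y f => shift_strict f)
    (fun X Y f g h => h) (fun X x => erefl) (fun X Y Z f g x => erefl).

Definition CA_rqi (X Y : CA) (f : hom X Y) : Prop := rel_quasi_iso f.

Definition CA_rqi_shift (X Y : CA) (f : hom X Y) :
    CA_rqi f -> CA_rqi (fmap CA_shift f) :=
  fun h => shift_rel_quasi_iso h.

Definition Drel_cat : category := localization CA_rqi.

Definition Drel_shift : functor Drel_cat Drel_cat := loc_functor CA_rqi_shift.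

(* The triangles of the homotopy category of dg modules are the images of the
   X -> Y -> cone f -> S X, for f : X -> Y in CA. *)
Definition Drel_triangle (X Y Z : Drel_cat)
    (u : hom X Y) (v : hom Y Z) (w : hom Z (Drel_shift X)) : Prop :=
  exists (X' Y' : dgMod) (f : strictHom X' Y'),
    @iso_triangle Drel_cat Drel_shift
      X' Y' (dg_cone f)
      (@loc_mor CA CA_rqi X' Y' f)
      (@loc_mor CA CA_rqi Y' (dg_cone f) (cone_inc f))
      (@loc_mor CA CA_rqi (dg_cone f) (dg_shift X') (cone_proj f))
      X Y Z u v w.

Definition Drel : triCat := TriCat Drel_triangle.

Implicit Types L M N : ainfMod A.

Lemma stab_cmp1m L M (f : ainfHom L M) : homotopic (ainf_comp (ainf_id M) f) f.
Proof.
apply: homotopic_eq => p x t _ _ /=.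
by rewrite comp_strictl // => y [].
Qed.

Lemma stab_cmpm1 L M (f : ainfHom L M) : homotopic (ainf_comp f (ainf_id L)) f.
Proof.
apply: homotopic_eq => p x t _ _ /=.
rewrite (comp_strictr _ _ _ (ah_fam f)) ?mul0r ?ksgn0 ?scale1r //.
by move=> y [].
Qed.

Lemma stab_cmpA L M N P (f : ainfHom N P) (g : ainfHom M N) (h : ainfHom L M) :
  homotopic (ainf_comp f (ainf_comp g h)) (ainf_comp (ainf_comp f g) h).
Proof.
apply: homotopic_eq => p x t _ _ /=.
by rewrite (comp_assoc _ _ _ _ (ah_fam f)).
Qed.

Lemma stab_heq_cmp L M N (f f' : ainfHom M N) (g g' : ainfHom L M) :
  homotopic f f' -> homotopic g g' ->
  homotopic (ainf_comp f g) (ainf_comp f' g').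
Proof.
move=> hf hg; apply: homotopic_trans (homotopic_compr g hf) _.
exact: homotopic_compl.
Qed.

Definition stab_cat : category :=
  @Category (ainfMod A) (@ainfHom k A) (@homotopic k A) (@ainf_id k A)
    (@ainf_comp k A) (@homotopic_refl k A) (@homotopic_sym k A)
    (@homotopic_trans k A) stab_heq_cmp stab_cmp1m stab_cmpm1 stab_cmpA.

Lemma shift_hom_id M : homotopic (shift_hom (ainf_id M)) (ainf_id (shift M)).
Proof.
apply: homotopic_eq => p x [|a t] _ _ /=.
  by rewrite /sfam /= addr0 ksgn0 scale1r.
by rewrite /sfam /= scaler0.
Qed.

Lemma shift_hom_comp L M N (f : ainfHom M N) (g : ainfHom L M) :
  homotopic (shift_hom (ainf_comp f g)) (ainf_comp (shift_hom f) (shift_hom g)).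
Proof.
apply: homotopic_eq => p x t _ _ /=; apply/esym.
apply: etrans (comp_sfam 0 0 0 _ _ _ (ah_fam f)) _.
by rewrite /sfam addr0.
Qed.

Definition stab_shift : functor stab_cat stab_cat :=
  @Functor stab_cat stab_cat (@shift k A) (@shift_hom k A)
    (@shift_homotopic k A) shift_hom_id shift_hom_comp.

Variable eps : augmentation A.

Definition eq_on_ker (L M : gmod k) (f g : L -> seq A -> M) : Prop :=
  forall x s, {in s, forall a, eps a = 0} -> f x s = g x s.

(* After restriction to the augmentation ideal A' and the bar construction,
   the graded comodule morphisms M (x) T(S A') -> N (x) T(S A') are the
   families M (x) A'^(i-1) -> N of degree 1 - i, composed by famcomp 0.  A family
   on A' extends to A, and only its restriction to A' matters here. *)
Definition conflation L M N (i : ainfHom L M) (p : ainfHom M N) : Prop :=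
  exists (r : M -> seq A -> L) (s : N -> seq A -> M),
    [/\ @is_family k A M L 0 r, @is_family k A N M 0 s,
        eq_on_ker (famcomp 0 r i) (@idfam k A L),
        eq_on_ker (famcomp 0 p s) (@idfam k A N) &
        eq_on_ker (fun x t => famcomp 0 i r x t + famcomp 0 s p x t) (@idfam k A M)].

(* The conflation L -> I L -> S L, where I L, the cone of the identity of L,
   is injective for the conflations. *)
Definition hull L : ainfMod A := cone (strict_id L).
Definition hull_inc L : ainfHom L (hull L) := ainf_of_strict (cone_inc (strict_id L)).
Definition hull_proj L : ainfHom (hull L) (shift L) :=
  ainf_of_strict (cone_proj (strict_id L)).

(* (i, p, e) where the conflation (i, p) is mapped to the previous one by the
   identity of L, some g : M -> I L and e : N -> S L. *)
Definition standard_triangle L M N (i : ainfHom L M) (p : ainfHom M N)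
    (e : ainfHom N (shift L)) : Prop :=
  conflation i p /\
  exists g : ainfHom M (hull L),
    (forall x s, ainf_comp g i x s = hull_inc L x s) /\
    (forall x s, ainf_comp e p x s = ainf_comp (hull_proj L) g x s).

Definition stab_triangle (X Y Z : stab_cat)
    (u : hom X Y) (v : hom Y Z) (w : hom Z (stab_shift X)) : Prop :=
  exists L M N (i : ainfHom L M) (p : ainfHom M N) (e : ainfHom N (shift L)),
    standard_triangle i p e /\
    @iso_triangle stab_cat stab_shift L M N i p e X Y Z u v w.

(* A full subcategory of stab_cat; its triangles are those of stab_cat whose
   vertices are unital dg modules. *)
Definition stab_dg_cat : category :=
  @Category dgMod (fun X Y => ainfHom X Y) (fun X Y f g => homotopic f g)
    (fun X => ainf_id X) (fun X Y Z f g => ainf_comp f g)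
    (fun X Y f => homotopic_refl f) (fun X Y f g h => homotopic_sym h)
    (fun X Y f g l h h' => homotopic_trans h h')
    (fun X Y Z f f' g g' h h' => stab_heq_cmp h h')
    (fun X Y f => stab_cmp1m f) (fun X Y f => stab_cmpm1 f)
    (fun X Y Z T f g h => stab_cmpA f g h).

Definition stab_dg_shift : functor stab_dg_cat stab_dg_cat :=
  @Functor stab_dg_cat stab_dg_cat dg_shift (fun X Y f => shift_hom f)
    (fun X Y f g h => shift_homotopic h) (fun X => shift_hom_id X)
    (fun X Y Z f g => shift_hom_comp f g).

Definition stab_dg_triangle (X Y Z : stab_dg_cat)
    (u : hom X Y) (v : hom Y Z) (w : hom Z (stab_dg_shift X)) : Prop :=
  @stab_triangle (dg_ainf X) (dg_ainf Y) (dg_ainf Z) u v w.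

Definition stab_dg : triCat := TriCat stab_dg_triangle.

End TwoCategories.

(* Main.v *)
Require Import Defs.
From HB Require Import structures.
From mathcomp Require Import all_boot all_order all_algebra.
From mathcomp Require Import zify.
From mathcomp Require boolp.
(* hom is also a name of the linear algebra library *)
Import Defs.

Set Implicit Arguments.
Unset Strict Implicit.
Unset Printing Implicit Defensive.

Import GRing.Theory.
Local Open Scope ring_scope.

(** Inverting the relative quasi-isomorphisms amounts to replacing each dg module
    by a resolution, and the A_oo-morphisms to Y are the strict morphisms to a
    resolution of Y.  The bar resolution of the source would require tensor
    products over k; the dual resolution of the target only requires functions.
    It is the coinduced module C(Y) of all strictly unital families of maps from
    A to Y, with A acting through left multiplication on the argument in A.  Its
    differential has square zero by cdiffK.

    The unit Y -> C(Y) sends y to a |-> y a.  It is a relative quasi-isomorphism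
    (cunit_rqi), since inserting 1 as a new first argument contracts its cone
    over k.  Composition with an A_oo-morphism f : X -> Y gives a strict morphism
    C(f) : C(X) -> C(Y), and composition with a homotopy gives an A-linear
    homotopy; both follow from cdiff_ccomp.  The unit is natural for strict
    morphisms, while evaluation at 1 is an A_oo-morphism C(Y) -> Y which is
    natural for all A_oo-morphisms (coev_natural) and a retraction of the unit.

    A strict morphism w whose cone is contractible over k is a homotopy
    equivalence of A_oo-modules (rqi_iso).  A contraction h of the cone is
    corrected by a closed formula: each argument a contributes the defect
    x |-> h(x) a - h(x a), and the entries of the corrected contraction are an
    inverse of w and two homotopies.  Hence the inclusion of strict morphisms
    extends to a functor from the localization to the stable category, the
    identity on objects.  In the other direction, f is sent to C(f) conjugated by
    the units.  This respects homotopy, because homotopic strict morphisms factor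
    through the two ends of a cylinder and agree after localization
    (strict_homotopic_loc).  Naturality of the unit and of the evaluation shows
    that the two functors are mutually inverse.

    Additivity is automatic for an equivalence.  The triangle of the cone of
    f : X -> Y goes to the one of the conflation X -> Y (+) hull X -> cone f, up
    to the sign of the last morphism, so that the functor commutes with the
    suspensions through -1. *)

(** * Isomorphisms, equivalences and localizations *)

Section Isomorphisms.
Variable C : category.
Implicit Types X Y Z T : C.

Lemma heq_cmpl X Y Z (f f' : hom Y Z) (g : hom X Y) :
  heq f f' -> heq (cmp f g) (cmp f' g).
Proof. by move=> h; apply: heq_cmp h (heq_refl _). Qed.

Lemma heq_cmpr X Y Z (f : hom Y Z) (g g' : hom X Y) :
  heq g g' -> heq (cmp f g) (cmp f g').
Proof. by move=> h; apply: heq_cmp (heq_refl _) h. Qed.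

Lemma cmpKl X Y Z (g : hom Y X) (f : hom X Y) (u : hom Z X) :
  heq (cmp g f) (idm X) -> heq (cmp g (cmp f u)) u.
Proof.
move=> e; apply: heq_trans (cmpA _ _ _) _.
exact: heq_trans (heq_cmpl _ e) (cmp1m _).
Qed.

Lemma cmpKr X Y Z (g : hom Y X) (f : hom X Y) (u : hom X Z) :
  heq (cmp g f) (idm X) -> heq (cmp (cmp u g) f) u.
Proof.
move=> e; apply: heq_trans (heq_sym (cmpA _ _ _)) _.
exact: heq_trans (heq_cmpr _ e) (cmpm1 _).
Qed.

Lemma inverse_unique X Y (f : hom X Y) (g g' : hom Y X) :
  heq (cmp g f) (idm X) -> heq (cmp f g') (idm Y) -> heq g g'.
Proof.
move=> e e'; apply: heq_trans (heq_sym (cmpm1 g)) _.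
apply: heq_trans (heq_cmpr _ (heq_sym e')) _.
exact: cmpKl.
Qed.

Lemma iso_id X : is_iso (idm X).
Proof. by exists (idm X); split; apply: cmp1m. Qed.

Lemma iso_inv X Y (f : hom X Y) (g : hom Y X) :
  heq (cmp g f) (idm X) -> heq (cmp f g) (idm Y) -> is_iso g.
Proof. by move=> *; exists f. Qed.

Lemma iso_comp X Y Z (f : hom Y Z) (g : hom X Y) :
  is_iso f -> is_iso g -> is_iso (cmp f g).
Proof.
move=> [f' [h1 h2]] [g' [h3 h4]]; exists (cmp g' f'); split.
  apply: heq_trans (heq_sym (cmpA _ _ _)) _.
  exact: heq_trans (heq_cmpr _ (cmpKl _ h1)) h3.
apply: heq_trans (heq_sym (cmpA _ _ _)) _.
exact: heq_trans (heq_cmpr _ (cmpKl _ h4)) h2.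
Qed.

Lemma iso_sectionK X Y (f : hom X Y) (g : hom Y X) :
  is_iso f -> heq (cmp f g) (idm Y) -> heq (cmp g f) (idm X).
Proof.
move=> [f' [h1 h2]] e; apply: heq_trans (h1); apply: heq_cmpl.
exact: heq_sym (inverse_unique h1 e).
Qed.

Lemma iso_mono X Y Z (f : hom X Y) (u v : hom Z X) :
  is_iso f -> heq (cmp f u) (cmp f v) -> heq u v.
Proof.
move=> [g [h _]] e; apply: heq_trans (heq_sym (cmpKl u h)) _.
exact: heq_trans (heq_cmpr _ e) (cmpKl v h).
Qed.

Lemma iso_epi X Y Z (f : hom X Y) (u v : hom Y Z) :
  is_iso f -> heq (cmp u f) (cmp v f) -> heq u v.
Proof.
move=> [g [_ h]] e; apply: heq_trans (heq_sym (cmpKr u h)) _.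
exact: heq_trans (heq_cmpl _ e) (cmpKr v h).
Qed.
End Isomorphisms.

Lemma functor_iso (C D : category) (F : functor C D) (X Y : C) (f : hom X Y) :
  is_iso f -> is_iso (fmap F f).
Proof.
move=> [g [h1 h2]]; exists (fmap F g).
by split; apply: heq_trans (heq_sym (fmap_cmp F _ _)) _;
  apply: heq_trans (fmap_heq F _) (fmap_id F _).
Qed.

(** Full faithfulness and essential surjectivity let every test object of D be
    replaced by one in the image of F, so that universal properties transfer;
    an equivalence is therefore additive for free. *)
Section Equivalences.
Variables (C D : category) (F : functor C D) (G : functor D C).
Variable eta : forall X : C, hom X (G (F X)).
Variable eps : forall Y : D, hom (F (G Y)) Y.
Hypothesis etaN : @nat_iso C C (id_functor C) (comp_functor G F) eta.
Hypothesis epsN : @nat_iso D D (comp_functor F G) (id_functor D) eps.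

Lemma equivalence_faithful (X Y : C) (f g : hom X Y) :
  heq (fmap F f) (fmap F g) -> heq f g.
Proof.
move=> e; apply: (iso_mono (etaN.1 Y)).
apply: heq_trans (etaN.2 _ _ f) _; apply: heq_sym.
apply: heq_trans (etaN.2 _ _ g) _; apply: heq_cmpl.
exact: fmap_heq (heq_sym e).
Qed.

Lemma equivalence_faithful_inv (X Y : D) (f g : hom X Y) :
  heq (fmap G f) (fmap G g) -> heq f g.
Proof.
move=> e; apply: (iso_epi (epsN.1 X)).
apply: heq_trans (heq_sym (epsN.2 _ _ f)) _; apply: heq_sym.
apply: heq_trans (heq_sym (epsN.2 _ _ g)) _; apply: heq_cmpr.
exact: fmap_heq (heq_sym e).
Qed.

Lemma equivalence_full (X Y : C) (c : hom (F X) (F Y)) :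
  exists f : hom X Y, heq (fmap F f) c.
Proof.
have [iy [ky1 ky2]] := etaN.1 Y.
exists (cmp iy (cmp (fmap G c) (eta X))); apply: equivalence_faithful_inv.
apply: (iso_epi (etaN.1 X)).
apply: heq_trans (heq_sym (etaN.2 _ _ _)) _.
exact: cmpKl.
Qed.

Lemma equivalence_zero (Z : C) : is_zero Z -> is_zero (F Z).
Proof.
move=> z0 Y; have [[a ha] [b hb]] := z0 (G Y).
have [e' [h1 h2]] := epsN.1 Y; split.
  exists (cmp (fmap F a) e') => g.
  apply: heq_trans (heq_sym (cmpKr g h2)) _; apply: heq_cmpl.
  have [g' e] := equivalence_full (cmp g (eps Y)).
  exact: heq_trans (heq_sym e) (fmap_heq F (ha g')).
exists (cmp (eps Y) (fmap F b)) => g.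
apply: heq_trans (heq_sym (cmpKl g h2)) _; apply: heq_cmpr.
have [g' e] := equivalence_full (cmp e' g).
exact: heq_trans (heq_sym e) (fmap_heq F (hb g')).
Qed.

Lemma equivalence_product (P X Y : C) (p : hom P X) (q : hom P Y) :
  is_product p q -> is_product (fmap F p) (fmap F q).
Proof.
move=> pr T a b; have [e' [h1 h2]] := epsN.1 T.
have [a' ea] := equivalence_full (cmp a (eps T)).
have [b' eb] := equivalence_full (cmp b (eps T)).
have [h [ha hb hu]] := pr _ a' b'.
have down (U : C) (r : hom P U) (c' : hom (G T) U) (c : hom T (F U)) :
    heq (fmap F c') (cmp c (eps T)) -> heq (cmp r h) c' ->
    heq (cmp (fmap F r) (cmp (fmap F h) e')) c.
  move=> ec hr; apply: heq_trans (cmpA _ _ _) _.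
  apply: heq_trans (heq_cmpl _ (heq_sym (fmap_cmp F r h))) _.
  apply: heq_trans (heq_cmpl _ (fmap_heq F hr)) _.
  exact: heq_trans (heq_cmpl _ ec) (cmpKr c h2).
exists (cmp (fmap F h) e'); split; [exact: down ea ha | exact: down eb hb |].
move=> h' ha' hb'; have [g eg] := equivalence_full (cmp h' (eps T)).
apply: heq_trans (heq_sym (cmpKr h' h2)) _; apply: heq_cmpl.
apply: heq_trans (heq_sym eg) _; apply: fmap_heq.
have up (U : C) (r : hom P U) (c' : hom (G T) U) (c : hom T (F U)) :
    heq (fmap F c') (cmp c (eps T)) -> heq (cmp (fmap F r) h') c ->
    heq (cmp r g) c'.
  move=> ec hr; apply: equivalence_faithful.
  apply: heq_trans (fmap_cmp F r g) _; apply: heq_trans (heq_cmpr _ eg) _.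
  apply: heq_trans (cmpA _ _ _) _; apply: heq_trans (heq_cmpl _ hr) _.
  exact: heq_sym.
by apply: hu; [apply: up ea ha' | apply: up eb hb'].
Qed.

Lemma equivalence_additive : additive_functor F.
Proof. by split; [apply: equivalence_zero | apply: equivalence_product]. Qed.
End Equivalences.

(** A functor that inverts W extends to the localization at W.  The inverses
    are chosen, and inverses are unique, so the relations between zigzags are
    respected. *)
Section LocalizationExtension.
Variables (C D : category) (W : forall X Y : C, hom X Y -> Prop).
Variable F : functor C D.
Hypothesis FW : forall (X Y : C) (w : hom X Y), W w -> is_iso (fmap F w).

Definition chosen_inverse (X Y : C) (w : hom X Y) (Ww : W w) : hom (F Y) (F X) :=
  projT1 (boolp.cid (FW Ww)).

Lemma chosen_inverseP (X Y : C) (w : hom X Y) (Ww : W w) :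
  heq (cmp (chosen_inverse Ww) (fmap F w)) (idm (F X)) /\
  heq (cmp (fmap F w) (chosen_inverse Ww)) (idm (F Y)).
Proof. exact: projT2 (boolp.cid (FW Ww)). Qed.

Fixpoint zigzag_map X Y (z : zigzag W X Y) : hom (F X) (F Y) :=
  match z in zigzag _ X Y return hom (F X) (F Y) with
  | znil X => idm (F X)
  | zfwd _ _ _ f z => cmp (zigzag_map z) (fmap F f)
  | zbwd _ _ _ _ Ww z => cmp (zigzag_map z) (chosen_inverse Ww)
  end.

Lemma zigzag_map_zeq X Y (z z' : zigzag W X Y) :
  zeq z z' -> heq (zigzag_map z) (zigzag_map z').
Proof.
elim=> {X Y z z'} /=.
- by move=> *; apply: heq_refl.
- by move=> X Y z z' _; apply: heq_sym.
- by move=> X Y z z' z'' _ h _; apply: heq_trans h.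
- by move=> X Y Z f f' z z' e _ h; apply: heq_cmp h (fmap_heq F e).
- by move=> X Y Z w Ww z z' _; apply: heq_cmpl.
- by move=> X Y z; apply: heq_trans (heq_cmpr _ (fmap_id F X)) (cmpm1 _).
- move=> X Y Z T g f z; apply: heq_trans (heq_cmpr _ (fmap_cmp F g f)) _.
  exact: cmpA.
- by move=> X Y Z w Ww z; apply: cmpKr (chosen_inverseP Ww).1.
- by move=> X Y Z w Ww z; apply: cmpKr (chosen_inverseP Ww).2.
Qed.

Lemma zigzag_map_cat X Y Z (z : zigzag W Y Z) (t : zigzag W X Y) :
  heq (zigzag_map (zcat t z)) (cmp (zigzag_map z) (zigzag_map t)).
Proof.
elim: t z => [U|U V T f t IH|U V T w Ww t IH] z /=.
- exact: heq_sym (cmpm1 _).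
- exact: heq_trans (heq_cmpl _ (IH z)) (heq_sym (cmpA _ _ _)).
- exact: heq_trans (heq_cmpl _ (IH z)) (heq_sym (cmpA _ _ _)).
Qed.

Definition loc_extension : functor (localization W) D :=
  @Functor (localization W) D F zigzag_map zigzag_map_zeq
    (fun X => heq_refl (idm (F X))) zigzag_map_cat.

End LocalizationExtension.

Lemma loc_morM (C : category) (W : forall X Y : C, hom X Y -> Prop) (X Y Z : C)
    (g : hom Y Z) (f : hom X Y) :
  zeq (loc_mor W (cmp g f)) (zcat (loc_mor W f) (loc_mor W g)).
Proof. exact: zeq_cmp. Qed.

Lemma loc_mor_heq (C : category) (W : forall X Y : C, hom X Y -> Prop) (X Y : C)
    (f g : hom X Y) : heq f g -> zeq (loc_mor W f) (loc_mor W g).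
Proof. by move=> h; apply: zeq_fwd h (zeq_refl _). Qed.

Lemma loc_iso (C : category) (W : forall X Y : C, hom X Y -> Prop) (X Y : C)
    (w : hom X Y) (Ww : W X Y w) :
  @is_iso (localization W) X Y (loc_mor W w).
Proof.
by exists (zbwd Ww (znil W X)); split; [apply: zeq_fb | apply: zeq_bf].
Qed.

(** * Identities in abelian groups *)

(** Sums of signed variables are compared by reflection: an identity holds in
    every abelian group once each variable has the same integer coefficient on
    both sides. *)
Inductive zterm := ZVar of nat | ZZero | ZAdd of zterm & zterm | ZOpp of zterm.

Fixpoint zeval (V : zmodType) (e : seq V) (t : zterm) : V :=
  match t with
  | ZVar n => nth 0 e n
  | ZZero => 0
  | ZAdd t1 t2 => zeval e t1 + zeval e t2
  | ZOpp t1 => - zeval e t1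
  end.

Fixpoint zcoef (t : zterm) (n : nat) : int :=
  match t with
  | ZVar m => if m == n then 1 else 0
  | ZZero => 0
  | ZAdd t1 t2 => zcoef t1 n + zcoef t2 n
  | ZOpp t1 => - zcoef t1 n
  end.

Lemma zevalE (V : zmodType) (e : seq V) t :
  zeval e t = \sum_(i < size e) nth 0 e i *~ zcoef t i.
Proof.
elim: t => [n||t1 IH1 t2 IH2|t1 IH1] /=.
- case: (ltnP n (size e)) => h; last first.
    rewrite nth_default // big1 // => i _; case: eqP => [E|_]; last by rewrite mulr0z.
    by move: h; rewrite E leqNgt ltn_ord.
  rewrite (bigD1 (Ordinal h)) //= eqxx mulr1z big1 ?addr0 // => i /eqP hi.
  by case: eqP => [E|_]; rewrite ?mulr0z //; case: hi; apply: val_inj.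
- by rewrite big1 // => i _; rewrite mulr0z.
- by rewrite IH1 IH2 -big_split; apply: eq_bigr => i _ /=; rewrite mulrzDr.
- by rewrite IH1 -sumrN; apply: eq_bigr => i _; rewrite mulrNz.
Qed.

Lemma zterm_eq (V : zmodType) (e : seq V) t1 t2 :
  all (fun i => zcoef t1 i == zcoef t2 i) (iota 0 (size e)) ->
  zeval e t1 = zeval e t2.
Proof.
move=> /allP h; rewrite !zevalE; apply: eq_bigr => i _.
have hi : (i : nat) \in iota 0 (size e) by rewrite mem_iota add0n ltn_ord.
by rewrite (eqP (h _ hi)).
Qed.

Ltac zmem x e :=
  match e with
  | ?y :: ?r => match constr:(Set) with
    | _ => let _ := match goal with _ => unify x y end in constr:(0%N)
    | _ => let n := zmem x r in constr:(S n)
    end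
  end.

Ltac zadd_env x e :=
  match constr:(Set) with
  | _ => let _ := zmem x e in e
  | _ => constr:(x :: e)
  end.

Ltac zenv t e :=
  lazymatch t with
  | @Algebra.add _ ?a ?b => let e := zenv a e in zenv b e
  | GRing.opp ?a => zenv a e
  | GRing.zero => e
  | _ => zadd_env t e
  end.

Ltac zreify t e :=
  lazymatch t with
  | @Algebra.add _ ?a ?b =>
    let a := zreify a e in let b := zreify b e in constr:(ZAdd a b)
  | GRing.opp ?a => let a := zreify a e in constr:(ZOpp a)
  | GRing.zero => constr:(ZZero)
  | _ => let n := zmem t e in constr:(ZVar n)
  end.

Ltac zmodule :=
  lazymatch goal with
  | |- @eq ?V ?l ?r =>
    let e := zenv l (@nil V) in let e := zenv r e in
    let a := zreify l e in let b := zreify r e in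
    apply: (@zterm_eq _ e a b isT)
  end.

(** * The parity involution of a graded module *)

Section Signs.
Variable k : comPzRingType.

Lemma ksgnZ (V : lmodType k) a b (x : V) :
  ksgn a *: (ksgn b *: x) = ksgn (a + b) *: x.
Proof. by rewrite scalerA -ksgnD. Qed.

Lemma ksgnN (V : lmodType k) a (x : V) : - (ksgn a *: x) = ksgn (a + 1) *: x.
Proof. by rewrite ksgnD ksgn1 mulrN1 scaleNr. Qed.

Lemma ksgnK a : ksgn a * ksgn a = 1 :> k.
Proof. by rewrite -ksgnD ksgn_even //; lia. Qed.

Lemma ksgnZ_odd (V : lmodType k) a b (x : V) :
  odd `|a| = odd `|b| -> ksgn a *: x = ksgn b *: x.
Proof. by move/(ksgn_odd k) ->. Qed.

Lemma ksgnZ_even (V : lmodType k) a (x : V) : ~~ odd `|a| -> ksgn a *: x = x.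
Proof. by move=> h; rewrite ksgn_even // scale1r. Qed.
End Signs.

Section Parity.
Variable k : comPzRingType.
Implicit Types M N : gmod k.

(** Grouping the terms by degree reduces this to the independence of the
    components.  It makes the parity involution, computed from a chosen
    decomposition, independent of that choice. *)
Lemma homog_sum0 M (t : seq (int * M)) (c : int -> k) :
  homog t -> \sum_(q <- t) q.2 = 0 -> \sum_(q <- t) c q.1 *: q.2 = 0.
Proof.
move=> ht e.
have split_deg (V : nmodType) (F : int * M -> V) : \sum_(q <- t) F q =
    \sum_(n <- undup [seq q.1 | q <- t]) \sum_(q <- t | q.1 == n) F q.
  rewrite (exchange_big_dep predT) //= big_seq [RHS]big_seq; apply: eq_bigr => q hq.
  rewrite -big_filter (_ : [seq i <- _ | q.1 == i] = [:: q.1]) ?big_seq1 //.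
  rewrite (eq_filter (a2 := pred1 q.1)); last by move=> i; rewrite /= eq_sym.
  by rewrite filter_pred1_uniq ?undup_uniq // mem_undup map_f.
rewrite split_deg big_seq big1 // => n hn.
under eq_bigr => q /eqP -> do [].
rewrite -scaler_sumr.
have := @gdeg_indep k M _ (fun n => \sum_(q <- t | q.1 == n) q.2) (undup_uniq [seq q.1 | q <- t]).
move=> ->; rewrite ?scaler0 //; last by rewrite -split_deg.
move=> m; rewrite big_seq_cond; elim/big_ind: _ => [||q /andP[hq /eqP <-]].
- exact: gdeg0.
- by move=> x y; apply: gdegD.
- exact: ht.
Qed.

Definition decomp M (x : M) : seq (int * M) := projT1 (boolp.cid (gdeg_span x)).

Lemma decompP M (x : M) : homog (decomp x) /\ x = \sum_(q <- decomp x) q.2.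
Proof. exact: projT2 (boolp.cid (gdeg_span x)). Qed.

(** The map x |-> (-1)^p x on the component of degree p.  With it the Koszul
    signs become operators, and formulas stated for homogeneous arguments extend
    to all arguments. *)
Definition gpar M (x : M) : M := \sum_(q <- decomp x) ksgn q.1 *: q.2.

Lemma gparE M (t : seq (int * M)) : homog t ->
  gpar (\sum_(q <- t) q.2) = \sum_(q <- t) ksgn q.1 *: q.2.
Proof.
move=> ht; have [hd e] := decompP (\sum_(q <- t) q.2).
apply/eqP; rewrite -subr_eq0; apply/eqP.
pose t' := decomp (\sum_(q <- t) q.2) ++ [seq (q.1, - q.2) | q <- t].
have E (c : int -> k) : \sum_(q <- t') c q.1 *: q.2 =
    \sum_(q <- decomp (\sum_(q <- t) q.2)) c q.1 *: q.2 - \sum_(q <- t) c q.1 *: q.2.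
  rewrite big_cat big_map -sumrN; congr (_ + _).
  by apply: eq_bigr => q _; rewrite scalerN.
rewrite -(E ksgn); apply: homog_sum0.
  move=> q; rewrite mem_cat => /orP [/hd //|/mapP [r /ht hr ->]] /=.
  by rewrite -scaleN1r; apply: gdegZ.
transitivity (\sum_(q <- t') (1 : k) *: q.2).
  by apply: eq_bigr => q _; rewrite scale1r.
rewrite (E (fun=> 1)) -!scaler_sumr -e subrr.
by [].
Qed.

Lemma gpar_deg M p (x : M) : gdeg p x -> gpar x = ksgn p *: x.
Proof.
move=> hx; have h : homog [:: (p, x)] by move=> q; rewrite inE => /eqP ->.
by have := gparE h; rewrite !big_seq1.
Qed.

Lemma gpar_lin M : linear (@gpar M).
Proof.
move=> c x y; have [hx ex] := decompP x; have [hy ey] := decompP y.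
pose t := [seq (q.1, c *: q.2) | q <- decomp x] ++ decomp y.
have ht : homog t.
  move=> q; rewrite mem_cat => /orP [/mapP [r /hx hr ->]|/hy //] /=.
  exact: gdegZ.
have := gparE ht; rewrite /t !big_cat !big_map /= -scaler_sumr -ex -ey => ->.
rewrite [in RHS]/gpar scaler_sumr; congr (_ + _).
by apply: eq_bigr => q _; rewrite !scalerA mulrC.
Qed.

Lemma gdeg_ind M (P : M -> Prop) :
  P 0 -> (forall x y, P x -> P y -> P (x + y)) ->
  (forall p x, gdeg p x -> P x) -> forall x, P x.
Proof.
move=> h0 hD hp x; have [hd ->] := decompP x.
rewrite big_seq; elim/big_ind: _ => // q /hd; exact: hp.
Qed.

Lemma lin_ext M (V : lmodType k) (f g : M -> V) : linear f -> linear g ->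
  (forall p x, gdeg p x -> f x = g x) -> f =1 g.
Proof.
move=> fl gl h; apply: gdeg_ind => //; first by rewrite !lin0.
by move=> x y e e'; rewrite !linD // e e'.
Qed.

Lemma lin_comp (U V W : lmodType k) (f : V -> W) (g : U -> V) :
  linear f -> linear g -> linear (fun x => f (g x)).
Proof. by move=> fl gl c x y; rewrite gl fl. Qed.

Lemma lin_scale (U V : lmodType k) a (f : U -> V) : linear f -> linear (fun x => a *: f x).
Proof. by move=> fl c x y; rewrite fl scalerDr !scalerA mulrC. Qed.

Lemma lin_add (U V : lmodType k) (f g : U -> V) :
  linear f -> linear g -> linear (fun x => f x + g x).
Proof. by move=> fl gl c x y; rewrite fl gl scalerDr addrACA. Qed.

Lemma lin_opp (U V : lmodType k) (f : U -> V) : linear f -> linear (fun x => - f x).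
Proof. by move=> fl c x y; rewrite fl opprD scalerN. Qed.

Lemma gparK M : involutive (@gpar M).
Proof.
apply: lin_ext => [|//|p x hx]; first by apply: lin_comp; apply: gpar_lin.
by rewrite (gpar_deg hx) (linZ (gpar_lin (M := M))) (gpar_deg hx) ksgnZ ksgnZ_even //; lia.
Qed.

Lemma gdeg_gpar M p (x : M) : gdeg p x -> gdeg p (gpar x).
Proof. by move=> hx; rewrite (gpar_deg hx); apply: gdegZ. Qed.

Lemma gpar_map M N e (f : M -> N) : linear f ->
  (forall p x, gdeg p x -> gdeg (p + e) (f x)) ->
  forall x, f (gpar x) = ksgn e *: gpar (f x).
Proof.
move=> fl fd; apply: lin_ext; first exact: lin_comp fl (@gpar_lin M).
  exact: lin_scale (lin_comp (@gpar_lin N) fl).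
move=> p x hx; rewrite (gpar_deg hx) (gpar_deg (fd _ _ hx)) (linZ fl) ksgnZ.
by apply: ksgnZ_odd; lia.
Qed.
End Parity.
Arguments gpar {k M} x.

(** * The bar differential on functions of lists *)

Section Alg.
Variables (k : comPzRingType) (A : dgAlg k).
Implicit Types a b : A.

Lemma adiff_gpar a : adiff (gpar a) = - gpar (adiff a).
Proof.
have := gpar_map (@adiff_lin k A) (@adiff_deg k A) a.
by rewrite ksgn1 scaleN1r.
Qed.

Lemma gpar_amul a b : gpar (amul a b) = amul (gpar a) (gpar b).
Proof.
move: b; apply: lin_ext.
- exact: lin_comp (@gpar_lin _ A) (@amul_linr _ A a).
- exact: lin_comp (@amul_linr _ A _) (@gpar_lin _ A).
move=> q b hb; move: a; apply: lin_ext.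
- exact: lin_comp (@gpar_lin _ A) (@amul_linl _ A b).
- exact: lin_comp (@amul_linl _ A _) (@gpar_lin _ A).
move=> p a ha; rewrite (gpar_deg ha) (gpar_deg hb) (gpar_deg (amul_deg ha hb)).
by rewrite (linZ (@amul_linr _ A _)) (linZ (@amul_linl _ A b)) ksgnZ addrC.
Qed.

Lemma gpar1 : gpar (aone : A) = aone.
Proof. by rewrite (gpar_deg (aone_deg A)) ksgn0 scale1r. Qed.

Lemma adiff_amul a b : adiff (amul a b) = amul (adiff a) b + amul (gpar a) (adiff b).
Proof.
move: a; apply: lin_ext.
- exact: lin_comp (@adiff_lin _ A) (@amul_linl _ A b).
- apply: lin_add; first exact: lin_comp (@amul_linl _ A b) (@adiff_lin _ A).
  exact: lin_comp (@amul_linl _ A _) (@gpar_lin _ A).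
- by move=> p a ha; rewrite (adiffM b ha) (gpar_deg ha) (linZ (@amul_linl _ A _)).
Qed.

Lemma adiff1 : adiff (aone : A) = 0.
Proof.
have := adiff_amul aone aone; rewrite gpar1 !amul1l amul1r => e.
by apply: (addrI (adiff aone)); rewrite addr0 -e.
Qed.

Definition mlin (V : lmodType k) (phi : seq A -> V) : Prop :=
  forall u v, linear (fun a => phi (u ++ a :: v)).

Lemma mlin_cons (V : lmodType k) (phi : seq A -> V) a :
  mlin phi -> mlin (fun s => phi (a :: s)).
Proof. by move=> h u v; apply: (h (a :: u)). Qed.

Lemma mlin_head (V : lmodType k) (phi : seq A -> V) v :
  mlin phi -> linear (fun a => phi (a :: v)).
Proof. by move=> h; apply: (h [::]). Qed.

Lemma mlin_ext (V : lmodType k) (phi psi : seq A -> V) : mlin phi -> mlin psi ->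
  (forall t, homog t -> phi (vals t) = psi (vals t)) -> phi =1 psi.
Proof.
move=> hphi hpsi h s.
suff H u v : homog u -> phi (vals u ++ v) = psi (vals u ++ v) by apply: (H [::]).
elim: v u => [|a v IH] u hu; first by rewrite cats0 h.
move: a; apply: lin_ext; [exact: hphi | exact: hpsi |].
move=> p a ha; have := IH (rcons u (p, a)).
rewrite /vals map_rcons cat_rcons; apply.
by move=> q; rewrite mem_rcons inE => /orP [/eqP -> //|]; apply: hu.
Qed.

(** The dual of the bar differential, split into the part bd coming from the
    differential of A, with the Koszul signs of the arguments passed, and the
    part bm coming from the product, with alternating signs. Both are defined
    by recursion on the list, which reduces their relations to inductions. *)
Fixpoint bd (V : lmodType k) (phi : seq A -> V) (s : seq A) : V :=
  if s is a :: s' then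
    phi (adiff a :: s') + bd (fun u => phi (gpar a :: u)) s'
  else 0.

Fixpoint bm (V : lmodType k) (phi : seq A -> V) (s : seq A) : V :=
  if s is a :: s' then
    (if s' is b :: s'' then phi (amul a b :: s'') else 0) -
    bm (fun u => phi (a :: u)) s'
  else 0.

Section Ops.
Variable V : lmodType k.
Implicit Types phi psi : seq A -> V.

Lemma bd_cons phi a s :
  bd phi (a :: s) = phi (adiff a :: s) + bd (fun u => phi (gpar a :: u)) s.
Proof. by []. Qed.

Lemma bm_cons phi a b s :
  bm phi (a :: b :: s) = phi (amul a b :: s) - bm (fun u => phi (a :: u)) (b :: s).
Proof. by []. Qed.

Lemma bm1 phi a : bm phi [:: a] = 0.
Proof. by rewrite /= subr0. Qed.

Lemma bd_eq phi psi s :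
  (forall u, size u = size s -> phi u = psi u) -> bd phi s = bd psi s.
Proof.
elim: s phi psi => //= a s IH phi psi h; rewrite h //; congr (_ + _).
by apply: IH => u e; apply: h; rewrite /= e.
Qed.

Lemma bm_eq phi psi s :
  (forall u, (size u).+1 = size s -> phi u = psi u) -> bm phi s = bm psi s.
Proof.
elim: s phi psi => //= a s IH phi psi h; congr (_ - _).
  by case: s IH h => //= b s _ h; apply: h.
by apply: IH => u e; apply: h; rewrite /= e.
Qed.

Lemma bd0 s : bd (fun _ => 0 : V) s = 0.
Proof. by elim: s => //= a s ->; rewrite addr0. Qed.

Lemma bm0 s : bm (fun _ => 0 : V) s = 0.
Proof. by elim: s => //= a s ->; case: s => *; rewrite subr0. Qed.

Lemma bd_lin c phi psi s :
  bd (fun u => c *: phi u + psi u) s = c *: bd phi s + bd psi s.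
Proof.
elim: s phi psi => [|a s IH] phi psi /=; first by rewrite scaler0 addr0.
by rewrite IH scalerDr addrACA.
Qed.

Lemma bm_lin c phi psi s :
  bm (fun u => c *: phi u + psi u) s = c *: bm phi s + bm psi s.
Proof.
elim: s phi psi => [|a s IH] phi psi /=; first by rewrite scaler0 addr0.
rewrite IH scalerBr opprD addrACA; congr (_ + _).
by case: s {IH} => //=; rewrite scaler0 addr0.
Qed.

Lemma bdZ c phi s : bd (fun u => c *: phi u) s = c *: bd phi s.
Proof.
rewrite -[RHS]addr0 -[in RHS](bd0 s) -bd_lin.
by apply: bd_eq => u _; rewrite addr0.
Qed.

Lemma bmZ c phi s : bm (fun u => c *: phi u) s = c *: bm phi s.
Proof.
rewrite -[RHS]addr0 -[in RHS](bm0 s) -bm_lin.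
by apply: bm_eq => u _; rewrite addr0.
Qed.

Lemma bdD phi psi s : bd (fun u => phi u + psi u) s = bd phi s + bd psi s.
Proof.
rewrite -[bd phi s]scale1r -bd_lin.
by apply: bd_eq => u _; rewrite scale1r.
Qed.

Lemma bmD phi psi s : bm (fun u => phi u + psi u) s = bm phi s + bm psi s.
Proof.
rewrite -[bm phi s]scale1r -bm_lin.
by apply: bm_eq => u _; rewrite scale1r.
Qed.

Lemma bdN phi s : bd (fun u => - phi u) s = - bd phi s.
Proof. by rewrite -scaleN1r -bdZ; apply: bd_eq => u _; rewrite scaleN1r. Qed.

Lemma bmN phi s : bm (fun u => - phi u) s = - bm phi s.
Proof. by rewrite -scaleN1r -bmZ; apply: bm_eq => u _; rewrite scaleN1r. Qed.

Lemma bd_mlin phi : mlin phi -> mlin (bd phi).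
Proof.
move=> hphi u; elim: u phi hphi => [|b u IH] phi hphi v c a1 a2 /=.
  rewrite (adiff_lin) (mlin_head v hphi) scalerDr addrACA; congr (_ + _).
  rewrite -bd_lin; apply: bd_eq => w _.
  by rewrite gpar_lin (mlin_head w hphi).
rewrite (mlin_cons (adiff b) hphi u v) (IH _ (mlin_cons (gpar b) hphi) v c a1 a2).
by rewrite scalerDr addrACA.
Qed.

Lemma bm_mlin phi : mlin phi -> mlin (bm phi).
Proof.
move=> hphi u; elim: u phi hphi => [|b u IH] phi hphi v c a1 a2 /=.
  have -> : bm (fun u => phi (c *: a1 + a2 :: u)) v =
      c *: bm (fun u => phi (a1 :: u)) v + bm (fun u => phi (a2 :: u)) v.
    by rewrite -bm_lin; apply: bm_eq => w _; rewrite (mlin_head w hphi).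
  rewrite scalerBr opprD [RHS]addrACA; congr (_ + _).
  case: v => [|b v]; first by rewrite scaler0 addr0.
  by rewrite amul_linl (mlin_head v hphi).
rewrite (IH _ (mlin_cons b hphi) v c a1 a2) opprD scalerBr [RHS]addrACA; congr (_ + _).
case: u {IH} => [|b' u] /=; first by rewrite amul_linr (mlin_head v hphi).
by rewrite (mlin_cons _ hphi).
Qed.

Lemma bd_comp (W : lmodType k) (L : V -> W) phi s :
  linear L -> L (bd phi s) = bd (fun u => L (phi u)) s.
Proof.
by move=> Ll; elim: s phi => [|a s IH] phi /=; rewrite ?(lin0 Ll) // (linD Ll) IH.
Qed.

Lemma bm_comp (W : lmodType k) (L : V -> W) phi s :
  linear L -> L (bm phi s) = bm (fun u => L (phi u)) s.
Proof.
move=> Ll; elim: s phi => [|a s IH] phi /=; rewrite ?(lin0 Ll) // (linB Ll) IH.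
by case: s {IH} => //=; rewrite (lin0 Ll).
Qed.

Lemma bd_gpar phi s : mlin phi ->
  bd (fun u => phi (map gpar u)) s = - bd phi (map gpar s).
Proof.
elim: s phi => [|a s IH] phi hphi /=; first by rewrite oppr0.
rewrite (IH (fun u => phi (gpar (gpar a) :: u))); last exact: mlin_cons.
by rewrite adiff_gpar (linN (mlin_head _ hphi)) opprD opprK.
Qed.

Lemma bm_gpar phi s : bm (fun u => phi (map gpar u)) s = bm phi (map gpar s).
Proof.
elim: s phi => [|a s IH] phi //=.
rewrite (IH (fun u => phi (gpar a :: u))); congr (_ - _).
by case: s {IH} => //= b s; rewrite gpar_amul.
Qed.

(** The next three lemmas say that bd and bm form a double complex.  In each
    induction the terms acting on the first two arguments cancel among
    themselves, and the others are the induction hypothesis for phi with its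
    first argument frozen. *)
Lemma bd_bd phi s : mlin phi -> bd (bd phi) s = 0.
Proof.
elim: s phi => [|a s IH] phi hphi //=.
rewrite (bdD (fun u => phi (adiff (gpar a) :: u))) gparK IH; last exact: mlin_cons.
rewrite adiffK (lin0 (mlin_head _ hphi)) add0r addr0 -bdD.
rewrite (bd_eq (psi := fun=> 0)) ?bd0 // => u _.
by rewrite adiff_gpar (linN (mlin_head _ hphi)) subrr.
Qed.

Lemma bm_bm phi s : bm (bm phi) s = 0.
Proof.
elim: s phi => [|a [|b s] IH] phi //; first by rewrite /= subr0.
rewrite bm_cons.
pose f1 u := if u is c :: w then phi (amul a c :: w) else 0.
have -> : bm (fun u => bm phi (a :: u)) (b :: s) =
    bm f1 (b :: s) - bm (bm (fun u => phi (a :: u))) (b :: s).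
  by rewrite -bmN -bmD; apply: bm_eq => -[].
rewrite IH subr0; case: s {IH} => [|c s]; first by rewrite /= !subr0.
rewrite !bm_cons /f1 amulA.
by rewrite subrr.
Qed.

Lemma bd_bm phi s : mlin phi -> bd (bm phi) s = bm (bd phi) s.
Proof.
elim: s phi => [|a [|b s] IH] phi hphi //; first by rewrite /= subr0 addr0.
rewrite bm_cons bd_cons bm_cons.
pose f1 u := if u is c :: w then phi (amul (gpar a) c :: w) else 0.
have -> : bd (fun u => bm phi (gpar a :: u)) (b :: s) =
    bd f1 (b :: s) - bd (bm (fun u => phi (gpar a :: u))) (b :: s).
  by rewrite -bdN -bdD; apply: bd_eq => -[].
rewrite IH; last exact: mlin_cons.
rewrite (_ : bm (fun u => bd phi (a :: u)) (b :: s) =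
  bm (fun u => phi (adiff a :: u)) (b :: s) +
  bm (bd (fun u => phi (gpar a :: u))) (b :: s)); last by rewrite -bmD.
rewrite !bd_cons /f1 adiff_amul (linD (mlin_head _ hphi)) gpar_amul.
zmodule.
Qed.

(** The bar differential is a coderivation: a merged pair of arguments never
    straddles a cut of the merged list, so each term falls on one side. *)
Lemma bd_splits (G : seq A -> seq A -> V) s :
  bd (fun u => \sum_(uv <- splits u) G uv.1 uv.2) s =
  \sum_(uv <- splits s) (bd (G^~ uv.2) uv.1 + bd (G (map gpar uv.1)) uv.2).
Proof.
elim: s G => [|a s IH] G; first by rewrite sum_splits_nil /= addr0.
rewrite bd_cons !sum_splits_cons /= add0r.
have -> : bd (fun u => \sum_(uv <- splits (gpar a :: u)) G uv.1 uv.2) s =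
   bd (fun u => G [::] (gpar a :: u)) s +
   bd (fun u => \sum_(uv <- splits u) G (gpar a :: uv.1) uv.2) s.
  by rewrite -bdD; apply: bd_eq => u _; rewrite sum_splits_cons.
rewrite (IH (fun u => G (gpar a :: u))) addrACA -!big_split /=; congr (_ + _).
by apply: eq_bigr => uv _; rewrite addrA.
Qed.

Lemma bm_splits (G : seq A -> seq A -> V) s :
  bm (fun u => \sum_(uv <- splits u) G uv.1 uv.2) s =
  \sum_(uv <- splits s)
    (bm (G^~ uv.2) uv.1 + ksgn (size uv.1)%:Z *: bm (G uv.1) uv.2).
Proof.
elim: s G => [|a s IH] G; first by rewrite sum_splits_nil /= scaler0 addr0.
have h : bm (fun u => \sum_(uv <- splits (a :: u)) G uv.1 uv.2) s =
   bm (fun u => G [::] (a :: u)) s +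
   bm (fun u => \sum_(uv <- splits u) G (a :: uv.1) uv.2) s.
  by rewrite -bmD; apply: bm_eq => u _; rewrite sum_splits_cons.
have hs (uv : seq A * seq A) : ksgn (size (a :: uv.1))%:Z *: bm (G (a :: uv.1)) uv.2 =
    - (ksgn (size uv.1)%:Z *: bm (G (a :: uv.1)) uv.2).
  by rewrite ksgnN; apply: ksgnZ_odd => /=; lia.
rewrite [LHS]/= h (IH (fun u => G (a :: u))) sum_splits_cons /= ksgn0 scale1r add0r opprD.
under [X in _ = _ + X]eq_bigr => uv _ do rewrite hs.
case: s {IH h hs} => [|b s].
  by rewrite !sum_splits_nil /= scaler0; zmodule.
rewrite [X in _ = _ + X](_ : _ =
  \sum_(uv <- splits (b :: s)) (if uv.1 is b :: w then G (amul a b :: w) uv.2 else 0) -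
  \sum_(uv <- splits (b :: s)) (bm (fun u => G (a :: u) uv.2) uv.1 +
     ksgn (size uv.1)%:Z *: bm (G (a :: uv.1)) uv.2)); last first.
  by rewrite -sumrB; apply: eq_bigr => uv _; rewrite opprD addrA.
rewrite [in RHS](sum_splits_cons b) sum_splits_cons /=.
zmodule.
Qed.
End Ops.
End Alg.

(** * The boundary of a family of maps between dg modules *)

Section AopBar.
Variables (k : comPzRingType) (A : dgAlg k).

Lemma tdeg_cons (T : Type) (q : int * T) t : tdeg (q :: t) = q.1 + tdeg t.
Proof. by rewrite /tdeg big_cons. Qed.

Lemma tdeg_nil (T : Type) : tdeg ([::] : seq (int * T)) = 0.
Proof. by rewrite /tdeg big_nil. Qed.

(** The sign prescribed for m_n in aop only depends on the position for n = 2
    and, up to a global sign, on the degrees to the left for n = 1: the operators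
    bm and bd.  The shifts n0 and p record the arguments already passed, as the
    induction on t requires. *)
Lemma aop_bar_gen (V : lmodType k) (psi : seq A -> V) (n0 : nat) (p : int) t :
  mlin psi -> homog t ->
  \sum_(ut <- splits t) \sum_(wv <- splits ut.2)
    ksgn ((1 + (n0 + size ut.1)) * size wv.1 + size wv.2)%:Z *:
    (ksgn ((2 - (size wv.1)%:Z) * (p + tdeg ut.1)) *:
     psi (vals ut.1 ++ mA (vals wv.1) :: vals wv.2)) =
  ksgn ((n0 + size t)%:Z + p) *: bd psi (vals t) +
  ksgn (size t)%:Z *: bm psi (vals t).
Proof.
elim: t psi n0 p => [|[d a] t IH] psi n0 p hpsi ht.
  by rewrite !sum_splits_nil /= (lin0 (mlin_head _ hpsi)) !scaler0 addr0.
have ha : gdeg d a by apply: (ht (d, a)); rewrite inE eqxx.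
have ht' : homog t by move=> q hq; apply: ht; rewrite inE hq orbT.
rewrite sum_splits_cons /=.
under [X in _ + X]eq_bigr => ut _.
  under eq_bigr => wv _ do rewrite tdeg_cons /= addrA -addSnnS.
  over.
rewrite (IH (fun u => psi (a :: u)) n0.+1 (p + d)) //; last exact: mlin_cons.
have -> : bd (fun u => psi (gpar a :: u)) (vals t) =
    ksgn d *: bd (fun u => psi (a :: u)) (vals t).
  rewrite -bdZ; apply: bd_eq => u _.
  by rewrite (gpar_deg ha) (linZ (mlin_head _ hpsi)).
have -> : \sum_(wv <- splits ((d, a) :: t))
    ksgn ((1 + (n0 + 0)) * size wv.1 + size wv.2)%:Z *:
    (ksgn ((2 - (size wv.1)%:Z) * (p + tdeg ([::] : seq (int * A)))) *:
     psi (mA (vals wv.1) :: vals wv.2)) =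
   ksgn ((n0 + (size t).+1)%:Z + p) *: psi (adiff a :: vals t) +
   ksgn (size t).+1%:Z *:
     (if vals t is b :: s then psi (amul a b :: s) else 0).
  rewrite tdeg_nil sum_splits_cons /= (lin0 (mlin_head _ hpsi)) !scaler0 add0r.
  case: t {IH ht ht'} => [|[d' b] t].
    rewrite sum_splits_nil /= !scaler0 !addr0 ksgnZ.
    by apply: ksgnZ_odd; lia.
  rewrite (sum_splits_cons (d', b)) /=.
  rewrite (sum_splits_first t (F := fun w v =>
    ksgn ((1 + (n0 + 0)) * (size w).+2 + size v)%:Z *:
    (ksgn ((2 - (size w).+2%:Z) * (p + 0)) *:
     psi (mA [:: a, b & vals w] :: vals v)))); last first.
    by move=> [|c w] v //= _; rewrite (lin0 (mlin_head _ hpsi)) !scaler0.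
  rewrite !ksgnZ; congr (_ + _); first by apply: ksgnZ_odd => /=; lia.
  by apply: ksgnZ_odd => /=; lia.
rewrite /= scalerBr scalerDr ksgnZ.
have -> : (n0.+1 + size t)%:Z + (p + d) = (n0 + (size t).+1)%:Z + p + d by lia.
have -> : ksgn (size t)%:Z = - ksgn (size t).+1%:Z :> k.
  by rewrite -mulrN1 -(ksgn1 k) -ksgnD; apply: ksgn_odd; lia.
by rewrite scaleNr; zmodule.
Qed.

Lemma fam_mlin (M N : gmod k) e (f : M -> seq A -> N) x : is_family e f -> mlin (f x).
Proof. by move=> hf u v; apply: fam_linA hf x u v. Qed.

(** The sign of x is absorbed by the parity involution, which frees aop from
    explicit degrees. *)
Lemma aop_bar (M N : gmod k) e (f : M -> seq A -> N) p x t :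
  is_family e f -> gdeg p x -> homog t ->
  aop f p x t = ksgn (size t)%:Z *:
    (bd (f (gpar x)) (vals t) + bm (f x) (vals t)).
Proof.
move=> hf hx ht; rewrite /aop.
have := @aop_bar_gen _ (f x) 0 p t (fam_mlin x hf) ht.
rewrite /= => ->; rewrite scalerDr; congr (_ + _).
rewrite -ksgnZ -bdZ; congr (_ *: _); apply: bd_eq => u _.
by rewrite (gpar_deg hx) (linZ (fam_lin hf _)).
Qed.
End AopBar.

Section DGModules.
Variables (k : comPzRingType) (A : dgAlg k).

Section Laws.
Variable Y : dgMod A.
Implicit Types (y : Y) (a b : A).

Lemma dg_d_lin : linear (fun y => am Y y [::]).
Proof. exact: fam_lin (am_fam Y) [::]. Qed.

Lemma dg_act_linl a : linear (fun y => am Y y [:: a]).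
Proof. exact: fam_lin (am_fam Y) [:: a]. Qed.

Lemma dg_act_linr y : linear (fun a => am Y y [:: a]).
Proof. exact: fam_linA (am_fam Y) y [::] [::]. Qed.

Lemma homog1 p a : gdeg p a -> homog [:: (p, a)].
Proof. by move=> ha q; rewrite inE => /eqP ->. Qed.

Lemma dg_d_deg p y : gdeg p y -> gdeg (p + 1) (am Y y [::]).
Proof.
move=> hy; have := fam_deg (am_fam Y) hy (t := [::]).
by rewrite tdeg_nil addr0 subr0; apply.
Qed.

Lemma dg_act_deg p q y a : gdeg p y -> gdeg q a -> gdeg (p + q) (am Y y [:: a]).
Proof.
move=> hy ha; have := fam_deg (am_fam Y) hy (homog1 ha).
by rewrite tdeg_cons tdeg_nil /= addr0 addrK.
Qed.

Lemma dg_dd y : am Y (am Y y [::]) [::] = 0.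
Proof.
move: y; apply: (lin_ext (g := fun=> 0)).
- exact: lin_comp dg_d_lin dg_d_lin.
- by move=> c x y; rewrite scaler0 addr0.
- by move=> p x; apply: dg_diffK.
Qed.

Lemma dg_gpar_d y : am Y (gpar y) [::] = - gpar (am Y y [::]).
Proof.
by have := gpar_map dg_d_lin dg_d_deg y; rewrite ksgn1 scaleN1r.
Qed.

Lemma dg_gpar_act y a : gpar (am Y y [:: a]) = am Y (gpar y) [:: gpar a].
Proof.
move: a; apply: lin_ext.
- exact: lin_comp (@gpar_lin _ Y) (dg_act_linr y).
- exact: lin_comp (dg_act_linr _) (@gpar_lin _ A).
move=> q a ha; move: y; apply: lin_ext.
- exact: lin_comp (@gpar_lin _ Y) (dg_act_linl a).
- exact: lin_comp (dg_act_linl _) (@gpar_lin _ Y).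
move=> p y hy; rewrite (gpar_deg ha) (gpar_deg hy) (gpar_deg (dg_act_deg hy ha)).
by rewrite (linZ (dg_act_linr _)) (linZ (dg_act_linl _)) ksgnZ addrC.
Qed.

Lemma dg_d_act y a :
  am Y (am Y y [:: a]) [::] = am Y (am Y y [::]) [:: a] + am Y (gpar y) [:: adiff a].
Proof.
move: y; apply: lin_ext.
- exact: lin_comp dg_d_lin (dg_act_linl a).
- apply: lin_add; first exact: lin_comp (dg_act_linl a) dg_d_lin.
  exact: lin_comp (dg_act_linl _) (@gpar_lin _ Y).
move=> p y hy; move: a; apply: lin_ext.
- exact: lin_comp dg_d_lin (dg_act_linr y).
- apply: lin_add; first exact: dg_act_linr.
  exact: lin_comp (dg_act_linr _) (@adiff_lin _ A).
move=> q a ha; rewrite (dg_leibniz hy ha) (gpar_deg hy).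
by rewrite (linZ (dg_act_linl _)).
Qed.

Lemma dg_actA y a b : am Y (am Y y [:: a]) [:: b] = am Y y [:: amul a b].
Proof.
move: y; apply: lin_ext.
- exact: lin_comp (dg_act_linl b) (dg_act_linl a).
- exact: dg_act_linl.
move=> p y hy; move: a; apply: lin_ext.
- exact: lin_comp (dg_act_linl b) (dg_act_linr y).
- exact: lin_comp (dg_act_linr _) (@amul_linl _ A b).
move=> q a ha; move: b; apply: lin_ext.
- exact: dg_act_linr.
- exact: lin_comp (dg_act_linr _) (@amul_linr _ A a).
by move=> r b hb; apply: dg_assoc hy ha hb.
Qed.
End Laws.

(** The converse of the laws above: in arity at least four all terms of the
    A_oo-relations vanish, and the first three arities are d^2 = 0, the Leibniz
    rule and associativity. *)
Section Constructor.
Variables (M : gmod k) (d : M -> M) (act : M -> A -> M).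
Hypothesis d_lin : linear d.
Hypothesis d_deg : forall p x, gdeg p x -> gdeg (p + 1) (d x).
Hypothesis dd : forall x, d (d x) = 0.
Hypothesis act_linl : forall a, linear (act^~ a).
Hypothesis act_linr : forall x, linear (act x).
Hypothesis act_deg : forall p q x a, gdeg p x -> gdeg q a -> gdeg (p + q) (act x a).
Hypothesis actA : forall x a b, act (act x a) b = act x (amul a b).
Hypothesis act1 : forall x, act x aone = x.
Hypothesis d_act : forall x a, d (act x a) = act (d x) a + act (gpar x) (adiff a).

Definition dgfam (x : M) (s : seq A) : M :=
  match s with [::] => d x | [:: a] => act x a | _ => 0 end.

Lemma dgfam_family : is_family 1 dgfam.
Proof.
split.
- move=> [|a [|b s]] c x y //=; last by rewrite scaler0 addr0.
    exact: d_lin.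
  exact: act_linl.
- move=> x [|a [|b u]] [|a' v] c a1 a2 /=; rewrite ?scaler0 ?addr0 //.
  exact: act_linr.
- move=> p x [|[q a] [|r t]] hx ht /=; last exact: gdeg0.
    by rewrite tdeg_nil addr0 subr0; apply: d_deg.
  rewrite tdeg_cons tdeg_nil /= addr0 addrK; apply: act_deg => //.
  by apply: (ht (q, a)); rewrite inE eqxx.
Qed.

Lemma dgfam_high x s : (1 < size s)%N -> dgfam x s = 0.
Proof. by case: s => [|a [|b s]]. Qed.

Lemma dgfam_rel p x t : gdeg p x -> homog t -> circ dgfam dgfam p x t = 0.
Proof.
move=> hx ht; rewrite /circ (aop_bar dgfam_family hx ht).
case: t ht => [|[q a] [|[r b] [|z t]]] ht.
- by rewrite /famcomp sum_splits_nil /= dd addr0 !scaler0 addr0.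
- rewrite /famcomp sum_splits_cons sum_splits_nil /= ksgn1 ksgn0 !scaleN1r scale1r.
  by rewrite subr0 !addr0 d_act addKr subrr.
- rewrite /famcomp !sum_splits_cons sum_splits_nil /= ksgn1 ksgn0 !scaleN1r.
  rewrite (lin0 d_lin) actA.
  by rewrite !scaler0 !subr0 !add0r addr0 (@ksgnZ_even _ _ 2) // addNr.
- rewrite (bd_eq (psi := fun=> 0)) ?bd0; last first.
    by move=> u hu; apply: dgfam_high; rewrite hu.
  rewrite (bm_eq (psi := fun=> 0)) ?bm0; last first.
    by move=> u [hu]; apply: dgfam_high; rewrite hu.
  rewrite addr0 scaler0 addr0 /famcomp big_seq big1 // => -[u v] /splits_cat /= E.
  case: (ltnP 1 (size u)) => hu.
    by rewrite (dgfam_high _ hu) (lin0 (fam_lin dgfam_family v)) scaler0.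
  rewrite (dgfam_high _ (s := v)) ?scaler0 //.
  move/(congr1 size): E; rewrite size_cat /=; move: hu.
  by case: (size u) => [|[|n]] // _; [rewrite add0n => -> | rewrite add1n => -[->]].
Qed.

Lemma dgfam_su x s : (1 < size s)%N -> aone \in s -> dgfam x s = 0.
Proof. by move=> hs _; apply: dgfam_high. Qed.

Definition mkdg : dgMod A :=
  DGMod (dg_ainf := @AinfMod k A M dgfam dgfam_family dgfam_rel act1 dgfam_su)
    dgfam_high.
End Constructor.

(** The two terms of the boundary of a family in which an argument acts: the last
    one acts on the value, the first one on the source. *)
Fixpoint lact (Y : dgMod A) (phi : seq A -> Y) (s : seq A) : Y :=
  if s is a :: s' then
    if s' is [::] then am Y (phi [::]) [:: a] else lact (fun u => phi (a :: u)) s'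
  else 0.

Definition hact (X : dgMod A) (V : lmodType k) (f : X -> seq A -> V) x (s : seq A) : V :=
  if s is b :: s' then f (am X x [:: b]) s' else 0.

Section LastAction.
Variable Y : dgMod A.
Implicit Types phi psi : seq A -> Y.

Lemma lact_cons phi a b s :
  lact phi (a :: b :: s) = lact (fun u => phi (a :: u)) (b :: s).
Proof. by []. Qed.

Lemma lact_eq phi psi s :
  (forall u, (size u).+1 = size s -> phi u = psi u) -> lact phi s = lact psi s.
Proof.
elim: s phi psi => [|a [|b s] IH] phi psi h //; first by rewrite /= h.
by rewrite !lact_cons; apply: IH => u e; apply: h; rewrite /= e.
Qed.

Lemma lact_lin c phi psi s :
  lact (fun u => c *: phi u + psi u) s = c *: lact phi s + lact psi s.
Proof.
elim: s phi psi => [|a [|b s] IH] phi psi; first by rewrite scaler0 addr0.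
  exact: dg_act_linl.
by rewrite !lact_cons IH.
Qed.

Lemma lact0 s : lact (fun=> 0 : Y) s = 0.
Proof.
elim: s => [|a [|b s] IH] //; first by rewrite /= (lin0 (dg_act_linl (Y := Y) a)).
Qed.

Lemma lactZ c phi s : lact (fun u => c *: phi u) s = c *: lact phi s.
Proof.
rewrite -[RHS]addr0 -[in RHS](lact0 s) -lact_lin.
by apply: lact_eq => u _; rewrite addr0.
Qed.

Lemma lactD phi psi s : lact (fun u => phi u + psi u) s = lact phi s + lact psi s.
Proof.
rewrite -[lact phi s]scale1r -lact_lin.
by apply: lact_eq => u _; rewrite scale1r.
Qed.

Lemma lactN phi s : lact (fun u => - phi u) s = - lact phi s.
Proof. by rewrite -scaleN1r -lactZ; apply: lact_eq => u _; rewrite scaleN1r. Qed.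

Lemma lact_mlin phi : mlin phi -> mlin (lact phi).
Proof.
move=> hphi u; elim: u phi hphi => [|b u IH] phi hphi [|b' v] c a1 a2.
- exact: dg_act_linr.
- rewrite -[LHS]/(lact (fun w => phi (c *: a1 + a2 :: w)) (b' :: v)).
  rewrite (lact_eq (psi := fun w => c *: phi (a1 :: w) + phi (a2 :: w))) ?lact_lin //.
  by move=> w _; apply: mlin_head.
- case: u IH => [|b' u] IH; first exact: (IH _ (mlin_cons b hphi) [::]).
  exact: (IH _ (mlin_cons b hphi) [::]).
- case: u IH => [|b'' u] IH; exact: (IH _ (mlin_cons b hphi) (b' :: v)).
Qed.

Lemma lact_gpar phi s :
  gpar (lact phi (map gpar s)) = lact (fun u => gpar (phi (map gpar u))) s.
Proof.
elim: s phi => [|a [|b s] IH] phi; first exact: (lin0 (@gpar_lin _ Y)).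
  by rewrite /= dg_gpar_act gparK.
by rewrite [map _ _]/= lact_cons (IH (fun u => phi (gpar a :: u))).
Qed.

(** The defect of commutation with lact of both bd and the differential of Y;
    in the square of the differential of the coinduced module these two defects
    cancel. *)
Fixpoint lastd phi (s : seq A) : Y :=
  if s is a :: s' then
    if s' is [::] then am Y (phi [::]) [:: adiff a]
    else lastd (fun u => phi (gpar a :: u)) s'
  else 0.

Lemma lastd_eq phi psi s :
  (forall u, (size u).+1 = size s -> phi u = psi u) -> lastd phi s = lastd psi s.
Proof.
elim: s phi psi => [|a [|b s] IH] phi psi h //; first by rewrite /= h.
by apply: IH => u e; apply: h; rewrite /= e.
Qed.

Lemma lastdZ c phi s : lastd (fun u => c *: phi u) s = c *: lastd phi s.
Proof.
elim: s phi => [|a [|b s] IH] phi; first by rewrite scaler0.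
  exact: (linZ (dg_act_linl _)).
exact: (IH (fun u => phi (gpar a :: u))).
Qed.

Lemma bd_lact phi s : bd (lact phi) s = lact (bd phi) s + lastd phi s.
Proof.
elim: s phi => [|a [|b s] IH] phi; first by rewrite addr0.
  by rewrite /= addr0 (lin0 (dg_act_linl (Y := Y) a)) add0r.
rewrite bd_cons !lact_cons (lactD (fun u => phi (adiff a :: u))) -addrA; congr (_ + _).
rewrite (_ : lastd phi _ = lastd (fun u => phi (gpar a :: u)) (b :: s)) // -IH.
by apply: bd_eq => -[].
Qed.

Lemma d_lact phi s :
  am Y (lact phi s) [::] =
  lact (fun u => am Y (phi u) [::]) s + lastd (fun u => gpar (phi (map gpar u))) s.
Proof.
elim: s phi => [|a [|b s] IH] phi.
- by rewrite addr0 (lin0 (dg_d_lin (Y := Y))).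
- exact: dg_d_act.
rewrite !lact_cons IH; congr (_ + _).
rewrite [RHS]/(lastd (fun u => gpar (phi (gpar (gpar a) :: map gpar u))) (b :: s)).
by rewrite gparK.
Qed.

(** The two orders only differ by the product of the last two arguments. *)
Lemma lact_bm phi s :
  lact (bm phi) s = bm (lact phi) s + ksgn ((size s)%:Z + 1) *: lact (lact phi) s.
Proof.
elim: s phi => [|a s IH] phi; first by rewrite scaler0 addr0.
case: s IH => [|b s] IH.
  by rewrite /= (lin0 (dg_act_linl (Y := Y) a)) scaler0 addr0 subr0.
case: s IH => [|c s] IH.
  rewrite /= !subr0 (lin0 (dg_act_linl (Y := Y) b)) dg_actA.
  by rewrite ksgn_oddN // scaleN1r subrr.
have E1 : lact (bm phi) [:: a, b, c & s] =
    lact (fun u => phi (amul a b :: u)) (c :: s) -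
    lact (bm (fun u => phi (a :: u))) [:: b, c & s].
  rewrite lact_cons -lactN (lact_eq (psi := fun u =>
    (if u is b' :: u' then phi (amul a b' :: u') else 0) -
     bm (fun w => phi (a :: w)) u)) //.
  by rewrite lactD lactN lact_cons.
have E2 : lact (lact phi) [:: a, b, c & s] =
    lact (lact (fun u => phi (a :: u))) [:: b, c & s].
  by rewrite lact_cons; apply: lact_eq => -[].
have E3 : bm (fun u => lact phi (a :: u)) [:: b, c & s] =
    bm (lact (fun u => phi (a :: u))) [:: b, c & s].
  by apply: bm_eq => -[].
rewrite E1 E2 IH (bm_cons (lact phi)) E3 lact_cons.
rewrite opprD addrA ksgnN; congr (_ + _); apply: ksgnZ_odd => /=; lia.
Qed.

Lemma lact_splits (G : seq A -> seq A -> Y) s :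
  lact (fun u => \sum_(uv <- splits u) G uv.1 uv.2) s =
  \sum_(uv <- splits s) lact (G uv.1) uv.2.
Proof.
elim: s G => [|a [|b s] IH] G; first by rewrite sum_splits_nil.
  by rewrite sum_splits_cons !sum_splits_nil /= sum_splits_nil addr0.
rewrite lact_cons sum_splits_cons (lact_cons (G [::])).
rewrite -(IH (fun u => G (a :: u))) -lactD; apply: lact_eq => u _.
by rewrite sum_splits_cons.
Qed.

(** Moving the argument next to the cut from one side of the cut to the other. *)
Lemma hact_splits (V : lmodType k) (f : Y -> seq A -> V) phi s :
  (forall v, linear (f^~ v)) ->
  \sum_(uv <- splits s) hact f (phi uv.1) uv.2 =
  \sum_(uv <- splits s) f (lact phi uv.1) uv.2.
Proof.
move=> fl; elim: s phi => [|a s IH] phi.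
  by rewrite !sum_splits_nil /= (lin0 (fl _)).
rewrite !sum_splits_cons /= (lin0 (fl _)) add0r (IH (fun u => phi (a :: u))).
case: s {IH} => [|b s]; first by rewrite !sum_splits_nil /= (lin0 (fl _)) addr0.
by rewrite !(sum_splits_cons b) /= (lin0 (fl _)) add0r.
Qed.

Lemma am_splits e phi s :
  \sum_(uv <- splits s) ksgn (e * (size uv.2)%:Z) *: am Y (phi uv.1) uv.2 =
  am Y (phi s) [::] + ksgn e *: lact phi s.
Proof.
elim: s phi => [|a s IH] phi.
  by rewrite sum_splits_nil /= mulr0 ksgn0 scale1r scaler0 addr0.
rewrite sum_splits_cons (IH (fun u => phi (a :: u))) /=.
case: s {IH} => [|b s]; first by rewrite mulr1 scaler0 addr0 addrC.
by rewrite dg_high // scaler0 add0r.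
Qed.
End LastAction.

(** The differential of the complex of families from X to Y, where e is the degree
    of f, or any integer of the same parity. Its cycles of degree 0 are the
    A_oo-morphisms, and a homotopy h, of degree -1, from f to g satisfies
    bdry 1 h = f - g. *)
Definition bdry (X Y : dgMod A) e (f : X -> seq A -> Y) (x : X) (s : seq A) : Y :=
  am Y (f x s) [::] + ksgn e *: lact (f x) s -
  ksgn (e + (size s)%:Z) *:
    (f (am X x [::]) s - hact f x s + bd (f (gpar x)) s + bm (f x) s).

Section Boundary.
Variables X Y : dgMod A.
Implicit Types f h : X -> seq A -> Y.

Lemma famcomp_am e d f x s : is_family d f ->
  famcomp e (am Y) f x s = am Y (f x s) [::] + ksgn e *: lact (f x) s.
Proof. by move=> _; rewrite /famcomp am_splits. Qed.

Lemma famcomp_am_r d f x s : is_family d f ->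
  famcomp 1 f (am X) x s =
  ksgn (size s)%:Z *: (f (am X x [::]) s - hact f x s).
Proof.
move=> hf; rewrite /famcomp; case: s => [|a s].
  by rewrite sum_splits_nil /= mulr0 subr0.
rewrite !sum_splits_cons /=.
rewrite (sum_splits_first s (F := fun u v => ksgn (1 * (size v)%:Z) *: f (am X x (a :: u)) v)).
  rewrite scalerBr !mul1r; congr (_ + _).
  by rewrite ksgnN; apply: ksgnZ_odd; lia.
by move=> [|b u] v //= _; rewrite dg_high // (lin0 (fam_lin hf _)) scaler0.
Qed.

Lemma bdryE e d f p x t : is_family d f -> gdeg p x -> homog t ->
  bdry e f x (vals t) =
  famcomp e (am Y) f x (vals t) - ksgn e *: circ (am X) f p x t.
Proof.
move=> hf hx ht; rewrite /circ (famcomp_am_r _ _ hf) (aop_bar hf hx ht).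
rewrite (famcomp_am _ _ _ hf) /bdry size_vals; congr (_ - _).
by rewrite -scalerDr ksgnZ addrA.
Qed.

Lemma ainf_bdry (f : ainfHom X Y) p x t : gdeg p x -> homog t ->
  bdry 0 f x (vals t) = 0.
Proof.
move=> hx ht; rewrite (bdryE _ (ah_fam f) hx ht) (ah_rel f hx ht).
by rewrite ksgn0 scale1r subrr.
Qed.

Lemma bdry_ainf f p x t : is_family 0 f -> gdeg p x -> homog t ->
  bdry 0 f x (vals t) = 0 -> circ (am X) f p x t = famcomp 0 (am Y) f x (vals t).
Proof.
move=> hf hx ht; rewrite (bdryE _ hf hx ht) ksgn0 scale1r => e.
by apply/esym/eqP; rewrite -subr_eq0 e.
Qed.

Lemma bdry_homotopic (f g : ainfHom X Y) h : is_family (-1) h ->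
  strictly_unital h ->
  (forall p x t, gdeg p x -> homog t ->
    f x (vals t) - g x (vals t) = bdry 1 h x (vals t)) ->
  homotopic f g.
Proof.
move=> hh hu e; exists h; split=> // p x t hx ht; rewrite (e p) //.
by rewrite (bdryE _ hh hx ht) ksgn1 scaleN1r opprK.
Qed.

Lemma homotopic_bdry (f g : ainfHom X Y) : homotopic f g ->
  exists h, [/\ is_family (-1) h, strictly_unital h &
    forall p x t, gdeg p x -> homog t ->
      f x (vals t) - g x (vals t) = bdry 1 h x (vals t)].
Proof.
move=> [h [hh hu e]]; exists h; split=> // p x t hx ht; rewrite (e p) //.
by rewrite (bdryE _ hh hx ht) ksgn1 scaleN1r opprK.
Qed.
End Boundary.
End DGModules.

(** * Operators on the coinduced module *)

Section CoinducedOperators.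
Variables (k : comPzRingType) (A : dgAlg k).

Section Target.
Variable Y : dgMod A.
Implicit Types phi psi : seq A -> Y.

(** The parity involution of the coinduced module, expressed on the values: a
    homogeneous element of degree n is multiplied by (-1)^n, because its value
    at a :: s has degree n + |a| + |s| - size s. *)
Definition tw phi (s : seq A) : Y := ksgn ((size s)%:Z + 1) *: gpar (phi (map gpar s)).

(** The differential of the complex of families from A to Y, where phi (a :: s)
    is the value at a of the component of arity size s. The signs are those for
    which evaluation at a = 1 is an A_oo-morphism to Y without any sign. *)
Definition cdiff phi (s : seq A) : Y :=
  ksgn ((size s)%:Z + 1) *: (am Y (phi s) [::] + lact phi s) + bm phi s - bd (tw phi) s.

(** Right multiplication on the coinduced module comes from left multiplication
    on the first argument, the one in which phi is not normalized. *)
Definition cact phi (b : A) (s : seq A) : Y :=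
  if s is a :: s' then phi (amul b a :: s') else 0.

Lemma tw_mlin phi : mlin phi -> mlin (tw phi).
Proof.
move=> h u v c a1 a2; rewrite /tw !map_cat /= !size_cat /= gpar_lin h gpar_lin.
by rewrite scalerDr !scalerA mulrC.
Qed.

Lemma twK phi : tw (tw phi) =1 phi.
Proof.
move=> s; rewrite /tw size_map (linZ (@gpar_lin _ Y)) gparK ksgnZ ksgnZ_even; last by lia.
by rewrite (mapK (@gparK _ A)).
Qed.

Lemma bd_tw phi s : mlin phi -> tw (bd phi) s = - bd (tw phi) s.
Proof.
move=> h; rewrite /tw.
rewrite [in RHS](bd_eq (psi := fun u => ksgn ((size s)%:Z + 1) *: gpar (phi (map gpar u)))).
  rewrite bdZ -scalerN; congr (_ *: _); rewrite -(bd_comp _ _ (@gpar_lin _ Y)).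
  by rewrite bd_gpar // (linN (@gpar_lin _ Y)) opprK.
by move=> u ->.
Qed.

Lemma bm_tw phi s : tw (bm phi) s = - bm (tw phi) s.
Proof.
rewrite /tw.
rewrite [in RHS](bm_eq (psi := fun u => ksgn (size s)%:Z *: gpar (phi (map gpar u)))).
  rewrite bmZ ksgnN -(bm_comp _ _ (@gpar_lin _ Y)).
  by rewrite bm_gpar.
by move=> u <-; apply: ksgnZ_odd; lia.
Qed.

Lemma lact_tw phi s : tw (lact phi) s = - lact (tw phi) s.
Proof.
rewrite /tw lact_gpar.
rewrite [in RHS](lact_eq (psi := fun u => ksgn (size s)%:Z *: gpar (phi (map gpar u)))).
  by rewrite lactZ ksgnN.
by move=> u <-; apply: ksgnZ_odd; lia.
Qed.

Lemma cdiff_tw phi s : mlin phi -> tw (cdiff phi) s = - cdiff (tw phi) s.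
Proof.
move=> h; have h' := tw_mlin h.
have -> : tw (cdiff phi) s = ksgn ((size s)%:Z + 1) *:
    (tw (fun u => am Y (phi u) [::]) s + tw (lact phi) s) + tw (bm phi) s - tw (bd (tw phi)) s.
  have l := @gpar_lin _ Y.
  rewrite /tw /cdiff size_map (linB l) (linD l) (linZ l) (linD l).
  by rewrite !scalerDr scalerN.
rewrite lact_tw bm_tw (bd_tw s h').
have -> : tw (fun u => am Y (phi u) [::]) s = - am Y (tw phi s) [::].
  by rewrite /tw (linZ (@dg_d_lin _ _ Y)) dg_gpar_d scalerN opprK.
by rewrite /cdiff -opprD scalerN; zmodule.
Qed.

Lemma cdiff_mlin phi : mlin phi -> mlin (cdiff phi).
Proof.
move=> h u v c a1 a2; rewrite /cdiff !size_cat /=.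
rewrite (bd_mlin (tw_mlin h)) (bm_mlin h) (lact_mlin h) h (dg_d_lin (Y := Y)).
rewrite !(scalerDr, scalerN).
by rewrite !(scalerA c) ![c * _]mulrC -!scalerA; zmodule.
Qed.

(** The square is expanded in the four operators d, lact, bm and bd. What their
    mutual (anti)commutation leaves vanishes because the action is associative
    and satisfies the Leibniz rule, and because the bar differential has square
    zero. *)
Lemma cdiffK phi s : mlin phi -> cdiff (cdiff phi) s = 0.
Proof.
move=> h; have h' := tw_mlin h.
set e := ksgn ((size s)%:Z + 1) : k.
have ee : e * e = 1 by rewrite ksgnK.
have eN : ksgn (size s)%:Z = - e :> k.
  by rewrite -mulrN1 -(ksgn1 k) -ksgnD; apply: ksgn_odd; lia.
have ld := @dg_d_lin _ _ Y.
have ED : am Y (cdiff phi s) [::] = e *: am Y (lact phi s) [::] +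
    am Y (bm phi s) [::] - am Y (bd (tw phi) s) [::].
  by rewrite /cdiff (linB ld) (linD ld) (linZ ld) (linD ld) dg_dd add0r.
have EL : lact (cdiff phi) s = - e *: (lact (fun u => am Y (phi u) [::]) s +
    lact (lact phi) s) + lact (bm phi) s - lact (bd (tw phi)) s.
  rewrite -lactD -lactZ -lactD -lactN -lactD; apply: lact_eq => u hu.
  by rewrite /cdiff -eN -hu (_ : (size u).+1%:Z = (size u)%:Z + 1) //; lia.
have EM : bm (cdiff phi) s = - e *: (bm (fun u => am Y (phi u) [::]) s +
    bm (lact phi) s) - bm (bd (tw phi)) s.
  rewrite -[X in _ = X - _]addr0 -(bm_bm phi s).
  rewrite -bmD -bmZ -bmD -bmN -bmD; apply: bm_eq => u hu.
  by rewrite /cdiff -eN -hu (_ : (size u).+1%:Z = (size u)%:Z + 1) //; lia.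
have EB : bd (tw (cdiff phi)) s = - (e *: (bd (fun u => am Y (tw phi u) [::]) s +
    bd (lact (tw phi)) s) + bd (bm (tw phi)) s).
  rewrite -[X in _ = - X]subr0 -[X in _ = - (_ - X)](bd_bd s h).
  rewrite -bdD -bdZ -bdD -bdN -bdD -bdN; apply: bd_eq => u hu.
  rewrite (cdiff_tw _ h) /cdiff hu; congr (- (_ - _)).
  by apply: bd_eq => w _; apply: twK.
have El : lastd (tw phi) s = - e *: lastd (fun u => gpar (phi (map gpar u))) s.
  rewrite -eN -lastdZ; apply: lastd_eq => u <-.
  by apply: ksgnZ_odd; lia.
rewrite /cdiff -/(cdiff _) -/e ED EL EM EB.
rewrite -(bm_comp _ _ ld) -(bd_comp _ _ ld) (bd_bm _ h') bd_lact El d_lact lact_bm -/e.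
rewrite !(scalerDr, scalerN, scaleNr, opprD, opprK) !scalerA ee !scale1r.
zmodule.
Qed.

(** ** Strict unitality *)

Definition cunital (V : lmodType k) (phi : seq A -> V) : Prop :=
  forall a s, aone \in s -> phi (a :: s) = 0.

Definition funital (V : lmodType k) (phi : seq A -> V) : Prop :=
  forall s, aone \in s -> phi s = 0.

Lemma cunital_funital phi a : cunital phi -> funital (fun s => phi (a :: s)).
Proof. by move=> h s; apply: h. Qed.

Lemma funital_cunital phi : funital phi -> cunital phi.
Proof. by move=> h a s hs; apply: h; rewrite inE hs orbT. Qed.

Lemma bd_funital phi : mlin phi -> funital phi -> funital (bd phi).
Proof.
move=> h hu s; elim: s phi h hu => [|b s IH] phi h hu //; rewrite inE => hs.
rewrite bd_cons; case: (boolP (aone \in s)) hs => [hs _|_].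
  rewrite hu ?inE ?hs ?orbT // add0r IH //; first exact: mlin_cons.
  by move=> u huu; apply: hu; rewrite inE huu orbT.
rewrite orbF => /eqP <-; rewrite adiff1 (lin0 (mlin_head _ h)) add0r gpar1.
rewrite (bd_eq (psi := fun=> 0)) ?bd0 // => u _.
by rewrite hu // inE eqxx.
Qed.

Lemma bd_cunital phi : mlin phi -> cunital phi -> cunital (bd phi).
Proof.
move=> h hu a s hs; rewrite bd_cons hu // add0r.
by apply: bd_funital hs; [apply: mlin_cons | apply: cunital_funital].
Qed.

Lemma tw_cunital phi : cunital phi -> cunital (tw phi).
Proof.
move=> hu a s hs; rewrite /tw [map _ _]/= hu ?(lin0 (@gpar_lin _ Y)) ?scaler0 //.
by apply/mapP; exists aone; rewrite ?gpar1.
Qed.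

(** A unit inside s is absorbed by both of its neighbours, with opposite signs;
    when it comes last, the second neighbour is the value of phi, on which it
    acts through lact. *)
Lemma bm_lact_cunital phi a s : cunital phi -> aone \in s ->
  bm phi (a :: s) + ksgn (size s)%:Z *: lact phi (a :: s) = 0.
Proof.
elim: s phi a => [|b s IH] phi a hu //; rewrite inE => hs.
have hf := cunital_funital a hu.
rewrite bm_cons lact_cons.
case: (boolP (aone \in s)) hs => [hs _|_].
  rewrite hu // sub0r.
  have := IH (fun u => phi (a :: u)) b (funital_cunital hf) hs => /eqP.
  rewrite addr_eq0 => /eqP ->; rewrite opprK -scalerDl.
  have -> : ksgn (size (b :: s))%:Z = - ksgn (size s)%:Z :> k.
    by rewrite -mulrN1 -(ksgn1 k) -ksgnD; apply: ksgn_odd => /=; lia.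
  by rewrite subrr scale0r.
rewrite orbF => /eqP <-; rewrite amul1r; case: s {IH} => [|c s].
  by rewrite bm1 subr0 /= am_one ksgn1 scaleN1r subrr.
rewrite bm_cons amul1l lact_cons (bm_eq (psi := fun=> 0)) ?bm0; last first.
  by move=> u _; apply: hf; rewrite inE eqxx.
rewrite (lact_eq (psi := fun=> 0)) ?lact0 ?scaler0; last first.
  by move=> u _; apply: hf; rewrite inE eqxx.
by rewrite subr0 subrr addr0.
Qed.

Lemma cdiff_cunital phi : mlin phi -> cunital phi -> cunital (cdiff phi).
Proof.
move=> h hu a s hs; rewrite /cdiff hu // (lin0 (@dg_d_lin _ _ Y)) add0r.
rewrite (bd_cunital (tw_mlin h) (tw_cunital hu) a hs) subr0 addrC.
rewrite -[RHS](bm_lact_cunital a hu hs); congr (_ + _).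
by apply: ksgnZ_odd => /=; lia.
Qed.

(** ** Degrees *)

Definition hdeg (n : int) phi : Prop :=
  forall t : seq (int * A), homog t -> gdeg (tdeg t + n - (size t)%:Z) (phi (vals t)).

Lemma homog_cons q (t : seq (int * A)) : homog (q :: t) <-> gdeg q.1 q.2 /\ homog t.
Proof.
split=> [h|[hq ht] r]; last by rewrite inE => /orP [/eqP ->|/ht].
by split=> [|r hr]; apply: h; rewrite inE ?eqxx ?hr ?orbT.
Qed.

Lemma hdeg_cons n phi d a : hdeg n phi -> gdeg d a ->
  hdeg (n + d - 1) (fun s => phi (a :: s)).
Proof.
move=> h ha t ht; have := h ((d, a) :: t); rewrite tdeg_cons /=.
have -> : d + tdeg t + n - (size t).+1%:Z = tdeg t + (n + d - 1) - (size t)%:Z by lia.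
by apply; apply/homog_cons.
Qed.

Lemma hdeg_bd n phi : mlin phi -> hdeg n phi -> hdeg (n + 1) (bd phi).
Proof.
move=> hm hn t; elim: t n phi hm hn => [|[d a] t IH] n phi hm hn; first by move=> _; exact: gdeg0.
move=> /homog_cons /= [ha ht]; apply: gdegD.
  have := hdeg_cons hn (adiff_deg ha) ht.
  by rewrite tdeg_cons /=; congr gdeg; lia.
have := IH _ _ (mlin_cons (gpar a) hm) (hdeg_cons hn (gdeg_gpar ha)) ht.
by rewrite tdeg_cons /=; congr gdeg; lia.
Qed.

Lemma hdeg_bm n phi : hdeg n phi -> hdeg (n + 1) (bm phi).
Proof.
move=> hn t; elim: t n phi hn => [|[d a] t IH] n phi hn; first by move=> _; exact: gdeg0.
move=> /homog_cons /= [ha ht]; rewrite -scaleN1r; apply: gdegD; last first.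
  apply: gdegZ; have := IH _ _ (hdeg_cons hn ha) ht.
  by rewrite tdeg_cons /=; congr gdeg; lia.
case: t {IH} ht => [|[d' b] t] ; first by move=> _; exact: gdeg0.
move=> /homog_cons /= [hb ht].
have := hdeg_cons hn (amul_deg ha hb) ht.
by rewrite !tdeg_cons /=; congr gdeg; lia.
Qed.

Lemma hdeg_lact n phi : hdeg n phi -> hdeg (n + 1) (lact phi).
Proof.
move=> hn t; elim: t n phi hn => [|[d a] t IH] n phi hn; first by move=> _; exact: gdeg0.
move=> /homog_cons [ha ht]; case: t IH ht => [|q t] IH ht.
  have h0 : homog ([::] : seq (int * A)) by [].
  have := dg_act_deg (hn _ h0) ha.
  by rewrite tdeg_cons tdeg_nil /=; congr gdeg; lia.
have := IH _ _ (hdeg_cons hn ha) ht.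
by rewrite [tdeg [:: _, _ & _]]tdeg_cons /=; congr gdeg; lia.
Qed.

Lemma mlin_gpar (V : lmodType k) (phi : seq A -> V) (t : seq (int * A)) :
  mlin phi -> homog t -> phi (map gpar (vals t)) = ksgn (tdeg t) *: phi (vals t).
Proof.
elim: t phi => [|[d a] t IH] phi h; first by rewrite tdeg_nil ksgn0 scale1r.
move=> /homog_cons [ha ht] /=; rewrite (IH (fun s => phi (gpar a :: s))) //; last exact: mlin_cons.
by rewrite (gpar_deg ha) (linZ (mlin_head _ h)) ksgnZ tdeg_cons addrC.
Qed.

Lemma tw_hdeg n phi t : mlin phi -> hdeg n phi -> homog t ->
  tw phi (vals t) = ksgn (n + 1) *: phi (vals t).
Proof.
move=> hm hn ht; rewrite /tw size_vals (mlin_gpar hm ht) (linZ (@gpar_lin _ Y)).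
by rewrite (gpar_deg (hn t ht)) !ksgnZ; apply: ksgnZ_odd; lia.
Qed.

Lemma hdeg_cdiff n phi : mlin phi -> hdeg n phi -> hdeg (n + 1) (cdiff phi).
Proof.
move=> hm hn t ht; rewrite /cdiff -scaleN1r.
apply: gdegD; first apply: gdegD; last 1 first.
- apply: gdegZ; apply: (hdeg_bd (tw_mlin hm)) ht => u hu.
  by rewrite (tw_hdeg hm hn hu); apply/gdegZ/hn.
- apply/gdegZ/gdegD; last exact: hdeg_lact.
  by have := dg_d_deg (hn t ht); congr gdeg; lia.
- exact: hdeg_bm.
Qed.

(** ** The right action *)

Lemma cact_cons phi b a s : cact phi b (a :: s) = phi (amul b a :: s).
Proof. by []. Qed.

Lemma cact_mlin phi b : mlin phi -> mlin (cact phi b).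
Proof.
move=> h [|a' u] v c a1 a2 /=; last exact: (h (_ :: u)).
by rewrite amul_linr (mlin_head _ h).
Qed.

Lemma cact_cunital phi b : cunital phi -> cunital (cact phi b).
Proof. by move=> h a s; apply: h. Qed.

Lemma cact_hdeg n d phi b : gdeg d b -> hdeg n phi -> hdeg (n + d) (cact phi b).
Proof.
move=> hb h [|[q a] t]; first by move=> _; exact: gdeg0.
move=> /homog_cons [/= ha ht]; have := hdeg_cons h (amul_deg hb ha) ht.
by rewrite tdeg_cons /=; congr gdeg; lia.
Qed.

Lemma cdiff_nil phi : phi [::] = 0 -> cdiff phi [::] = 0.
Proof.
by move=> e; rewrite /cdiff /= e (lin0 (@dg_d_lin _ _ Y)) !addr0 scaler0 subr0.
Qed.

Lemma cdiff_cact phi b s : mlin phi -> phi [::] = 0 ->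
  cdiff (cact phi b) s = cact (cdiff phi) b s + cact (tw phi) (adiff b) s.
Proof.
move=> hm h0; case: s => [|a s]; first by rewrite cdiff_nil // addr0.
have EL : lact (cact phi b) (a :: s) = lact phi (amul b a :: s).
  case: s => [|c s]; first by rewrite /= h0 !(lin0 (dg_act_linl _)).
  by rewrite !lact_cons; apply: lact_eq.
have EM : bm (cact phi b) (a :: s) = bm phi (amul b a :: s).
  case: s {EL} => [|c s]; first by rewrite !bm1.
  by rewrite !bm_cons /= amulA.
have EB : bd (tw (cact phi b)) (a :: s) =
    bd (tw phi) (amul b a :: s) - tw phi (amul (adiff b) a :: s).
  have E c u : tw (cact phi b) (c :: u) = tw phi (amul (gpar b) c :: u).
    by rewrite /tw /= gpar_amul gparK.
  rewrite !bd_cons E (bd_eq (psi := fun u => tw phi (gpar (amul b a) :: u))); last first.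
    by move=> u _; rewrite E gpar_amul.
  rewrite adiff_amul (linD (mlin_head _ (tw_mlin hm))).
  zmodule.
rewrite /cdiff EL EM EB !cact_cons /=.
zmodule.
Qed.
End Target.

(** ** Functoriality *)

Lemma fam_gpar (X Y : gmod k) d (f : X -> seq A -> Y) x s : is_family d f ->
  gpar (f x (map gpar s)) = ksgn (d + (size s)%:Z) *: f (gpar x) s.
Proof.
move=> hf; have hm y := fam_mlin y hf.
move: s; apply: mlin_ext.
- by move=> u v c a1 a2; rewrite !map_cat /= gpar_lin hm gpar_lin.
- by move=> u v c a1 a2; rewrite !size_cat /= hm scalerDr !scalerA mulrC.
move=> t ht; move: x; apply: lin_ext.
- exact: lin_comp (@gpar_lin _ Y) (fam_lin hf _).
- exact: lin_scale (lin_comp (fam_lin hf _) (@gpar_lin _ X)).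
move=> p x hx; rewrite (mlin_gpar (hm x) ht) (linZ (@gpar_lin _ Y)).
rewrite (gpar_deg (fam_deg hf hx ht)) (gpar_deg hx) (linZ (fam_lin hf _)) !ksgnZ size_vals.
by apply: ksgnZ_odd; lia.
Qed.

Section Composition.
Variables X Y : dgMod A.
Implicit Type phi : seq A -> X.

(** Composition with a family f of degree e, with the sign that makes it commute
    with the differentials up to (-1)^e. *)
Definition ccomp (e : int) (f : X -> seq A -> Y) phi (s : seq A) : Y :=
  ksgn (e * ((size s)%:Z + 1)) *: \sum_(uv <- splits s) f (phi uv.1) uv.2.

Section Family.
Variables (e : int) (f : X -> seq A -> Y).
Hypothesis hf : is_family e f.

Lemma ccomp_nil phi : phi [::] = 0 -> ccomp e f phi [::] = 0.
Proof. by move=> h; rewrite /ccomp sum_splits_nil /= h (lin0 (fam_lin hf _)) scaler0. Qed.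

Lemma ccomp_cons phi a s : phi [::] = 0 -> ccomp e f phi (a :: s) =
  ksgn (e * (size s)%:Z) *: \sum_(uv <- splits s) f (phi (a :: uv.1)) uv.2.
Proof.
move=> h; rewrite /ccomp sum_splits_cons /= h (lin0 (fam_lin hf _)) add0r.
by apply: ksgnZ_odd; lia.
Qed.

Lemma ccomp_mlin phi : mlin phi -> mlin (ccomp e f phi).
Proof.
move=> h u v c a1 a2; rewrite /ccomp !size_cat /= (scalerA c) [c * _]mulrC -scalerA -scalerDr.
congr (_ *: _); rewrite !sum_splits_cat scalerDr addrACA !scaler_sumr -!big_split.
congr (_ + _); apply: eq_bigr => ab _ /=; first by rewrite (fam_linA hf).
by rewrite h (fam_lin hf).
Qed.

Lemma ccomp_cunital phi : strictly_unital f -> phi [::] = 0 -> cunital phi ->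
  cunital (ccomp e f phi).
Proof.
move=> fu h hu a s hs; rewrite ccomp_cons // big_seq big1 ?scaler0 // => -[u v] /splits_cat /= E.
move: hs; rewrite -E mem_cat => /orP [hs|hs]; last exact: fu.
by rewrite hu // (lin0 (fam_lin hf _)).
Qed.

Lemma ccomp_hdeg n phi : hdeg n phi -> hdeg (n + e) (ccomp e f phi).
Proof.
move=> h t ht; apply: gdegZ; rewrite sum_splits_vals; apply: gdeg_sum => -[u v] /splits_cat /= E.
move: ht; rewrite -E => /homog_cat [hu hv].
have := fam_deg hf (h _ hu) hv; rewrite tdeg_cat size_cat.
by congr gdeg; lia.
Qed.

Lemma tw_ccomp phi s : tw (ccomp e f phi) s = ksgn e *: ccomp e f (tw phi) s.
Proof.
have l := @gpar_lin _ Y.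
rewrite /tw /ccomp size_map (linZ l) (lin_sum _ _ l) splits_map big_map !ksgnZ !scaler_sumr.
rewrite big_seq [RHS]big_seq; apply: eq_bigr => -[u v] /splits_cat /= <-.
rewrite (fam_gpar _ _ hf) (linZ (fam_lin hf _)) !ksgnZ.
by apply: ksgnZ_odd; rewrite size_cat; lia.
Qed.

(** The failure of ccomp e f to be a chain map is ccomp for the boundary of f:
    morphisms induce chain maps, and homotopies induce homotopies. After the
    coderivation property of bd and bm, the identity holds cut by cut. *)
Lemma cdiff_ccomp phi s : mlin phi ->
  cdiff (ccomp e f phi) s = ksgn e *: ccomp e f (cdiff phi) s +
  ksgn ((e + 1) * ((size s)%:Z + 1)) *: \sum_(uv <- splits s) bdry e f (phi uv.1) uv.2.
Proof.
move=> hm; set n : int := (size s)%:Z + 1.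
have fl v := fam_lin hf v.
have ld := @dg_d_lin _ _ Y.
have ED : am Y (ccomp e f phi s) [::] =
    ksgn (e * n) *: \sum_(uv <- splits s) am Y (f (phi uv.1) uv.2) [::].
  by rewrite /ccomp (linZ ld) (lin_sum _ _ ld).
have EL : lact (ccomp e f phi) s =
    ksgn (e * n + e) *: \sum_(uv <- splits s) lact (f (phi uv.1)) uv.2.
  rewrite -(lact_splits (fun u => f (phi u))) -lactZ; apply: lact_eq => u hu.
  by apply: ksgnZ_odd; rewrite /n -hu; lia.
have EM : bm (ccomp e f phi) s = ksgn (e * n + e) *:
    \sum_(uv <- splits s) (f (bm phi uv.1) uv.2 +
      ksgn (size uv.1)%:Z *: bm (f (phi uv.1)) uv.2).
  have -> : bm (ccomp e f phi) s = ksgn (e * n + e) *: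
      bm (fun u => \sum_(uv <- splits u) f (phi uv.1) uv.2) s.
    rewrite -bmZ; apply: bm_eq => u hu.
    by apply: ksgnZ_odd; rewrite /n -hu; lia.
  rewrite (bm_splits (fun u => f (phi u))); congr (_ *: _); apply: eq_bigr => uv _.
  by rewrite (bm_comp _ _ (fl uv.2)).
have EB : bd (tw (ccomp e f phi)) s = ksgn (e * n + e) *:
    \sum_(uv <- splits s) (f (bd (tw phi) uv.1) uv.2 +
      ksgn ((size uv.1)%:Z + 1) *: bd (f (gpar (phi uv.1))) uv.2).
  have -> : bd (tw (ccomp e f phi)) s = ksgn (e * n + e) *:
      bd (fun u => \sum_(uv <- splits u) f (tw phi uv.1) uv.2) s.
    rewrite -bdZ; apply: bd_eq => u hu.
    rewrite tw_ccomp ksgnZ.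
    by apply: ksgnZ_odd; rewrite /n -hu; lia.
  rewrite (bd_splits (fun u => f (tw phi u))); congr (_ *: _); apply: eq_bigr => uv _.
  rewrite (bd_comp _ _ (fl uv.2)) -bdZ; congr (_ + _); apply: bd_eq => w _.
  by rewrite /tw size_map (mapK (@gparK _ A)) (linZ (fl _)).
have EH : \sum_(uv <- splits s) ksgn ((size uv.1)%:Z + 1) *: f (lact phi uv.1) uv.2 =
    \sum_(uv <- splits s) ksgn (size uv.1)%:Z *: hact f (phi uv.1) uv.2.
  have := @hact_splits _ _ X _ (fun x v => ksgn (size v)%:Z *: f x v) phi s.
  have fl' v : linear (fun x => ksgn (size v)%:Z *: f x v) by apply: lin_scale.
  move=> /(_ fl') /(congr1 (fun y => ksgn n *: y)) H.
  apply: (etrans (etrans _ (esym H))); rewrite !scaler_sumr big_seq [RHS]big_seq;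
    apply: eq_bigr => -[u v] /splits_cat /= E.
    by rewrite ksgnZ; apply: ksgnZ_odd; rewrite /n -E size_cat; lia.
  case: v E => [|b v] E; first by rewrite !scaler0.
  by rewrite /= ksgnZ; apply: ksgnZ_odd; rewrite /n -E size_cat /=; lia.
rewrite [LHS]/cdiff -/n ED EL EM EB /ccomp -/n.
have EC : \sum_(uv <- splits s) f (cdiff phi uv.1) uv.2 =
    \sum_(uv <- splits s) (ksgn ((size uv.1)%:Z + 1) *: f (am X (phi uv.1) [::]) uv.2 +
      ksgn (size uv.1)%:Z *: hact f (phi uv.1) uv.2 +
      f (bm phi uv.1) uv.2 - f (bd (tw phi) uv.1) uv.2).
  rewrite sumrB !big_split /= -EH -!big_split -sumrB; apply: eq_bigr => uv _ /=.
  by rewrite /cdiff (linB (fl _)) (linD (fl _)) (linZ (fl _)) (linD (fl _)) scalerDr.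
rewrite EC scalerDr !ksgnZ !scaler_sumr -!big_split -sumrB /=.
rewrite big_seq [RHS]big_seq; apply: eq_bigr => -[u v] /splits_cat /= E.
have En : n = (size u)%:Z + (size v)%:Z + 1 by rewrite /n -E size_cat PoszD.
move: En; rewrite /bdry; move: (size u)%:Z (size v)%:Z => su sv En.
rewrite !(scalerDr, scalerN, opprD, opprB) !ksgnZ.
have -> : (e + 1) * n = n + e * n by rewrite mulrDl mul1r addrC.
move: (e * n) En => m En.
have E1 : ksgn (m + e + (su + 1)) = ksgn (n + m + (e + sv)) :> k by apply: ksgn_odd; lia.
have E2 : ksgn (e + m + (su + 1)) = ksgn (n + m + (e + sv)) :> k by apply: ksgn_odd; lia.
have E3 : ksgn (m + e + su) = - ksgn (n + m + (e + sv)) :> k.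
  by rewrite -mulrN1 -(ksgn1 k) -ksgnD; apply: ksgn_odd; lia.
rewrite [n + (m + e)]addrA E1 E2 [e + m]addrC E3 !scaleNr.
zmodule.
Qed.
End Family.
End Composition.
End CoinducedOperators.

(** * The coinduced dg module *)

Section CoinducedModule.
Variables (k : comPzRingType) (A : dgAlg k) (Y : dgMod A).
Implicit Types phi psi : seq A -> Y.

(** Functions on nonempty lists are extended by 0 to the empty list, which spares
    a separate case for the cut before the first argument. The first argument
    may be 1: strict unitality only concerns the others. The degree of the value
    is counted with the arity size s, one less than the length of a :: s. *)
Record chom (n : int) phi : Prop := CHom {
  chom_nil : phi [::] = 0;
  chom_mlin : mlin phi;
  chom_unital : cunital phi;
  chom_deg : hdeg (n + 1) phi }.

Lemma chom0 n : chom n (fun=> 0).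
Proof.
by split=> // [u v c x y|t _]; [rewrite scaler0 addr0 | apply: gdeg0].
Qed.

Lemma chom_lin n c phi psi : chom n phi -> chom n psi ->
  chom n (fun s => c *: phi s + psi s).
Proof.
move=> [h1 h2 h3 h4] [g1 g2 g3 g4]; split.
- by rewrite h1 g1 scaler0 addr0.
- by move=> u v; apply: lin_add (lin_scale c (h2 u v)) (g2 u v).
- by move=> a s hs; rewrite h3 // g3 // scaler0 addr0.
- by move=> t ht; apply: gdegL; [apply: h4 | apply: g4].
Qed.

(** A graded module is the direct sum of its components, so only finite sums of
    homogeneous functions are elements of the coinduced module. *)
Inductive cvalid : (seq A -> Y) -> Prop :=
| cvalid_hom n phi : chom n phi -> cvalid phi
| cvalid_add phi psi : cvalid phi -> cvalid psi -> cvalid (fun s => phi s + psi s).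

Lemma cvalid0 : cvalid (fun=> 0).
Proof. exact: cvalid_hom (chom0 0). Qed.

Lemma cvalidZ c phi : cvalid phi -> cvalid (fun s => c *: phi s).
Proof.
elim=> {phi} [n phi h|phi psi _ h _ g].
  apply: (@cvalid_hom n); rewrite (_ : (fun s => _) = fun s => c *: phi s + 0).
    by apply: chom_lin h (chom0 n).
  by apply/boolp.funext => s; rewrite addr0.
rewrite (_ : (fun s => _) = fun s => c *: phi s + c *: psi s).
  exact: cvalid_add.
by apply/boolp.funext => s; rewrite scalerDr.
Qed.

Lemma cvalidN phi : cvalid phi -> cvalid (fun s => - phi s).
Proof.
move=> h; rewrite (_ : (fun s => _) = fun s => -1 *: phi s); first exact: cvalidZ.
by apply/boolp.funext => s; rewrite scaleN1r.
Qed.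

Lemma cvalid_nil phi : cvalid phi -> phi [::] = 0.
Proof. by elim=> {phi} [n phi []|phi psi _ -> _ ->] //; rewrite addr0. Qed.

Lemma cvalid_mlin phi : cvalid phi -> mlin phi.
Proof. by elim=> {phi} [n phi []|phi psi _ h _ g] // u v; apply: lin_add. Qed.

Lemma cvalid_unital phi : cvalid phi -> cunital phi.
Proof.
elim=> {phi} [n phi []|phi psi _ h _ g] // a s hs.
by rewrite h // g // addr0.
Qed.

Record coind := Coind { cfun :> seq A -> Y; cfunP : cvalid cfun }.

Lemma coind_eq (x y : coind) : cfun x =1 cfun y -> x = y.
Proof.
case: x y => [f hf] [g hg] /= /boolp.funext e; case: _ / e hg => hg.
by congr Coind; apply: boolp.Prop_irrelevance.
Qed.

HB.instance Definition _ := boolp.gen_eqMixin coind.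
HB.instance Definition _ := boolp.gen_choiceMixin coind.

Definition coind0 := Coind cvalid0.
Definition coindD x y := Coind (cvalid_add (cfunP x) (cfunP y)).
Definition coindN x := Coind (cvalidN (cfunP x)).
Definition coindZ c x := Coind (cvalidZ c (cfunP x)).

Lemma coindDA : associative coindD.
Proof. by move=> x y z; apply: coind_eq => s; apply: addrA. Qed.
Lemma coindDC : commutative coindD.
Proof. by move=> x y; apply: coind_eq => s; apply: addrC. Qed.
Lemma coind0D : left_id coind0 coindD.
Proof. by move=> x; apply: coind_eq => s; apply: add0r. Qed.
Lemma coindND : left_inverse coind0 coindN coindD.
Proof. by move=> x; apply: coind_eq => s; apply: addNr. Qed.

HB.instance Definition _ := GRing.isZmodule.Build coind coindDA coindDC coind0D coindND.

Lemma coindZA a b x : coindZ a (coindZ b x) = coindZ (a * b) x.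
Proof. by apply: coind_eq => s; apply: scalerA. Qed.
Lemma coind1Z : left_id 1 coindZ.
Proof. by move=> x; apply: coind_eq => s; apply: scale1r. Qed.
Lemma coindZDr : right_distributive coindZ +%R.
Proof. by move=> a x y; apply: coind_eq => s; apply: scalerDr. Qed.
Lemma coindZDl x : {morph coindZ^~ x : a b / a + b}.
Proof. by move=> a b; apply: coind_eq => s; apply: scalerDl. Qed.

HB.instance Definition _ := GRing.Zmodule_isLmodule.Build k coind
  coindZA coind1Z coindZDr coindZDl.

Lemma cfun_sum (I : Type) (r : seq I) (F : I -> coind) s :
  cfun (\sum_(i <- r) F i) s = \sum_(i <- r) cfun (F i) s.
Proof. by elim: r => [|i r IH]; rewrite ?big_nil // !big_cons -IH. Qed.

Definition coind_deg (n : int) (x : coind) := chom n x.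

Lemma coind_span (x : coind) : exists t : seq (int * coind),
  {in t, forall q, coind_deg q.1 q.2} /\ x = \sum_(q <- t) q.2.
Proof.
case: x => phi h; suff [t [ht e]] : exists t : seq (int * coind),
    {in t, forall q, coind_deg q.1 q.2} /\ forall s, phi s = \sum_(q <- t) cfun q.2 s.
  exists t; split=> //; apply: coind_eq => s /=.
  by rewrite e cfun_sum.
elim: h => {phi} [n phi h|phi psi _ [t [ht et]] _ [u [hu eu]]].
  exists [:: (n, Coind (cvalid_hom h))]; split=> [q|s]; last by rewrite big_seq1.
  by rewrite inE => /eqP ->.
exists (t ++ u); split=> [q|s]; last by rewrite big_cat et eu.
by rewrite mem_cat => /orP [/ht|/hu].
Qed.

(** Homogeneous functions are compared on homogeneous arguments, where their
    values of different degrees are independent. *)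
Lemma coind_indep (s : seq int) (c : int -> coind) : uniq s ->
  (forall n, coind_deg n (c n)) -> \sum_(n <- s) c n = 0 ->
  forall n, n \in s -> c n = 0.
Proof.
move=> us hc e n hn; apply: coind_eq.
apply: mlin_ext => [||t ht]; first exact: chom_mlin (hc n).
  exact: chom_mlin (chom0 n).
have inj : injective (fun m : int => tdeg t + (m + 1) - (size t)%:Z).
  by move=> a b; lia.
pose g m := m - 1 + (size t)%:Z - tdeg t.
have gK m : g (tdeg t + (m + 1) - (size t)%:Z) = m by rewrite /g; lia.
have Kg m : tdeg t + (g m + 1) - (size t)%:Z = m by rewrite /g; lia.
have := @gdeg_indep k Y [seq tdeg t + (m + 1) - (size t)%:Z | m <- s]
  (fun m => cfun (c (g m)) (vals t)).
rewrite map_inj_uniq // big_map => /(_ us).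
have hd m : gdeg m (cfun (c (g m)) (vals t)) 
  by have := chom_deg (hc (g m)) ht; rewrite Kg.
move=> /(_ hd); under eq_bigr => m _ do rewrite gK.
rewrite -cfun_sum e => /(_ erefl _ (map_f _ hn)).
by rewrite gK.
Qed.

Definition coind_gmod : gmod k :=
  @GMod k coind coind_deg chom0 (fun n c x y => @chom_lin n c x y) coind_span coind_indep.

Lemma gpar_coind (x : coind_gmod) s : cfun (gpar x) s = tw x s.
Proof.
move: x s; apply: gdeg_ind => [s|x y hx hy s|n x hx s].
- by rewrite (lin0 (@gpar_lin _ _)) /tw /= (lin0 (@gpar_lin _ Y)) scaler0.
- rewrite (linD (@gpar_lin _ _)) -[LHS]/(cfun (gpar x) s + cfun (gpar y) s) hx hy.
  by rewrite /tw /= (linD (@gpar_lin _ Y)) scalerDr.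
rewrite (gpar_deg hx) -[LHS]/(ksgn n *: cfun x s).
have hm := chom_mlin hx; move: s; apply: mlin_ext; [|exact: tw_mlin|].
  by move=> u v; apply: lin_scale.
move=> t ht; rewrite (tw_hdeg hm (chom_deg hx) ht).
by apply: ksgnZ_odd; lia.
Qed.

Lemma chom_cdiff n phi : chom n phi -> chom (n + 1) (cdiff phi).
Proof.
move=> [h1 h2 h3 h4]; split; [exact: cdiff_nil | exact: cdiff_mlin | exact: cdiff_cunital |].
exact: hdeg_cdiff.
Qed.

Lemma chom_cact n d phi a : gdeg d a -> chom n phi -> chom (n + d) (cact phi a).
Proof.
move=> ha [h1 h2 h3 h4]; split; [by [] | exact: cact_mlin | exact: cact_cunital |].
by have := cact_hdeg ha h4; congr hdeg; lia.
Qed.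

Lemma cdiff_lin c phi psi s :
  cdiff (fun u => c *: phi u + psi u) s = c *: cdiff phi s + cdiff psi s.
Proof.
rewrite /cdiff lact_lin bm_lin.
rewrite (bd_eq (psi := fun u => c *: tw phi u + tw psi u)); last first.
  by move=> u _; rewrite /tw gpar_lin scalerDr !scalerA mulrC.
rewrite bd_lin (dg_d_lin (Y := Y)) !(scalerDr, scalerN) !(scalerA c) ![c * _]mulrC -!scalerA.
zmodule.
Qed.

Lemma cact_lin c phi psi a s :
  cact (fun u => c *: phi u + psi u) a s = c *: cact phi a s + cact psi a s.
Proof. by case: s => [|b s] //=; rewrite scaler0 addr0. Qed.

Lemma cact_linr phi s : mlin phi -> linear (fun a => cact phi a s).
Proof.
move=> h c a b; case: s => [|d s] /=; first by rewrite scaler0 addr0.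
by rewrite amul_linl (mlin_head _ h).
Qed.
End CoinducedModule.

Section LinearOperators.
Variables (k : comPzRingType) (A : dgAlg k).

(** An operator on functions that is linear and preserves homogeneity, up to a
    shift of the degree, descends to the coinduced modules. *)
Definition op_linear (X Y : dgMod A) (op : (seq A -> X) -> seq A -> Y) : Prop :=
  forall c phi psi s,
    op (fun u => c *: phi u + psi u) s = c *: op phi s + op psi s.

Lemma cvalid_op (X Y : dgMod A) (op : (seq A -> X) -> seq A -> Y) phi :
  op_linear op -> (forall n psi, chom n psi -> cvalid (op psi)) ->
  cvalid phi -> cvalid (op phi).
Proof.
move=> opl oph; elim=> {phi} [n phi|phi psi _ h _ g]; first exact: oph.
rewrite (_ : op _ = fun s => op phi s + op psi s); first exact: cvalid_add.
apply/boolp.funext => s; rewrite -[op phi s]scale1r -opl; congr (op _ _).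
by apply/boolp.funext => u; rewrite scale1r.
Qed.

Section Lift.
Variables (X Y : dgMod A) (op : (seq A -> X) -> seq A -> Y).
Hypothesis opl : op_linear op.
Hypothesis oph : forall n psi, chom n psi -> cvalid (op psi).

Definition lift_op (x : coind X) : coind Y := Coind (cvalid_op opl oph (cfunP x)).

Lemma lift_op_lin : linear lift_op.
Proof. by move=> c x y; apply: coind_eq => s; apply: opl. Qed.
End Lift.

Variable Y : dgMod A.

Lemma cvalid_cdiff_hom n (phi : seq A -> Y) : chom n phi -> cvalid (cdiff phi).
Proof. by move/chom_cdiff; apply: cvalid_hom. Qed.

Definition coind_d : coind_gmod Y -> coind_gmod Y :=
  lift_op (@cdiff_lin k A Y) cvalid_cdiff_hom.

Lemma cvalid_cact a n (phi : seq A -> Y) : chom n phi -> cvalid (cact phi a).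
Proof.
move=> h; have hm := chom_mlin h; move: a; apply: gdeg_ind.
- rewrite (_ : cact phi 0 = fun=> 0); first exact: cvalid0.
  by apply/boolp.funext => s; apply: (lin0 (cact_linr s hm)).
- move=> a b ha hb; rewrite (_ : cact phi _ = fun s => cact phi a s + cact phi b s).
    exact: cvalid_add.
  by apply/boolp.funext => s; apply: (linD (cact_linr s hm)).
- by move=> d a ha; apply: cvalid_hom (chom_cact ha h).
Qed.

Definition coind_act (x : coind_gmod Y) (a : A) : coind_gmod Y :=
  lift_op (fun c phi psi s => cact_lin c phi psi a s) (@cvalid_cact a) x.

Lemma coind_dd x : coind_d (coind_d x) = 0.
Proof. by apply: coind_eq => s; apply/cdiffK/cvalid_mlin/cfunP. Qed.

Lemma coind_act_linr x : linear (coind_act x).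
Proof.
by move=> c a b; apply: coind_eq => s; apply/cact_linr/cvalid_mlin/cfunP.
Qed.

Lemma coind_actA x a b : coind_act (coind_act x a) b = coind_act x (amul a b).
Proof. by apply: coind_eq => -[|c s] //=; rewrite amulA. Qed.

Lemma coind_act1 x : coind_act x aone = x.
Proof.
apply: coind_eq => -[|c s] /=; first by rewrite (cvalid_nil (cfunP x)).
by rewrite amul1l.
Qed.

Lemma coind_d_act x a :
  coind_d (coind_act x a) = coind_act (coind_d x) a + coind_act (gpar x) (adiff a).
Proof.
apply: coind_eq => s.
rewrite [LHS](cdiff_cact _ _ (cvalid_mlin (cfunP x)) (cvalid_nil (cfunP x))).
rewrite -[RHS]/(cact (cdiff x) a s + cact (gpar x) (adiff a) s); congr (_ + _).
by case: s => [|b s] //=; rewrite gpar_coind.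
Qed.

Definition coinduced : dgMod A :=
  @mkdg k A (coind_gmod Y) coind_d coind_act
    (lift_op_lin _ _) (fun p x h => chom_cdiff h) coind_dd
    (fun a => lift_op_lin _ _) coind_act_linr (fun p q x a hx ha => chom_cact ha hx)
    coind_actA coind_act1 coind_d_act.
End LinearOperators.

(** Y embeds into the coinduced module by y |-> (a |-> y a), as the families that
    vanish in higher arities. *)
Section Unit.
Variables (k : comPzRingType) (A : dgAlg k) (Y : dgMod A).

Definition unit_fun (y : Y) (s : seq A) : Y := if s is [:: a] then am Y y [:: a] else 0.

Lemma unit_fun_chom n y : gdeg n y -> chom n (unit_fun y).
Proof.
move=> hy; split=> //.
- move=> [|b [|b' u]] [|b'' v] c a1 a2 /=; rewrite ?scaler0 ?addr0 //.
  exact: dg_act_linr.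
- by move=> a [|b s].
- move=> [|[d a] [|q t]]; [by move=> _; exact: gdeg0 | | by move=> _; exact: gdeg0].
  move=> /homog_cons [/= ha _]; have := dg_act_deg hy ha.
  by rewrite tdeg_cons tdeg_nil /=; congr gdeg; lia.
Qed.

Lemma unit_fun_lin s : linear (unit_fun^~ s).
Proof.
case: s => [|a [|b s]] c x y /=; rewrite ?scaler0 ?addr0 //.
exact: dg_act_linl.
Qed.

Lemma unit_fun_valid y : cvalid (unit_fun y).
Proof.
move: y; apply: gdeg_ind => [|x y hx hy|n y /unit_fun_chom]; last exact: cvalid_hom.
- rewrite (_ : unit_fun 0 = fun=> 0); first exact: cvalid0.
  by apply/boolp.funext => s; rewrite (lin0 (unit_fun_lin s)).
- rewrite (_ : unit_fun _ = fun s => unit_fun x s + unit_fun y s).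
    exact: cvalid_add.
  by apply/boolp.funext => s; rewrite (linD (unit_fun_lin s)).
Qed.

Definition unit_map (y : Y) : coinduced Y := Coind (unit_fun_valid y).

Lemma unit_map_lin : linear unit_map.
Proof. by move=> c x y; apply: coind_eq => s; apply: unit_fun_lin. Qed.

Lemma tw_unit_fun y s : tw (unit_fun y) s = unit_fun (gpar y) s.
Proof.
rewrite /tw; case: s => [|a [|b s]] /=; rewrite ?(lin0 (@gpar_lin _ Y)) ?scaler0 //.
by rewrite dg_gpar_act gparK ksgnZ_even.
Qed.

Lemma unit_fun_d y s : unit_fun (am Y y [::]) s = cdiff (unit_fun y) s.
Proof.
rewrite /cdiff (bd_eq (psi := unit_fun (gpar y))); last by move=> u _; apply: tw_unit_fun.
have h0 := lin0 (@dg_d_lin _ _ Y).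
have ha a := lin0 (@dg_act_linl _ _ Y a).
case: s => [|a [|b [|c s]]].
- by rewrite /= h0 !addr0 scaler0 subr0.
- rewrite /= ha ksgnZ_even // dg_d_act !addr0 subr0.
  by zmodule.
- rewrite /= h0 ksgn_oddN // scaleN1r dg_actA; zmodule.
- rewrite (lact_eq (psi := fun=> 0)) ?lact0; last by move=> [|? [|? u]].
  rewrite (bm_eq (psi := fun=> 0)) ?bm0; last by move=> [|? [|? u]].
  rewrite (bd_eq (psi := fun=> 0)) ?bd0; last by move=> [|? [|? u]].
  by rewrite /= h0 !addr0 scaler0 subr0.
Qed.

Lemma unit_map_am y s : unit_map (am Y y s) = am (coinduced Y) (unit_map y) s.
Proof.
apply: coind_eq => u; case: s => [|a [|b s]]; first exact: unit_fun_d.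
- by case: u => [|c [|c' u]] //=; apply: dg_actA.
- by rewrite dg_high //= (lin0 (unit_fun_lin u)).
Qed.

Definition cunit : strictHom Y (coinduced Y) :=
  @StrictHom k A Y (coinduced Y) unit_map unit_map_lin
    (fun p y h => unit_fun_chom h) unit_map_am.

(** Evaluation at 1 in the first argument, the other arguments becoming those of an
    A_oo-morphism; it is a retraction of the unit, though not a strict one. *)
Definition cev (x : coinduced Y) (s : seq A) : Y := cfun x (aone :: s).

Lemma cev_family : is_family 0 cev.
Proof.
split=> [s c x y|x u v|p x t hx ht] //.
  exact: cvalid_mlin (cfunP x) (aone :: u) v.
have := chom_deg hx (t := (0, aone) :: t).
rewrite tdeg_cons /=; have -> : (0 + tdeg t + (p + 1) - (size t).+1%:Z = p + tdeg t + 0 - (size t)%:Z) by lia.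
by apply; apply/homog_cons; split=> //; apply: aone_deg.
Qed.

Lemma cev_su : strictly_unital cev.
Proof. by move=> x s hs; apply: cvalid_unital (cfunP x) _ _ hs. Qed.

Lemma cev_bdry x s : bdry 0 cev x s = 0.
Proof.
have hm := cvalid_mlin (cfunP x).
rewrite /bdry ksgn0 scale1r add0r.
have -> : cev (am (coinduced Y) x [::]) s = cdiff x (aone :: s) by [].
have EL : lact x (aone :: s) = lact (cev x) s.
  case: s => [|b s] //.
  by rewrite /= (cvalid_nil (cfunP x)) (lin0 (dg_act_linl _)).
have EM : bm x (aone :: s) = hact cev x s - bm (cev x) s.
  by case: s {EL} => [|b s] //=; rewrite amul1l amul1r.
have EB : bd (tw x) (aone :: s) = bd (cev (gpar x)) s.
  rewrite bd_cons adiff1 (lin0 (mlin_head _ (tw_mlin hm))) add0r gpar1.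
  by apply: bd_eq => u _; rewrite /cev gpar_coind.
rewrite /cdiff EL EM EB.
have -> : (size (aone :: s))%:Z + 1 = (size s)%:Z + 2 by rewrite /=; lia.
rewrite ksgnD (_ : ksgn 2 = 1) ?mulr1; last exact: ksgn_even.
set e := ksgn _; set u := _ + lact _ _.
rewrite (_ : _ + bm _ _ = e *: u); last by rewrite /u; zmodule.
by rewrite scalerA ksgnK scale1r subrr.
Qed.

Definition coev : ainfHom (coinduced Y) Y :=
  @AinfHom k A (coinduced Y) Y cev cev_family
    (fun p x t hx ht => bdry_ainf cev_family hx ht (cev_bdry x (vals t))) cev_su.

Lemma coev_cunit : homotopic (ainf_comp coev (ainf_of_strict cunit)) (ainf_id Y).
Proof.
apply: homotopic_eq => p y t hy ht /=.
rewrite (comp_strictr _ _ _ cev_family (@strictfam_nil _ _ _ _ cunit)) mul0r ksgn0 scale1r.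
case: t ht => [|q [|q' t]] ht //=.
exact: am_one.
Qed.
End Unit.

(** * Functoriality of the coinduced module *)

Section CoinducedFunctor.
Variables (k : comPzRingType) (A : dgAlg k).

Section Lifted.
Variables (X Y : dgMod A) (e : int) (f : X -> seq A -> Y).
Hypotheses (hf : is_family e f) (fu : strictly_unital f).

Lemma ccomp_lin : op_linear (ccomp e f).
Proof.
move=> c phi psi s; rewrite /ccomp (scalerA c) [c * _]mulrC -scalerA -scalerDr.
congr (_ *: _); rewrite scaler_sumr -big_split; apply: eq_bigr => uv _ /=.
exact: fam_lin hf _ _ _ _.
Qed.

Lemma chom_ccomp n phi : chom n phi -> chom (n + e) (ccomp e f phi).
Proof.
move=> [h1 h2 h3 h4]; split.
- exact: ccomp_nil.
- exact: ccomp_mlin.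
- exact: ccomp_cunital.
- by have := ccomp_hdeg hf h4; congr hdeg; lia.
Qed.

Lemma ccomp_valid n phi : chom n phi -> cvalid (ccomp e f phi).
Proof. by move/chom_ccomp; apply: cvalid_hom. Qed.

Definition lift_comp : coinduced X -> coinduced Y := lift_op ccomp_lin ccomp_valid.

Lemma lift_comp_lin : linear lift_comp.
Proof. exact: lift_op_lin. Qed.

Lemma lift_comp_act x s : (0 < size s)%N ->
  lift_comp (am (coinduced X) x s) = am (coinduced Y) (lift_comp x) s.
Proof.
case: s => [|a [|b s]] // _; last by rewrite (lin0 lift_comp_lin).
have x0 := cvalid_nil (cfunP x).
apply: coind_eq => -[|b s]; first by rewrite /= ccomp_nil.
by rewrite /= !(ccomp_cons hf).
Qed.

Lemma lift_comp_d n (x : coinduced X) t : gdeg n x -> homog t ->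
  cfun (am (coinduced Y) (lift_comp x) [::]) (vals t) =
  ksgn e *: cfun (lift_comp (am (coinduced X) x [::])) (vals t) +
  ksgn ((e + 1) * ((size t)%:Z + 1)) *:
    \sum_(uv <- splits t) bdry e f (cfun x (vals uv.1)) (vals uv.2).
Proof.
move=> hx ht; rewrite [LHS](cdiff_ccomp hf _ (cvalid_mlin (cfunP x))).
by rewrite size_vals sum_splits_vals.
Qed.
End Lifted.

Lemma coind_lin_ext (X Y : dgMod A) (F G : coinduced X -> coinduced Y) :
  linear F -> linear G ->
  (forall n (x : coinduced X) t, gdeg n x -> homog t ->
     cfun (F x) (vals t) = cfun (G x) (vals t)) -> F =1 G.
Proof.
move=> hF hG h; apply: lin_ext => // n x hx; apply: coind_eq.
apply: mlin_ext; [exact: cvalid_mlin (cfunP _) | exact: cvalid_mlin (cfunP _) |].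
by move=> t; apply: h hx.
Qed.

Lemma coind_value_deg (X : dgMod A) n (x : coinduced X) t : gdeg n x -> homog t ->
  gdeg (tdeg t + (n + 1) - (size t)%:Z) (cfun x (vals t)).
Proof. by move=> hx ht; apply: chom_deg hx _ ht. Qed.

Section OnMorphisms.
Variables (X Y : dgMod A) (f : ainfHom X Y).

Lemma coind_map_am x s :
  lift_comp (ah_fam f) (@ah_su _ _ _ _ f) (am (coinduced X) x s) =
  am (coinduced Y) (lift_comp (ah_fam f) (@ah_su _ _ _ _ f) x) s.
Proof.
have ll := lift_comp_lin (ah_fam f) (@ah_su _ _ _ _ f).
case: s => [|a s]; last exact: lift_comp_act.
move: x; apply: coind_lin_ext.
- exact: lin_comp ll (@dg_d_lin _ _ (coinduced X)).
- exact: lin_comp (@dg_d_lin _ _ (coinduced Y)) ll.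
move=> n x t hx ht.
rewrite (lift_comp_d _ _ hx ht) ksgn0 scale1r big_seq big1 ?scaler0 ?addr0 // => -[u v] /splits_cat /= E.
move: ht; rewrite -E => /homog_cat [hu hv].
exact: ainf_bdry (coind_value_deg hx hu) hv.
Qed.

Lemma coind_map_deg p x : @gdeg k (coinduced X) p x ->
  @gdeg k (coinduced Y) p (lift_comp (ah_fam f) (@ah_su _ _ _ _ f) x).
Proof. by move=> hx; have := chom_ccomp (ah_fam f) (@ah_su _ _ _ _ f) hx; rewrite addr0. Qed.

Definition coind_map : strictHom (coinduced X) (coinduced Y) :=
  @StrictHom k A (coinduced X) (coinduced Y) _
    (lift_comp_lin (ah_fam f) (@ah_su _ _ _ _ f)) coind_map_deg coind_map_am.

Lemma coind_mapE x s :
  cfun (coind_map x) s = \sum_(uv <- splits s) f (cfun x uv.1) uv.2.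
Proof. by rewrite -[LHS]/(ccomp 0 f x s) /ccomp mul0r ksgn0 scale1r. Qed.

(** The cuts of 1 :: s after the first place are the cuts of s. This replaces f by
    the strict morphism between coinduced modules without choosing a homotopy. *)
Lemma coev_natural :
  homotopic (ainf_comp f (coev X)) (ainf_comp (coev Y) (ainf_of_strict coind_map)).
Proof.
apply: homotopic_eq => p x t hx ht /=.
rewrite (comp_strictr _ _ _ (cev_family Y) (@strictfam_nil _ _ _ _ coind_map)).
rewrite mul0r ksgn0 scale1r /cev coind_mapE sum_splits_cons /=.
rewrite (cvalid_nil (cfunP x)) (lin0 (fam_lin (ah_fam f) _)) add0r.
by apply: eq_bigr => uv _; rewrite mul0r ksgn0 scale1r.
Qed.
End OnMorphisms.

Lemma coind_map_comp (X Y Z : dgMod A) (f : ainfHom Y Z) (g : ainfHom X Y) :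
  coind_map (ainf_comp f g) =1 fun x => coind_map f (coind_map g x).
Proof.
move=> x; apply: coind_eq => s; rewrite !coind_mapE.
under [RHS]eq_bigr => uv _ do rewrite coind_mapE (lin_sum _ _ (fam_lin (ah_fam f) _)).
rewrite (sum_splits_coassoc s (fun u v w => f (g (cfun x u) v) w)).
apply: eq_bigr => uv _ /=; rewrite /famcomp; apply: eq_bigr => ab _.
by rewrite mul0r ksgn0 scale1r.
Qed.

Lemma cunit_natural (X Y : dgMod A) (f : strictHom X Y) x :
  coind_map (ainf_of_strict f) (cunit X x) = cunit Y (f x).
Proof.
apply: coind_eq => s; rewrite coind_mapE.
rewrite (sum_splits_last s (F := fun u v => strictfam f (unit_fun x u) v)); last first.
  by move=> u v; apply: strictfam_nil.
by case: s => [|a [|b s]] /=; rewrite ?(lin0 (sh_lin f)) ?sh_am.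
Qed.

(** Homotopy in the category of dg modules, where the homotopy has to be A-linear. *)
Definition strict_homotopic (X Y : dgMod A) (f g : strictHom X Y) : Prop :=
  exists h : X -> Y, [/\ linear h,
    forall n x, gdeg n x -> gdeg (n - 1) (h x),
    forall x a, h (am X x [:: a]) = am Y (h x) [:: a] &
    forall x, f x - g x = am Y (h x) [::] + h (am X x [::])].

(** A homotopy of A_oo-morphisms becomes A-linear, since the action only involves
    the first argument, which composition leaves alone. *)
Lemma coind_map_homotopic (X Y : dgMod A) (f g : ainfHom X Y) :
  homotopic f g -> strict_homotopic (coind_map f) (coind_map g).
Proof.
move=> /homotopic_bdry [h [hh hu e]].
have ll := lift_comp_lin hh hu.
exists (lift_comp hh hu); split=> //.
- by move=> n x hx; apply: chom_ccomp.
- by move=> x a; apply: lift_comp_act.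
have dl := @dg_d_lin k A.
apply: coind_lin_ext.
- exact: lin_add (sh_lin (coind_map f)) (lin_opp (sh_lin (coind_map g))).
- apply: lin_add; first exact: lin_comp (dl (coinduced Y)) ll.
  exact: lin_comp ll (dl (coinduced X)).
move=> n x t hx ht.
rewrite -[RHS]/(cfun (am (coinduced Y) _ [::]) (vals t) + cfun (lift_comp _ _ _) (vals t)).
rewrite (lift_comp_d hh hu hx ht) ksgn_oddN // scaleN1r addrAC addNr add0r.
rewrite ksgnZ_even; last by lia.
rewrite -[LHS]/(cfun (coind_map f x) (vals t) - cfun (coind_map g x) (vals t)).
rewrite !coind_mapE !sum_splits_vals -sumrB big_seq [RHS]big_seq.
apply: eq_bigr => -[u v] /splits_cat /= E.
move: ht; rewrite -E => /homog_cat [hu' hv].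
rewrite (e _ _ _ (coind_value_deg hx hu') hv) /bdry.
by rewrite !(ksgnD _ (-1)) !(ksgnD _ 1) !ksgn1 [ksgn (-1)]ksgn_oddN.
Qed.

(** The unit has the k-linear retraction x |-> x [:: 1], and inserting 1 in the
    first place contracts the complement, as in the bar resolution. *)
Section UnitContraction.
Variable Y : dgMod A.

Definition ins1 (phi : seq A -> Y) (s : seq A) : Y :=
  if s is [::] then 0 else phi (aone :: s).

Lemma ins1_lin : op_linear ins1.
Proof. by move=> c phi psi [|a s] //=; rewrite scaler0 addr0. Qed.

Lemma chom_ins1 n phi : chom n phi -> chom (n - 1) (ins1 phi).
Proof.
move=> [h1 h2 h3 h4]; split=> //.
- by move=> [|b u] v; [apply: (h2 [:: aone]) | apply: (h2 [:: aone, b & u])].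
- by move=> a s hs; apply: h3; rewrite inE hs orbT.
- move=> [|q t] ht; first exact: gdeg0.
  have := h4 ((0, aone) :: q :: t).
  rewrite (tdeg_cons (0, aone)) /= => H.
  have -> : tdeg (q :: t) + (n - 1 + 1) - (size t).+1%:Z =
    0 + tdeg (q :: t) + (n + 1) - (size t).+2%:Z by lia.
  by apply: H; apply/homog_cons; split=> //; apply: aone_deg.
Qed.

Lemma ins1_valid n phi : chom n phi -> cvalid (ins1 phi).
Proof. by move/chom_ins1; apply: cvalid_hom. Qed.

Definition cins1 : coinduced Y -> coinduced Y := lift_op ins1_lin ins1_valid.

Lemma cins1_lin : linear cins1.
Proof. exact: lift_op_lin. Qed.

Definition ev1 (x : coinduced Y) : Y := cfun x [:: aone].

Lemma ev1_lin : linear ev1. Proof. by []. Qed.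

Lemma ev1_d x : ev1 (am (coinduced Y) x [::]) = am Y (ev1 x) [::].
Proof.
rewrite -[LHS]/(cdiff x [:: aone]) /cdiff bm1 bd_cons adiff1.
rewrite (lin0 (mlin_head _ (tw_mlin (cvalid_mlin (cfunP x))))) /=.
rewrite (cvalid_nil (cfunP x)) (lin0 (dg_act_linl _)) !addr0 subr0.
by rewrite ksgnZ_even.
Qed.

Lemma cins1_homotopy x :
  am (coinduced Y) (cins1 x) [::] + cins1 (am (coinduced Y) x [::]) =
  x - cunit Y (ev1 x).
Proof.
have hm := cvalid_mlin (cfunP x); have h0 := cvalid_nil (cfunP x).
apply: coind_eq => s.
rewrite -[LHS]/(cdiff (ins1 x) s + ins1 (cdiff x) s).
rewrite -[RHS]/(cfun x s - unit_fun (ev1 x) s).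
case: s => [|a s]; first by rewrite cdiff_nil //= h0 addr0 subr0.
have EB : bd (tw (ins1 x)) (a :: s) = - bd (tw x) [:: aone, a & s].
  rewrite (bd_cons (tw x)) adiff1 (lin0 (mlin_head _ (tw_mlin hm))) add0r gpar1 -bdN.
  apply: bd_eq => -[|b u] // _; rewrite /tw /= gpar1 ksgnN.
  by apply: ksgnZ_odd; lia.
have EM : bm x [:: aone, a & s] = cfun x (a :: s) - bm (ins1 x) (a :: s).
  by rewrite bm_cons amul1l; congr (_ - _); apply: bm_eq => -[|b u].
have EL : lact x [:: aone, a & s] = lact (ins1 x) (a :: s) +
    unit_fun (ev1 x) (a :: s).
  rewrite lact_cons; case: s {EB EM} => [|b s].
    by rewrite /= (lin0 (dg_act_linl _)) add0r.
  by rewrite addr0; apply: lact_eq => -[|c u].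
rewrite /ins1 /cdiff EB EM EL -/(ins1 _).
have EU : ksgn ((size (a :: s))%:Z + 1) *: unit_fun (ev1 x) (a :: s) =
    unit_fun (ev1 x) (a :: s).
  by case: s {EB EM EL} => [|b s]; [rewrite ksgnZ_even | rewrite scaler0].
have -> : (size [:: aone, a & s])%:Z + 1 = ((size (a :: s))%:Z + 1) + 1 by rewrite /=; lia.
rewrite -[ksgn (_ + 1 + 1) *: _]ksgnN !scalerDr EU; zmodule.
Qed.

(** The contraction of the cone of the unit assembled from ins1 and ev1; the
    side conditions ev1 ins1 = 0 and ins1 unit = 0 hold by strict unitality. *)
Lemma cunit_rqi : rel_quasi_iso (cunit Y).
Proof.
have e1 x : ev1 (cins1 x) = 0.
  by apply: cvalid_unital (cfunP x) _ _ _; rewrite inE eqxx.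
have e2 y : cins1 (cunit Y y) = 0 by apply: coind_eq => -[|a s].
have e3 y : ev1 (cunit Y y) = y by apply: am_one.
exists (fun z => (cins1 z.1, ev1 z.1)); split.
- move=> c z1 z2.
  by rewrite -[RHS]/(c *: cins1 z1.1 + cins1 z2.1, c *: ev1 z1.1 + ev1 z2.1) -cins1_lin.
- move=> n [x y] [hx hy]; split; first exact: chom_ins1 hx.
  suff: @gdeg k Y (n - 1 + 1) (ev1 x) by [].
  have := coind_value_deg hx (homog1 (aone_deg A)).
  by rewrite tdeg_cons tdeg_nil /= => H; move: H; congr gdeg; lia.
move=> [x y]; rewrite -[LHS]/(am (coinduced Y) (cins1 x) [::] + cunit Y (ev1 x) +
   cins1 (am (coinduced Y) x [::] + cunit Y y),
   @sfam k A 1 Y Y (am Y) (ev1 x) [::] + ev1 (am (coinduced Y) x [::] + cunit Y y)).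
congr (_, _).
  by rewrite (linD cins1_lin) e2 addr0 addrAC cins1_homotopy subrK.
rewrite (linD ev1_lin) e3 ev1_d /sfam ksgn_oddN // scaleN1r.
by rewrite addrA addNr add0r.
Qed.
End UnitContraction.
End CoinducedFunctor.

(** * Relative quasi-isomorphisms are homotopy equivalences *)

Section Contraction.
Variables (k : comPzRingType) (A : dgAlg k) (T : dgMod A) (h : T -> T).
Hypothesis hl : linear h.
Hypothesis hd : forall n x, gdeg n x -> gdeg (n - 1) (h x).
Hypothesis hc : forall x, am T (h x) [::] + h (am T x [::]) = x.

(** The obstruction to the A-linearity of h. *)
Definition defect (x : T) (a : A) : T := am T (h x) [:: a] - h (am T x [:: a]).

(** The contraction h (x) 1 of the bar construction of T fails to anticommute with
    the part of the differential given by the action exactly by the defect.  The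
    perturbed contraction is a geometric series in the defect, which has a single
    term in each arity. *)
Definition ainf_contraction (x : T) (s : seq A) : T := h (foldl defect x s).

Lemma defect_linl a : linear (defect^~ a).
Proof.
apply: lin_add; first exact: lin_comp (dg_act_linl a) hl.
exact: lin_opp (lin_comp hl (dg_act_linl a)).
Qed.

Lemma defect_linr x : linear (defect x).
Proof.
apply: lin_add; first exact: dg_act_linr.
exact: lin_opp (lin_comp hl (dg_act_linr x)).
Qed.

Lemma defect_deg p q x a : gdeg p x -> gdeg q a -> gdeg (p + q - 1) (defect x a).
Proof.
move=> hx ha; apply: gdegD; last by rewrite -[- h _]scaleN1r; apply/gdegZ/hd/dg_act_deg.
by have := dg_act_deg (hd hx) ha; congr gdeg; lia.
Qed.

Lemma defect1 x : defect x aone = 0.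
Proof. by rewrite /defect !am_one subrr. Qed.

Lemma gpar_contraction x : gpar (h x) = - h (gpar x).
Proof.
have := gpar_map hl (e := -1) hd x.
by rewrite ksgn_oddN // scaleN1r => ->; rewrite opprK.
Qed.

Lemma gpar_defect x a : gpar (defect x a) = - defect (gpar x) (gpar a).
Proof.
rewrite /defect (linB (@gpar_lin _ T)) dg_gpar_act !gpar_contraction dg_gpar_act.
by rewrite (linN (dg_act_linl _)) opprD.
Qed.

Lemma d_defect x a : am T (defect x a) [::] =
  - defect (am T x [::]) a - defect (gpar x) (adiff a).
Proof.
have ed y : am T (h y) [::] = y - h (am T y [::]) by rewrite -{2}(hc y) addrK.
rewrite /defect (linB (@dg_d_lin _ _ T)) dg_d_act !ed dg_d_act gpar_contraction.
rewrite (linB (dg_act_linl a)) (linN (dg_act_linl _)) (linD hl).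
zmodule.
Qed.

(** The defect is a Hochschild cocycle, being a coboundary. *)
Lemma defect_cocycle x a b :
  defect x (amul a b) = am T (defect x a) [:: b] + defect (am T x [:: a]) b.
Proof. by rewrite /defect (linB (dg_act_linl b)) !dg_actA addrA subrK. Qed.

Lemma foldl_defect_lin s : linear (fun x => foldl defect x s).
Proof. by elim: s => [|a s IH] //=; apply: (lin_comp IH (defect_linl a)). Qed.

Lemma ainf_contraction_family : is_family (-1) ainf_contraction.
Proof.
split.
- by move=> s; apply: lin_comp hl (foldl_defect_lin s).
- move=> x u v c a1 a2; rewrite /ainf_contraction !foldl_cat /=.
  by rewrite (defect_linr) (foldl_defect_lin v) hl.
- move=> p x t hx ht; suff : gdeg (p + tdeg t - (size t)%:Z) (foldl defect x (vals t)).
    by move/hd; rewrite /ainf_contraction; congr gdeg; lia.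
  elim: t p x hx ht => [|[q a] t IH] p x hx; first by rewrite tdeg_nil addr0 subr0.
  move=> /homog_cons /= [ha ht]; have := IH _ _ (defect_deg hx ha) ht.
  by rewrite tdeg_cons /=; congr gdeg; lia.
Qed.

Lemma ainf_contraction_su : strictly_unital ainf_contraction.
Proof.
move=> x s hs; rewrite /ainf_contraction (_ : foldl _ _ _ = 0) ?(lin0 hl) //.
elim: s x hs => [|a s IH] x //; rewrite inE => /orP [/eqP <-|hs] /=; last exact: IH.
by rewrite defect1 (lin0 (foldl_defect_lin s)).
Qed.

(** In the step, the boundary at x and a :: s is compared with the one at
    defect x a and s; the difference consists of the terms that affect a, and
    vanishes because the defect is closed and a cocycle. *)
Lemma ainf_contractionP x s :
  bdry 1 ainf_contraction x s = if s is [::] then x else 0.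
Proof.
case: s => [|a s].
  by rewrite /bdry /= scaler0 addr0 !addr0 subr0 ksgn1 scaleN1r opprK hc.
have H0 u : linear (fun y => ainf_contraction y u) := fam_lin ainf_contraction_family u.
elim: s x a => [|b s IH] x a.
  rewrite /bdry /= ksgn1 scaleN1r (_ : ksgn (1 + 1) = 1) ?scale1r; last exact: ksgn_even.
  rewrite /ainf_contraction /= !addr0 !subr0.
  have -> : am T (h (defect x a)) [::] = defect x a - h (am T (defect x a) [::]).
    by rewrite -{2}(hc (defect x a)) addrK.
  rewrite d_defect (linB hl) (linN hl) /defect; zmodule.
rewrite -[RHS](IH (defect x a) b); set M := defect x a.
rewrite /bdry lact_cons (bd_cons _ a) (bm_cons _ a).
rewrite -[ainf_contraction x [:: a, b & s]]/(ainf_contraction M (b :: s)).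
rewrite -[lact (fun u => ainf_contraction x (a :: u)) _]/(lact (ainf_contraction M) (b :: s)).
congr (_ - _).
have -> : 1 + (size [:: a, b & s])%:Z = (1 + (size (b :: s))%:Z) + 1 :> int by rewrite /=; lia.
rewrite -ksgnN -scalerN; congr (_ *: _).
rewrite -[bm (fun u => ainf_contraction x (a :: u)) _]/(bm (ainf_contraction M) (b :: s)).
have -> : bd (ainf_contraction (gpar M)) (b :: s) =
    - bd (fun u => ainf_contraction (gpar x) (gpar a :: u)) (b :: s).
  rewrite -bdN; apply: bd_eq => u _; rewrite gpar_defect.
  exact: (linN (H0 u)).
have -> : ainf_contraction (am T M [::]) (b :: s) =
    - ainf_contraction (am T x [::]) [:: a, b & s] -
      ainf_contraction (gpar x) [:: adiff a, b & s].
  by rewrite d_defect (linB (H0 _)) (linN (H0 _)).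
have -> : ainf_contraction x (amul a b :: s) =
    hact ainf_contraction M (b :: s) + hact ainf_contraction x [:: a, b & s].
  by rewrite -[LHS]/(ainf_contraction (defect x (amul a b)) s) defect_cocycle (linD (H0 s)).
zmodule.
Qed.
End Contraction.

(** The contraction H of the cone Y (+) S X of w is a two by two matrix.  The
    entry from Y to S X is an inverse of w, and the diagonal entries are the two
    homotopies: this is the identity bdry 1 H = id read entry by entry. *)
Section ConeInverse.
Variables (k : comPzRingType) (A : dgAlg k) (X Y : dgMod A) (w : strictHom X Y).
Variable h : dg_cone w -> dg_cone w.
Hypothesis hl : linear h.
Hypothesis hd : forall n x, @gdeg k (dg_cone w) n x -> @gdeg k (dg_cone w) (n - 1) (h x).
Hypothesis hc : forall x, am (dg_cone w) (h x) [::] + h (am (dg_cone w) x [::]) = x.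

Let T := dg_cone w.
Let H : T -> seq A -> T := @ainf_contraction k A T h.
Let Hf : is_family (-1) H := ainf_contraction_family hl hd.
Let Hu : strictly_unital H := ainf_contraction_su hl.
Let HP x s : bdry 1 H x s = if s is [::] then x else 0 := ainf_contractionP hl hd hc x s.

Let i (y : Y) : T := (y, 0).
Let j (x : X) : T := (0, x).
Let p1 (z : T) : Y := z.1.
Let p2 (z : T) : X := z.2.

Let p1_lin : linear p1. Proof. by []. Qed.
Let p2_lin : linear p2. Proof. by []. Qed.
Let i_lin : linear i. Proof. exact: (sh_lin (cone_inc w)). Qed.
Let j_lin : linear j.
Proof.
by move=> c x y; rewrite /j -[RHS]/(c *: 0 + 0, c *: x + y) scaler0 addr0.
Qed.

Let i_am y s : am T (i y) s = i (am Y y s).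
Proof. by rewrite -[RHS]/(cone_inc w _) sh_am. Qed.

Lemma lact_fst (F : seq A -> T) s : p1 (lact F s) = lact (fun u => p1 (F u)) s.
Proof.
elim: s F => [|a [|b s] IH] F //; last by rewrite !lact_cons IH.
by rewrite /= /p1 /= addr0.
Qed.

Lemma lact_snd (F : seq A -> T) s : p2 (lact F s) = lact (fun u => p2 (F u)) s.
Proof.
elim: s F => [|a [|b s] IH] F //; last by rewrite !lact_cons IH.
by rewrite /= /p2 /= /sfam ksgnZ_even.
Qed.

Lemma gpar_inc y : gpar (i y) = i (gpar y).
Proof.
have := gpar_map i_lin (e := 0) _ y; rewrite ksgn0 scale1r => -> //.
by move=> p x hx; split; [rewrite addr0 | apply: gdeg0].
Qed.

Lemma gpar_j x : gpar (j x) = - j (gpar x).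
Proof.
have := gpar_map j_lin (e := -1) _ x; rewrite ksgn_oddN // scaleN1r => -> //.
  by rewrite opprK.
move=> p y hy; split; first exact: gdeg0.
by rewrite /= /gshift_deg subrK.
Qed.

Definition cone_inverse_fun (y : Y) (s : seq A) : X := p2 (H (i y) s).

Lemma cone_inverse_family : is_family 0 cone_inverse_fun.
Proof.
split.
- by move=> s; apply: lin_comp p2_lin (lin_comp (fam_lin Hf s) i_lin).
- by move=> y u v; apply: lin_comp p2_lin (fam_linA Hf _ _ _).
- move=> p y t hy ht.
  have [_] := fam_deg Hf (conj hy (gdeg0 (gshift X) p) : @gdeg k T p (i y)) ht.
  by rewrite /= /gshift_deg /cone_inverse_fun /p2; congr gdeg; lia.
Qed.

Lemma cone_inverse_su : strictly_unital cone_inverse_fun.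
Proof. by move=> y s hs; rewrite /cone_inverse_fun Hu. Qed.

Lemma hact_inc y s : hact H (i y) s = hact (fun y' => H (i y')) y s.
Proof. by case: s => [|b s] //; rewrite /hact i_am. Qed.

Lemma cone_inverse_bdry y s : bdry 0 cone_inverse_fun y s = 0.
Proof.
have E : p2 (bdry 1 H (i y) s) = 0 by rewrite HP; case: s.
apply: oppr_inj; rewrite oppr0 -E.
rewrite /bdry ksgn0 scale1r add0r ksgnD ksgn1 !scaleN1r mulN1r scaleNr opprK.
rewrite (linD p2_lin) (linB p2_lin) lact_snd (linZ p2_lin) (linD p2_lin) (linD p2_lin) (linB p2_lin).
rewrite (bd_comp _ _ p2_lin) (bm_comp _ _ p2_lin) gpar_inc hact_inc.
rewrite i_am.
have -> : p2 (am T (H (i y) s) [::]) = - am X (p2 (H (i y) s)) [::].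
  by rewrite /p2 /= /sfam ksgn1 scaleN1r.
have -> : p2 (hact (fun y' => H (i y')) y s) = hact cone_inverse_fun y s by case: (s).
rewrite opprD opprK -[bd _ _]/(bd (cone_inverse_fun (gpar y)) s).
by rewrite opprD.
Qed.

Definition cone_inverse : ainfHom Y X :=
  @AinfHom k A Y X cone_inverse_fun cone_inverse_family
    (fun p y t hy ht => bdry_ainf cone_inverse_family hy ht (cone_inverse_bdry y (vals t)))
    cone_inverse_su.

Lemma cone_inverser :
  homotopic (ainf_comp (ainf_of_strict w) cone_inverse) (ainf_id Y).
Proof.
apply: homotopic_sym; apply: (@bdry_homotopic k A Y Y _ _ (fun y s => p1 (H (i y) s))).
- split.
  + by move=> s; apply: lin_comp p1_lin (lin_comp (fam_lin Hf s) i_lin).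
  + by move=> y u v; apply: lin_comp p1_lin (fam_linA Hf _ _ _).
  + move=> p y t hy ht.
    by have [] := fam_deg Hf (conj hy (gdeg0 (gshift X) p) : @gdeg k T p (i y)) ht.
- by move=> y s hs; rewrite Hu.
move=> p y t hy ht; move: (vals t) => s /=.
rewrite (comp_strictl _ _ _ _ (@strictfam_nil _ _ _ _ w)) /=.
have -> : strictfam (strict_id Y) y s = p1 (bdry 1 H (i y) s) by rewrite HP; case: s.
rewrite /bdry (linB p1_lin) (linD p1_lin) !(linZ p1_lin) lact_fst (linD p1_lin) (linD p1_lin) (linB p1_lin).
rewrite (bd_comp _ _ p1_lin) (bm_comp _ _ p1_lin) gpar_inc hact_inc.
rewrite i_am.
have -> : p1 (am T (H (i y) s) [::]) = am Y (p1 (H (i y) s)) [::] + w (cone_inverse_fun y s).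
  by [].
have -> : p1 (hact (fun y' => H (i y')) y s) = hact (fun y s => p1 (H (i y) s)) y s by case: (s).
set hac := hact _ _ _; set q := ksgn (_ + _) *: _; set l := ksgn 1 *: _.
zmodule.
Qed.

Lemma cone_inversel :
  homotopic (ainf_comp cone_inverse (ainf_of_strict w)) (ainf_id X).
Proof.
(* the suspension of X changes the signs of the components of odd arity *)
pose K x s := ksgn (size s)%:Z *: p2 (H (j x) s).
apply: (@bdry_homotopic k A X X _ _ K).
- split.
  + by move=> s; apply: lin_scale (lin_comp p2_lin (lin_comp (fam_lin Hf s) j_lin)).
  + move=> x u v c a1 a2; rewrite /K !size_cat /= (fam_linA Hf) (p2_lin).
    by rewrite scalerDr !scalerA mulrC.
  + move=> p x t hx ht; apply: gdegZ.
    have hj : @gdeg k T (p - 1) (j x).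
      by split; [apply: gdeg0 | rewrite /= /gshift_deg subrK].
    have [_] := fam_deg Hf hj ht.
    by rewrite /= /gshift_deg /p2; congr gdeg; lia.
- by move=> x s hs; rewrite /K Hu // scaler0.
move=> p x t hx ht; move: (vals t) => s /=.
rewrite (comp_strictr _ _ _ cone_inverse_family (@strictfam_nil _ _ _ _ w)) mul0r ksgn0 scale1r /=.
have -> : strictfam (strict_id X) x s = ksgn (size s)%:Z *: p2 (bdry 1 H (j x) s).
  by rewrite HP; case: s => [|a s] /=; rewrite ?scaler0 // scale1r.
have EL : lact (K x) s = - (ksgn (size s)%:Z *: lact (fun u => p2 (H (j x) u)) s).
  rewrite ksgnN -lactZ; apply: lact_eq => u hu.
  by apply: ksgnZ_odd; rewrite -hu; lia.
have EM : bm (K x) s = - (ksgn (size s)%:Z *: bm (fun u => p2 (H (j x) u)) s).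
  rewrite ksgnN -bmZ; apply: bm_eq => u hu.
  by apply: ksgnZ_odd; rewrite -hu; lia.
have EB : bd (K (gpar x)) s = ksgn (size s)%:Z *: bd (fun u => p2 (H (j (gpar x)) u)) s.
  by rewrite -bdZ; apply: bd_eq => u hu; rewrite /K hu.
have EH : hact K x s = - (ksgn (size s)%:Z *: p2 (hact H (j x) s)).
  case: s {EL EM EB} => [|b s]; first by rewrite scaler0 oppr0.
  rewrite /K /= ksgnN; have -> : cone_am w (j x) [:: b] = j (am X x [:: b]).
    rewrite /cone_am /= /sfam ksgnZ_even // (lin0 (dg_act_linl _)) addr0.
    by [].
  by apply: ksgnZ_odd; lia.
rewrite /bdry EL EM EB EH.
have -> : p2 (am T (H (j x) s) [::] + ksgn 1 *: lact (H (j x)) s - ksgn (1 + (size s)%:Z) *: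
   (H (am T (j x) [::]) s - hact H (j x) s + bd (H (gpar (j x))) s + bm (H (j x)) s)) =
  - am X (p2 (H (j x) s)) [::] - lact (fun u => p2 (H (j x) u)) s + ksgn (size s)%:Z *:
   (cone_inverse_fun (w x) s - p2 (H (j (am X x [::])) s) - p2 (hact H (j x) s) -
     bd (fun u => p2 (H (j (gpar x)) u)) s + bm (fun u => p2 (H (j x) u)) s).
  rewrite (linB p2_lin) (linD p2_lin) !(linZ p2_lin) lact_snd (linD p2_lin) (linD p2_lin) (linB p2_lin).
  rewrite (bd_comp _ _ p2_lin) (bm_comp _ _ p2_lin) gpar_j.
  have -> : p2 (am T (H (j x) s) [::]) = - am X (p2 (H (j x) s)) [::].
    by rewrite /p2 /= /sfam ksgn1 scaleN1r.
  have -> : am T (j x) [::] = i (w x) - j (am X x [::]).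
    rewrite -[LHS]/(am Y 0 [::] + w x, @sfam k A 1 X X (am X) x [::]).
    rewrite (lin0 (@dg_d_lin _ _ Y)) /sfam ksgn1 scaleN1r.
    by rewrite -[RHS]/(w x - 0, 0 - am X x [::]) subr0 add0r sub0r.
  rewrite (linB (fam_lin Hf s)) (linB p2_lin) ksgn1 scaleN1r ksgnD ksgn1 mulN1r scaleNr opprK.
  rewrite -[p2 (H (i (w x)) s)]/(cone_inverse_fun (w x) s).
  have -> : bd (fun u => p2 (H (- j (gpar x)) u)) s = - bd (fun u => p2 (H (j (gpar x)) u)) s.
    by rewrite -bdN; apply: bd_eq => u _; rewrite (linN (fam_lin Hf u)) (linN p2_lin).
  by [].
rewrite {1}/K (linZ (@dg_d_lin _ _ X)) /K ksgn1 scaleN1r opprK (ksgnD _ 1) ksgn1 mulN1r scaleNr opprK.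
set e := ksgn _; rewrite !(scalerDr, scalerN, opprD, opprK) !scalerA ksgnK !scale1r.
zmodule.
Qed.
End ConeInverse.

Lemma rqi_iso (k : comPzRingType) (A : dgAlg k) (X Y : dgMod A) (w : strictHom X Y) :
  rel_quasi_iso w -> exists g : ainfHom Y X,
    homotopic (ainf_comp g (ainf_of_strict w)) (ainf_id X) /\
    homotopic (ainf_comp (ainf_of_strict w) g) (ainf_id Y).
Proof.
move=> [h [hl hd hc]]; exists (cone_inverse hl hd hc).
by split; [apply: cone_inversel | apply: cone_inverser].
Qed.

(** * Cylinders *)

Section DirectSum.
Variables (k : comPzRingType) (A : dgAlg k).

Section Sum.
Variables M N : dgMod A.
Let S : gmod k := gsum M N.

Definition dsum_d (z : S) : S := (am M z.1 [::], am N z.2 [::]).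
Definition dsum_act (z : S) (a : A) : S := (am M z.1 [:: a], am N z.2 [:: a]).

Lemma gpar_pair (z : S) : gpar z = (gpar z.1, gpar z.2).
Proof.
rewrite [LHS]surjective_pairing; congr (_, _).
  have := @gpar_map k S M 0 fst (fun c x y => erefl) _ z.
  by rewrite ksgn0 scale1r => -> // p x []; rewrite addr0.
have := @gpar_map k S N 0 snd (fun c x y => erefl) _ z.
by rewrite ksgn0 scale1r => -> // p x []; rewrite addr0.
Qed.

Lemma dsum_d_lin : linear dsum_d.
Proof.
move=> c x y.
by rewrite /dsum_d (dg_d_lin (Y := M)) (dg_d_lin (Y := N)).
Qed.

Lemma dsum_act_linl a : linear (dsum_act^~ a).
Proof.
move=> c x y.
by rewrite /dsum_act (dg_act_linl (Y := M)) (dg_act_linl (Y := N)).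
Qed.

Lemma dsum_act_linr z : linear (dsum_act z).
Proof. by move=> c x y; rewrite /dsum_act !dg_act_linr. Qed.

Lemma dsum_dd z : dsum_d (dsum_d z) = 0.
Proof. by rewrite /dsum_d /= !dg_dd. Qed.

Lemma dsum_actA z a b : dsum_act (dsum_act z a) b = dsum_act z (amul a b).
Proof. by rewrite /dsum_act /= !dg_actA. Qed.

Lemma dsum_act1 z : dsum_act z aone = z.
Proof. by case: z => x y; rewrite /dsum_act /= !am_one. Qed.

Lemma dsum_d_act z a :
  dsum_d (dsum_act z a) = dsum_act (dsum_d z) a + dsum_act (gpar z) (adiff a).
Proof. by rewrite gpar_pair /dsum_d /dsum_act /= !dg_d_act. Qed.

Definition dsum : dgMod A :=
  @mkdg k A S dsum_d dsum_act dsum_d_lin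
    (fun p z h => conj (dg_d_deg h.1) (dg_d_deg h.2)) dsum_dd
    dsum_act_linl dsum_act_linr
    (fun p q z a h ha => conj (dg_act_deg h.1 ha) (dg_act_deg h.2 ha))
    dsum_actA dsum_act1 dsum_d_act.

Lemma dsum_am z s : am dsum z s = (am M z.1 s, am N z.2 s).
Proof. by case: s => [|a [|b s]] //=; rewrite !dg_high. Qed.

Definition dsum_fst : strictHom dsum M :=
  @StrictHom k A dsum M fst (fun c x y => erefl) (fun p z h => h.1)
    (fun z s => congr1 fst (dsum_am z s)).

Definition dsum_snd : strictHom dsum N :=
  @StrictHom k A dsum N snd (fun c x y => erefl) (fun p z h => h.2)
    (fun z s => congr1 snd (dsum_am z s)).

Section Pairing.
Variables (L : dgMod A) (f : strictHom L M) (g : strictHom L N).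

Lemma dsum_pair_lin : linear (fun x => (f x, g x) : dsum).
Proof. by move=> c x y; rewrite (sh_lin f) (sh_lin g). Qed.

Lemma dsum_pair_am x s :
  ((f (am L x s), g (am L x s)) : dsum) = am dsum (f x, g x) s.
Proof. by rewrite dsum_am !sh_am. Qed.

Definition dsum_pair : strictHom L dsum :=
  @StrictHom k A L dsum _ dsum_pair_lin
    (fun p x h => conj (sh_deg f h) (sh_deg g h)) dsum_pair_am.
End Pairing.
End Sum.

Section StrictMaps.
Variables L M N : dgMod A.

Lemma zero_am (x : L) s : (0 : M) = am M 0 s.
Proof. by rewrite (lin0 (fam_lin (am_fam M) s)). Qed.

Definition strict_zero : strictHom L M :=
  @StrictHom k A L M (fun=> 0) (fun c x y => esym (etrans (congr2 +%R (scaler0 _ c) erefl) (addr0 0)))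
    (fun p x h => gdeg0 M p) zero_am.

Variables (f g : strictHom L M) (c : k).
Lemma strict_comb_lin : linear (fun x => f x + c *: g x).
Proof. exact: lin_add (sh_lin f) (lin_scale c (sh_lin g)). Qed.

Lemma strict_comb_deg p x : gdeg p x -> gdeg p (f x + c *: g x).
Proof. by move=> h; apply: gdegD; [apply: sh_deg | apply/gdegZ/sh_deg]. Qed.

Lemma strict_comb_am x s : f (am L x s) + c *: g (am L x s) = am M (f x + c *: g x) s.
Proof.
by rewrite (linD (fam_lin (am_fam M) s)) (linZ (fam_lin (am_fam M) s)) !sh_am.
Qed.

Definition strict_comb : strictHom L M :=
  StrictHom strict_comb_lin strict_comb_deg strict_comb_am.
End StrictMaps.

Definition dg_hull (X : dgMod A) : dgMod A := dg_cone (strict_id X).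

Definition hull_contraction (X : dgMod A) (z : dg_hull X) : dg_hull X := (0, z.1).

Lemma hull_contractionP (X : dgMod A) (z : dg_hull X) :
  am (dg_hull X) (hull_contraction z) [::] + hull_contraction (am (dg_hull X) z [::]) = z.
Proof.
case: z => x y; rewrite -[LHS]/(am X 0 [::] + x + 0, @sfam k A 1 X X (am X) x [::] + (am X x [::] + y)).
rewrite (lin0 (@dg_d_lin _ _ X)) add0r addr0 /sfam ksgn1 scaleN1r addKr.
by [].
Qed.

Lemma dsum_fst_rqi (Y X : dgMod A) : rel_quasi_iso (dsum_fst Y (dg_hull X)).
Proof.
pose c := @hull_contraction X.
have cl : linear c.
  by move=> a x y; rewrite /c /hull_contraction -[RHS]/(a *: 0 + 0, _) scaler0 addr0.
exists (fun z => (0, (z.1, - c z.2.2))); split.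
- move=> a x y; rewrite -[RHS]/(a *: 0 + 0, (a *: x.1 + y.1, a *: - c x.2.2 - c y.2.2)).
  by rewrite scaler0 addr0 /= cl opprD scalerN.
- move=> n [y [y' z]] [/= hy [hy' hz]]; split; first exact: gdeg0.
  split; first by rewrite subrK.
  rewrite -scaleN1r; apply: gdegZ; case: hz => hz _; split; first exact: gdeg0.
  by rewrite /= /gshift_deg; move: hz; congr gdeg; lia.
move=> [y [y' z]].
pose dH := am (dg_hull X).
rewrite -[LHS]/(am Y 0 [::] + y + 0,
  (@sfam k A 1 Y Y (am Y) y [::] + (am Y y [::] + y'),
   @sfam k A 1 (dg_hull X) (dg_hull X) dH (- c z) [::]
     - c (@sfam k A 1 (dg_hull X) (dg_hull X) dH z [::]))).
rewrite (lin0 (@dg_d_lin _ _ Y)) add0r addr0 /sfam ksgn1 !scaleN1r addKr.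
have -> : - dH (- c z) [::] - c (- dH z [::]) = z.
  have ldH : linear (fun z => dH z [::]) := @dg_d_lin _ _ (dg_hull X).
  rewrite (linN ldH) (linN cl) !opprK.
  exact: hull_contractionP.
by [].
Qed.
End DirectSum.

Section Localized.
Variables (k : comPzRingType) (A : dgAlg k).

(** A null-homotopy of f - g is a strict morphism from the hull of X, so that f
    and g factor through the two ends of the cylinder X (+) hull X, which
    become equal once the projection to X is inverted. *)
Section Cylinder.
Variables (X Y : dgMod A) (f g : strictHom X Y) (h : X -> Y).
Hypothesis hl : linear h.
Hypothesis hd : forall n x, gdeg n x -> gdeg (n - 1) (h x).
Hypothesis ha : forall x a, h (am X x [:: a]) = am Y (h x) [:: a].
Hypothesis hfg : forall x, f x - g x = am Y (h x) [::] + h (am X x [::]).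

Let cyl := dsum X (dg_hull X).
Let phi (z : cyl) : Y := f z.1 + ((g z.2.1 - f z.2.1) - h z.2.2).

Lemma cylinder_map_lin : linear phi.
Proof.
apply: lin_add; first exact: lin_comp (sh_lin f) (fun c x y => erefl).
apply: lin_add.
  by apply: lin_add; [|apply: lin_opp];
    apply: lin_comp (sh_lin _) (fun c x y => erefl).
by apply: lin_opp; apply: lin_comp hl (fun c x y => erefl).
Qed.

Lemma cylinder_map_deg p (z : cyl) : gdeg p z -> gdeg p (phi z).
Proof.
move=> [hz [hz1 hz2]]; have N (x : Y) : gdeg p x -> gdeg p (- x).
  by move=> hx; rewrite -scaleN1r; apply: gdegZ.
apply: gdegD; first exact: sh_deg.
apply: gdegD; last by apply: N; have := hd hz2; rewrite addrK.
by apply: gdegD; [|apply: N]; apply: sh_deg.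
Qed.

Lemma cylinder_map_am (z : cyl) s : phi (am cyl z s) = am Y (phi z) s.
Proof.
case: z => x [x1 x2]; case: s => [|a [|b s]].
- rewrite /phi -[am cyl _ _]/(am X x [::], (am X x1 [::] + x2, @sfam k A 1 X X (am X) x2 [::])) /=.
  rewrite /sfam ksgn1 scaleN1r (linN hl) (linD (sh_lin f)) (linD (sh_lin g)).
  have ld := @dg_d_lin _ _ Y.
  rewrite (linD ld) (linB ld) (linB ld) !sh_am.
  have -> : h (am X x2 [::]) = f x2 - g x2 - am Y (h x2) [::] by rewrite hfg addrC addrA addNr add0r.
  zmodule.
- rewrite /phi -[am cyl _ _]/(am X x [:: a], (am X x1 [:: a] + 0, @sfam k A 1 X X (am X) x2 [:: a])) /=.
  rewrite /sfam ksgnZ_even // addr0 ha !sh_am.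
  by have ld := @dg_act_linl _ _ Y a; rewrite (linD ld) (linB ld) (linB ld).
- by rewrite !dg_high // (lin0 cylinder_map_lin).
Qed.

Definition cylinder_map : strictHom cyl Y :=
  StrictHom cylinder_map_lin cylinder_map_deg cylinder_map_am.
End Cylinder.

Lemma strict_homotopic_loc (X Y : CA A) (f g : hom X Y) :
  strict_homotopic f g -> zeq (loc_mor (@CA_rqi k A) f) (loc_mor (@CA_rqi k A) g).
Proof.
move=> [h [hl hd ha hfg]].
pose Phi : @hom (CA A) _ Y := cylinder_map hl hd ha hfg.
pose i0 : @hom (CA A) X _ := dsum_pair (strict_id X) (strict_zero X (dg_hull X)).
pose i1 : @hom (CA A) X _ := @dsum_pair k A X (dg_hull X) X (strict_id X) (cone_inc (strict_id X)).
pose pi : @hom (CA A) _ X := dsum_fst X (dg_hull X).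
have e0 : heq f (cmp Phi i0).
  move=> x; rewrite /= (lin0 (sh_lin f)) (lin0 (sh_lin g)) (lin0 hl).
  by rewrite !subr0 addr0.
have e1 : heq g (cmp Phi i1).
  by move=> x; rewrite /= (lin0 hl) subr0 addrC subrK.
apply: zeq_trans (loc_mor_heq _ e0) _; apply: zeq_sym.
apply: zeq_trans (loc_mor_heq _ e1) _.
apply: zeq_trans (loc_morM _ _ _) _; apply: zeq_sym.
apply: zeq_trans (loc_morM _ _ _) _.
apply: zcat_zeq (zeq_refl _).
apply: (iso_mono (C := Drel_cat A) (f := loc_mor (@CA_rqi k A) pi)).
  exact: loc_iso (dsum_fst_rqi X X).
have e : heq (cmp pi i0) (cmp pi i1) by [].
apply: zeq_trans (zeq_sym (loc_morM _ pi i0)) _.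
exact: zeq_trans (loc_mor_heq _ e) (loc_morM _ pi i1).
Qed.
End Localized.

(** * The equivalence *)

Section Comparison.
Variables (k : comPzRingType) (A : dgAlg k) (eps : augmentation A).

Lemma ainf_of_strict_heq (X Y : CA A) (f g : hom X Y) :
  heq f g -> homotopic (ainf_of_strict f) (ainf_of_strict g).
Proof. by move=> e; apply: homotopic_eq => p x [|q t] _ _ //=; rewrite e. Qed.

Lemma ainf_of_strict_comp (L M N : ainfMod A) (f : strictHom M N) (g : strictHom L M) :
  homotopic (ainf_of_strict (strict_comp f g)) (ainf_comp (ainf_of_strict f) (ainf_of_strict g)).
Proof.
apply: homotopic_eq => p x t _ _ /=.
rewrite (comp_strictl _ _ _ _ (@strictfam_nil _ _ _ _ f)) /=.
by case: t => [|q t] //=; rewrite (lin0 (sh_lin f)).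
Qed.

Definition strict_functor : functor (CA A) (stab_dg_cat A) :=
  @Functor (CA A) (stab_dg_cat A) (fun X => X) (fun X Y f => ainf_of_strict f)
    ainf_of_strict_heq (fun X => homotopic_refl _)
    (fun X Y Z f g => ainf_of_strict_comp f g).

(** This is where contractibility over k suffices, the perturbed contraction not
    being asked to be A-linear. *)
Lemma strict_functor_rqi (X Y : CA A) (w : hom X Y) :
  CA_rqi w -> is_iso (fmap strict_functor w).
Proof. exact: rqi_iso. Qed.

Definition Drel_to_stab : functor (Drel_cat A) (stab_dg_cat A) :=
  loc_extension strict_functor_rqi.

Let loc X Y (f : @hom (CA A) X Y) : @hom (Drel_cat A) X Y := loc_mor (@CA_rqi k A) f.

Let loc_inv X Y (w : @hom (CA A) X Y) (Ww : CA_rqi w) : @hom (Drel_cat A) Y X :=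
  @zbwd (CA A) (@CA_rqi k A) Y X X w Ww (znil _ X).

Lemma loc_natural (X Y X' Y' : CA A) (a : hom X Y) (b : hom X' Y')
    (f : hom X X') (g : hom Y Y') : heq (cmp b f) (cmp g a) ->
  heq (cmp (loc b) (loc f)) (cmp (loc g) (loc a)).
Proof.
move=> e; apply: zeq_trans (zeq_sym (loc_morM _ b f)) _.
exact: zeq_trans (loc_mor_heq _ e) (loc_morM _ g a).
Qed.

Let j X : @hom (CA A) X (coinduced X) := cunit X.
Let q X : @hom (stab_dg_cat A) (coinduced X) X := coev X.
Let Cmap X Y (f : @hom (stab_dg_cat A) X Y) :
  @hom (CA A) (coinduced X) (coinduced Y) := coind_map f.

(** The A_oo-morphism f is replaced by the strict morphism it induces between
    coinduced modules, conjugated by the units, which are invertible here. *)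
Definition stab_to_Drel_map (X Y : stab_dg_cat A) (f : hom X Y) : @hom (Drel_cat A) X Y :=
  cmp (@loc_inv Y (coinduced Y) (j Y) (cunit_rqi Y))
    (cmp (loc (Cmap f)) (loc (j X))).

Lemma loc_invP (X Y : CA A) (w : hom X Y) (Ww : CA_rqi w) :
  heq (cmp (loc_inv Ww) (loc w)) (idm (X : Drel_cat A)) /\
  heq (cmp (loc w) (loc_inv Ww)) (idm (Y : Drel_cat A)).
Proof. by split; [apply: zeq_fb | apply: zeq_bf]. Qed.

Lemma stab_to_Drel_heq (X Y : stab_dg_cat A) (f g : hom X Y) :
  heq f g -> heq (stab_to_Drel_map f) (stab_to_Drel_map g).
Proof.
move=> e; apply/heq_cmpr/heq_cmpl/strict_homotopic_loc.
exact: coind_map_homotopic.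
Qed.

(** On a strict morphism f, naturality of the unit gives back f. *)
Lemma stab_to_Drel_strict (X Y : CA A) (f : hom X Y) :
  heq (stab_to_Drel_map (ainf_of_strict f)) (loc f).
Proof.
apply: heq_trans (heq_cmpr _ (loc_natural (g := j Y) (a := f) _)) _.
  by move=> x; apply: cunit_natural.
exact: cmpKl (loc_invP (cunit_rqi Y)).1.
Qed.

Lemma stab_to_Drel_id (X : stab_dg_cat A) :
  heq (stab_to_Drel_map (idm X)) (idm (X : Drel_cat A)).
Proof.
apply: heq_trans (stab_to_Drel_strict (idm (X : CA A))) _.
exact: zeq_id.
Qed.

Lemma stab_to_Drel_cmp (X Y Z : stab_dg_cat A) (f : hom Y Z) (g : hom X Y) :
  heq (stab_to_Drel_map (cmp f g)) (cmp (stab_to_Drel_map f) (stab_to_Drel_map g)).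
Proof.
rewrite /stab_to_Drel_map.
apply: heq_trans _ (cmpA _ _ _); apply: heq_cmpr.
apply: heq_trans _ (cmpA _ _ _).
apply: heq_trans _ (heq_sym (heq_cmpr _ (cmpKl _ (loc_invP (cunit_rqi Y)).2))).
apply: heq_trans _ (heq_sym (cmpA _ _ _)); apply: heq_cmpl.
apply: zeq_trans _ (loc_morM _ (Cmap f) (Cmap g)).
by apply: loc_mor_heq => x; apply: coind_map_comp.
Qed.

Definition stab_to_Drel : functor (stab_dg_cat A) (Drel_cat A) :=
  @Functor (stab_dg_cat A) (Drel_cat A) (fun X => X) stab_to_Drel_map
    stab_to_Drel_heq stab_to_Drel_id stab_to_Drel_cmp.

Lemma stab_to_DrelK (X Y : Drel_cat A) (z : hom X Y) :
  heq (fmap stab_to_Drel (fmap Drel_to_stab z)) z.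
Proof.
elim: z => {X Y} [X|X Y Z f z IH|X Y Z w Ww z IH].
- exact: stab_to_Drel_id.
- apply: heq_trans (fmap_cmp stab_to_Drel _ _) _.
  exact: (heq_cmp IH (stab_to_Drel_strict f)).
- apply: heq_trans (fmap_cmp stab_to_Drel _ _) _.
  apply: (heq_trans (heq_cmpl _ IH)).
  have [h1 h2] := loc_invP Ww; have [k1 k2] := chosen_inverseP strict_functor_rqi Ww.
  suff h : heq (fmap stab_to_Drel (chosen_inverse strict_functor_rqi Ww)) (loc_inv Ww).
    exact: (@heq_cmpr (Drel_cat A) _ _ _ z _ _ h).
  apply: inverse_unique h2.
  apply: heq_trans (heq_cmpr _ (heq_sym (stab_to_Drel_strict w))) _.
  apply: heq_trans (heq_sym (fmap_cmp stab_to_Drel _ _)) _.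
  exact: heq_trans (fmap_heq stab_to_Drel k1) (fmap_id stab_to_Drel Y).
Qed.

(** Evaluation at 1 is a retraction of the unit, hence becomes its inverse once the
    latter is invertible; its naturality finishes the computation. *)
Lemma Drel_to_stabK (X Y : stab_dg_cat A) (f : hom X Y) :
  heq (fmap Drel_to_stab (fmap stab_to_Drel f)) f.
Proof.
have [k1 k2] := chosen_inverseP strict_functor_rqi (cunit_rqi Y).
have qj (Z : stab_dg_cat A) : heq (cmp (q Z) (fmap strict_functor (j Z))) (idm Z).
  exact: coev_cunit.
have qE := inverse_unique (qj Y) k2.
have E1 : heq (fmap Drel_to_stab (loc_inv (cunit_rqi Y))) (q Y).
  exact: heq_trans (cmp1m _) (heq_sym qE).
have E2 : heq (fmap Drel_to_stab (cmp (loc (Cmap f)) (loc (j X))))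
    (cmp (fmap strict_functor (Cmap f)) (fmap strict_functor (j X))).
  apply: heq_trans (fmap_cmp Drel_to_stab _ _) _.
  exact: heq_cmp (cmp1m _) (cmp1m _).
apply: heq_trans (fmap_cmp Drel_to_stab (loc_inv (cunit_rqi Y))
  (cmp (loc (Cmap f)) (loc (j X)))) _.
apply: (heq_trans (heq_cmp E1 E2)).
apply: heq_trans (cmpA _ _ _) _.
have E3 : heq (cmp (q Y) (fmap strict_functor (Cmap f))) (cmp f (q X)).
  exact: homotopic_sym (coev_natural f).
apply: heq_trans (heq_cmpl _ E3) _.
apply: heq_trans (heq_sym (cmpA _ _ _)) _.
exact: heq_trans (heq_cmpr _ (qj X)) (cmpm1 f).
Qed.

Lemma Drel_to_stab_unit :
  @nat_iso (Drel_cat A) (Drel_cat A) (id_functor _) (comp_functor stab_to_Drel Drel_to_stab)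
    (fun X => idm X).
Proof.
split=> [X|X Y z]; first exact: iso_id.
apply: heq_trans (cmp1m _) _; apply: heq_sym.
exact: heq_trans (cmpm1 _) (stab_to_DrelK z).
Qed.

Lemma Drel_to_stab_counit :
  @nat_iso (stab_dg_cat A) (stab_dg_cat A) (comp_functor Drel_to_stab stab_to_Drel) (id_functor _)
    (fun X => idm X).
Proof.
split=> [X|X Y f]; first exact: iso_id.
apply: heq_trans (cmp1m _) _.
exact: heq_trans (Drel_to_stabK f) (heq_sym (cmpm1 _)).
Qed.

(** * Suspension and triangles *)

(** The suspension isomorphism of the equivalence is -1.  In the conflation
    X -> Y (+) hull X -> cone f that starts with x |-> (f x, (x, 0)), the second
    morphism is (y, (x1, x')) |-> (y - f x1, - x').  Hence the connecting
    morphism cone f -> S X which matches the projection of hull X is minus the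
    projection of the cone. *)
Definition strict_opp (X : dgMod A) : strictHom X X :=
  strict_comb (strict_zero X X) (strict_id X) (-1).

Definition opp_iso (X : dgMod A) : @hom (stab_dg_cat A) X X := ainf_of_strict (strict_opp X).

Lemma opp_isoK (X : dgMod A) : heq (cmp (opp_iso X) (opp_iso X)) (idm (X : stab_dg_cat A)).
Proof.
apply: heq_trans (heq_sym (fmap_cmp strict_functor _ _)) _.
by apply: ainf_of_strict_heq => x /=; rewrite !add0r !scaleN1r opprK.
Qed.

Lemma opp_iso_natural (X Y : stab_dg_cat A) (f : hom X Y) :
  heq (cmp (opp_iso Y) f) (cmp f (opp_iso X)).
Proof.
apply: homotopic_eq => p x t _ _ /=.
rewrite (comp_strictl _ _ _ _ (@strictfam_nil _ _ _ _ (strict_opp Y))).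
rewrite (comp_strictr _ _ _ (ah_fam f) (@strictfam_nil _ _ _ _ (strict_opp X))).
by rewrite /= mul0r ksgn0 scale1r !add0r !scaleN1r (linN (fam_lin (ah_fam f) _)).
Qed.

Lemma strict_functor_shift (X Y : CA A) (f : hom X Y) :
  heq (fmap strict_functor (fmap (CA_shift A) f))
      (fmap (stab_dg_shift A) (fmap strict_functor f)).
Proof.
apply: homotopic_eq => p x [|r t] _ _ /=; rewrite /sfam /= ?scaler0 //.
by rewrite addr0 ksgn0 scale1r.
Qed.

Lemma Drel_to_stab_shift (X Y : Drel_cat A) (z : hom X Y) :
  heq (fmap Drel_to_stab (fmap (Drel_shift A) z))
      (fmap (stab_dg_shift A) (fmap Drel_to_stab z)).
Proof.
elim: z => {X Y} [X|X Y Z f z IH|X Y Z w Ww z IH].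
- exact: heq_sym (fmap_id (stab_dg_shift A) X).
- apply: heq_trans _ (heq_sym (fmap_cmp (stab_dg_shift A) _ _)).
  exact: (heq_cmp IH (strict_functor_shift f)).
- apply: heq_trans _ (heq_sym (fmap_cmp (stab_dg_shift A) _ _)).
  apply: (heq_cmp IH).
  have [h1 h2] := chosen_inverseP strict_functor_rqi (CA_rqi_shift Ww).
  have [k1 k2] := chosen_inverseP strict_functor_rqi Ww.
  apply: inverse_unique h1 _.
  apply: heq_trans (heq_cmpl _ (strict_functor_shift w)) _.
  apply: heq_trans (heq_sym (fmap_cmp (stab_dg_shift A) _ _)) _.
  exact: heq_trans (fmap_heq (stab_dg_shift A) k2) (fmap_id (stab_dg_shift A) X).
Qed.

Lemma opp_shift_natural :
  @nat_iso (Drel_cat A) (stab_dg_cat A)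
    (comp_functor Drel_to_stab (Drel_shift A))
    (comp_functor (stab_dg_shift A) Drel_to_stab) (fun X => opp_iso (dg_shift X)).
Proof.
split=> [X|X Y z]; first by exists (opp_iso (dg_shift X)); split; apply: opp_isoK.
apply: heq_trans (heq_cmpr _ (Drel_to_stab_shift z)) _.
exact: opp_iso_natural.
Qed.

(** The cone of f is the cokernel of x |-> (f x, (x, 0)), so that (0, (x1, 0))
    becomes - f x1, whence the formula for cyl_proj. *)
Section ConeTriangle.
Variables (X Y : dgMod A) (f : strictHom X Y).

Let M : dgMod A := dsum Y (dg_hull X).
Let i : strictHom X M := @dsum_pair k A Y (dg_hull X) X f (cone_inc (strict_id X)).
Let N : dgMod A := dg_cone f.

Lemma cyl_proj_lin : linear (fun z : M => (z.1 - f z.2.1, - z.2.2) : N).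
Proof.
move=> c x y; rewrite -[RHS]/(_ + _, c *: - x.2.2 - y.2.2) /=.
by rewrite (sh_lin f) !opprD scalerDr !scalerN addrACA.
Qed.

Lemma cyl_proj_deg n (z : M) : gdeg n z -> @gdeg k N n (z.1 - f z.2.1, - z.2.2).
Proof.
move=> [hy [h1 h2]]; split=> /=.
  by apply: gdegD hy _; rewrite -scaleN1r; apply/gdegZ/sh_deg.
by rewrite -scaleN1r; apply: (@gdegZ k (gshift X)).
Qed.

Lemma cyl_proj_am (z : M) s : ((am M z s).1 - f (am M z s).2.1, - (am M z s).2.2) =
  am N (z.1 - f z.2.1, - z.2.2) s.
Proof.
rewrite dsum_am; case: z => y [x1 x2]; rewrite /= /cone_am /=.
have ly := fam_lin (am_fam Y) s; have lx := fam_lin (am_fam X) s.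
rewrite (linB ly) /sfam (linN lx) scalerN (linD (sh_lin f)) sh_am; congr (_, _).
by case: s {ly lx} => [|a s] /=; rewrite ?(linN (sh_lin f)) ?(lin0 (sh_lin f)); zmodule.
Qed.

Definition cyl_proj : strictHom M N := StrictHom cyl_proj_lin cyl_proj_deg cyl_proj_am.
Let e : strictHom N (dg_shift X) :=
  strict_comp (strict_opp (dg_shift X)) (cone_proj f).

Lemma strict_famcomp (L1 : ainfMod A) (L2 L3 : gmod k) (g : L1 -> L2) (l : L2 -> L3) x s :
  l 0 = 0 ->
  famcomp 0 (fun x (s : seq A) => if s is [::] then l x else 0)
    (fun x (s : seq A) => if s is [::] then g x else 0) x s =
  if s is [::] then l (g x) else 0.
Proof.
move=> l0; rewrite comp_strictl; first by case: s.
by move=> y [|a u].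
Qed.

(** The splittings are (y, (x1, x')) |-> x1 and (y, x') |-> (y, (0, - x')). *)
Lemma cone_conflation : conflation eps (ainf_of_strict i) (ainf_of_strict cyl_proj).
Proof.
pose r0 (z : M) : X := z.2.1.
pose s0 (z : N) : M := (z.1, (0, - z.2)).
exists (fun z s => if s is [::] then r0 z else 0), (fun z s => if s is [::] then s0 z else 0).
have s0l : linear s0.
  move=> c x y; rewrite /s0 -[RHS]/(_, (c *: 0 + 0, c *: - x.2 - y.2)).
  by rewrite scaler0 addr0 scalerN -opprD.
split.
- split=> [[|a s] c x y|x [|b u] v c a1 a2|p x [|t0 t] hx ht] //=;
    rewrite ?scaler0 ?addr0 //; try exact: gdeg0.
  by rewrite tdeg_nil !addr0 ?subr0; case: hx => _ [].
- split=> [[|a s] c x y|x [|b u] v c a1 a2|p x [|t0 t] hx ht] //=;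
    rewrite ?scaler0 ?addr0 //; [exact: s0l | | exact: (gdeg0 M)].
  rewrite tdeg_nil !addr0 ?subr0; case: hx => h1 h2; split=> //; split; first exact: gdeg0.
  suff: @gdeg k (gshift X) p (- x.2) by [].
  by rewrite -scaleN1r; apply: gdegZ.
- by move=> x s _; rewrite (@strict_famcomp X M X i r0) //; case: s.
- move=> x s _; rewrite (@strict_famcomp N M N s0 cyl_proj) ?(lin0 (sh_lin cyl_proj)) //.
  by case: s => //=; rewrite (lin0 (sh_lin f)) subr0 opprK; case: x.
- move=> z s _.
  rewrite (@strict_famcomp M X M r0 i) ?(lin0 (sh_lin i)) //.
  rewrite (@strict_famcomp M N M cyl_proj s0) ?(lin0 s0l) //.
  case: s => [|a s] /=; last by rewrite addr0.
  case: z => y [x1 x2].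
  rewrite -[LHS]/(f x1 + (y - f x1), (x1 + 0, 0 - - x2)).
  by rewrite addrC subrK addr0 sub0r opprK.
Qed.

Lemma cone_standard_triangle :
  standard_triangle eps (ainf_of_strict i) (ainf_of_strict cyl_proj) (ainf_of_strict e).
Proof.
split; first exact: cone_conflation.
exists (ainf_of_strict (dsum_snd Y (dg_hull X))); split=> x s.
  by apply: etrans (@strict_famcomp X M (dg_hull X) i snd x s erefl) _; case: s.
apply: etrans (@strict_famcomp M N (dg_shift X) cyl_proj e x s (lin0 (sh_lin e))) _.
apply: esym; apply: etrans (@strict_famcomp M (dg_hull X) (dg_shift X) snd snd x s erefl) _.
by case: s => //=; rewrite add0r scaleN1r opprK.
Qed.

(** The projection of the cylinder to Y identifies the standard triangle with
    the triangle of the cone, up to the sign of the last morphism. *)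
Lemma cone_triangle_iso :
  @iso_triangle (stab_cat A) (stab_shift A) X M N (ainf_of_strict i)
    (ainf_of_strict cyl_proj) (ainf_of_strict e) X Y N
    (ainf_of_strict f) (ainf_of_strict (cone_inc f)) (ainf_of_strict e).
Proof.
pose pi : strictHom M Y := dsum_fst Y (dg_hull X).
pose b : strictHom Y M := @dsum_pair k A Y (dg_hull X) Y (strict_id Y) (strict_zero Y (dg_hull X)).
have ipi : @is_iso (stab_cat A) M Y (ainf_of_strict pi).
  exact: strict_functor_rqi (dsum_fst_rqi Y X).
have pib : @heq (stab_cat A) Y Y (ainf_comp (ainf_of_strict pi) (ainf_of_strict b)) (ainf_id Y).
  apply: homotopic_trans (homotopic_sym (ainf_of_strict_comp pi b)) _.
  exact: (@ainf_of_strict_heq Y Y).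
exists (ainf_id X), (ainf_of_strict pi), (ainf_id N); split.
  by split=> //; apply: (iso_id (C := stab_cat A)).
split.
- apply: homotopic_trans (homotopic_sym (ainf_of_strict_comp pi i)) _.
  apply: homotopic_sym; apply: homotopic_trans (stab_cmpm1 _) _.
  exact: (@ainf_of_strict_heq X Y).
- apply: homotopic_trans (stab_cmp1m _) _.
  apply: homotopic_sym.
  apply: (iso_epi (C := stab_cat A) (f := ainf_of_strict b)).
    exact: iso_inv (iso_sectionK ipi pib) pib.
  apply: homotopic_trans (homotopic_sym (stab_cmpA _ _ _)) _.
  apply: homotopic_trans (stab_heq_cmp (homotopic_refl _) pib) _.
  apply: homotopic_trans (stab_cmpm1 _) _.
  apply: homotopic_trans _ (ainf_of_strict_comp cyl_proj b).
  apply: (@ainf_of_strict_heq Y N) => y.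
  by rewrite /= (lin0 (sh_lin f)) subr0 oppr0.
- apply: homotopic_trans _ (homotopic_sym (stab_cmpm1 _)).
  exact: homotopic_trans (stab_heq_cmp (shift_hom_id X) (homotopic_refl _)) (stab_cmp1m _).
Qed.
End ConeTriangle.

Lemma iso_triangle_trans (C : category) (S : functor C C)
    (X Y Z X' Y' Z' X'' Y'' Z'' : C)
    (u : hom X Y) (v : hom Y Z) (w : hom Z (S X))
    (u' : hom X' Y') (v' : hom Y' Z') (w' : hom Z' (S X'))
    (u'' : hom X'' Y'') (v'' : hom Y'' Z'') (w'' : hom Z'' (S X'')) :
  iso_triangle u v w u' v' w' -> iso_triangle u' v' w' u'' v'' w'' ->
  iso_triangle u v w u'' v'' w''.
Proof.
move=> [a [b [c [[ia ib ic] [e1 e2 e3]]]]] [a' [b' [c' [[ia' ib' ic'] [e1' e2' e3']]]]].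
exists (cmp a' a), (cmp b' b), (cmp c' c); split; first by split; apply: iso_comp.
have paste (U V U' V' U'' V'' : C) (s : hom U V) (s' : hom U' V') (s'' : hom U'' V'')
    (l : hom U U') (r : hom V V') (l' : hom U' U'') (r' : hom V' V'') :
    heq (cmp r s) (cmp s' l) -> heq (cmp r' s') (cmp s'' l') ->
    heq (cmp (cmp r' r) s) (cmp s'' (cmp l' l)).
  move=> h h'; apply: heq_trans (heq_sym (cmpA _ _ _)) _.
  apply: heq_trans (heq_cmpr _ h) _; apply: heq_trans (cmpA _ _ _) _.
  exact: heq_trans (heq_cmpl _ h') (heq_sym (cmpA _ _ _)).
split; [exact: paste e1 e1' | exact: paste e2 e2' |].
apply: heq_trans (heq_cmpl _ (fmap_cmp S _ _)) _.
exact: paste e3 e3'.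
Qed.

Lemma Drel_to_stab_triangle (X Y Z : Drel_cat A)
    (u : hom X Y) (v : hom Y Z) (w : hom Z (Drel_shift A X)) :
  Drel_triangle u v w ->
  @triangle (stab_dg eps) X Y Z (fmap Drel_to_stab u) (fmap Drel_to_stab v)
    (cmp (opp_iso (dg_shift X)) (fmap Drel_to_stab w)).
Proof.
move=> [X' [Y' [f [a [b [c [[ia ib ic] [e1 e2 e3]]]]]]]].
exists X', (dsum Y' (dg_hull X')), (dg_cone f).
do 3!eexists; split; first exact: cone_standard_triangle f.
apply: iso_triangle_trans (cone_triangle_iso f) _.
pose F := Drel_to_stab.
have sq (U V U' V' : Drel_cat A) (s : @hom (CA A) U V) (l : @hom (Drel_cat A) U U')
    (r : @hom (Drel_cat A) V V') (s' : @hom (Drel_cat A) U' V') :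
    heq (cmp r (loc s)) (cmp s' l) ->
    heq (cmp (fmap F r) (fmap strict_functor s)) (cmp (fmap F s') (fmap F l)).
  move=> h; apply: heq_trans _ (fmap_cmp F s' l).
  apply: heq_trans (heq_cmpr _ (heq_sym (cmp1m _))) _.
  exact: heq_trans (heq_sym (fmap_cmp F r (loc s))) (fmap_heq F h).
exists (fmap F a), (fmap F b), (fmap F c); split.
  by split; apply: (@functor_iso _ _ F).
split; [exact: sq e1 | exact: sq e2 |].
have h3 := sq _ _ _ _ _ _ _ _ e3.
pose pr : @hom (CA A) (dg_cone f) (dg_shift X') := cone_proj f.
have Ee : @heq (stab_dg_cat A) _ _ (fmap strict_functor
      (cmp (strict_opp (dg_shift X') : @hom (CA A) _ _) pr))
    (cmp (opp_iso (dg_shift X')) (fmap strict_functor pr)).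
  exact: ainf_of_strict_comp.
suff H : @heq (stab_dg_cat A) _ _
    (cmp (fmap (stab_dg_shift A) (fmap F a))
      (cmp (opp_iso (dg_shift X')) (fmap strict_functor pr)))
    (cmp (cmp (opp_iso (dg_shift X)) (fmap F w)) (fmap F c)).
  exact: (@heq_trans (stab_dg_cat A) _ _ _ _ _ (heq_cmpr _ Ee) H).
apply: heq_trans (cmpA _ _ _) _.
apply: heq_trans (heq_cmpl _ (heq_sym (opp_iso_natural _))) _.
apply: heq_trans (heq_sym (cmpA _ _ _)) _.
apply: heq_trans _ (cmpA _ _ _); apply: heq_cmpr.
exact: heq_trans (heq_cmpl _ (heq_sym (Drel_to_stab_shift a))) h3.
Qed.
End Comparison.

Theorem mainTheorem13 (k : comPzRingType) (A : dgAlg k) (eps : augmentation A) :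
  triangle_equivalent (Drel A) (stab_dg eps).
Proof.
have U := Drel_to_stab_unit A; have V := Drel_to_stab_counit A.
exists (Drel_to_stab A), (fun X => opp_iso (dg_shift X)); split.
  split; [exact: equivalence_additive U V | exact: opp_shift_natural |].
  exact: Drel_to_stab_triangle.
by exists (stab_to_Drel A); do 2!eexists; split; [exact: U | exact: V].
Qed.
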